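(* Let $m\ge 2$, let $V$ be a real-valued potential with $V\in H^{m^*}_{\rm per}(\Omega)$, $m^*=\max\{m,5\}$, and for $\varepsilon\in(0,1]$ let $\psi=\psi(x,t)$ be the exact solution of $$i\partial_t\psi=-\Delta\psi+\varepsilon V(x)\psi \ \text{ on } \Omega=(a,b),\ t>0,$$ with periodic boundary conditions and $\psi(x,0)=\psi_0(x)$. Assume that for any $T>0$ the bounds $$\|\psi\|_{L^\infty([0,T/\varepsilon];H^m_{\rm per})}\lesssim 1,\qquad \|\partial_t\psi\|_{L^\infty([0,T/\varepsilon];H^{m-2}_{\rm per})}\lesssim 1$$ hold uniformly in $\varepsilon\in(0,1]$. Let $\psi^n$ be the numerical solution produced by the time-splitting Fourier pseudospectral (TSFP) method (defined in the context) with mesh size $h=(b-a)/N$ and time step $\tau>0$, and let $t_n=n\tau$. Then for any $0<\varepsilon\le 1$, $$\|\psi(\cdot,t_n)-I_N\psi^n\|_{L^2}\le (C_0+C_1\varepsilon t_n)\,\tilde C(T)\,(h^m+\tau^2),\qquad 0\le n\le \frac{T/\varepsilon}{\tau},$$ where $C_0,C_1$ are two positive constants independent of $h,\tau,n,\varepsilon$ and $T$, and $\tilde C(T)$ (independent of $h,\tau,n,\varepsilon$) depends on $\|\psi\|_{L^\infty([0,T/\varepsilon];H^m)}$ and $\|V\|_{H^{m^*}}$.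
   Context: Notation: $\Omega=(a,b)$, $\mu_l=\frac{2\pi l}{b-a}$ for $l\in\mathbb Z$, $\Delta=\partial_{xx}$. $H^m_{\rm per}(\Omega)=\{\phi\in H^m(\Omega):\partial_x^k\phi(a)=\partial_x^k\phi(b),\ k=0,\dots,m-1\}$ with norm $\|\phi\|_{H^m}=\big(\sum_{l\in\mathbb Z}(1+\mu_l^2)^m|\widehat\phi_l|^2\big)^{1/2}$, where $\widehat\phi_l=\frac1{b-a}\int_a^b\phi(x)e^{-i\mu_l(x-a)}dx$. $A\lesssim B$ means $|A|\le CB$ with a constant $C>0$ independent of $h$, $\tau$ and $\varepsilon$. Spatial discretization: $N$ is an even positive integer, $h=(b-a)/N$, $x_j=a+jh$ for $j=0,\dots,N$, $\mathcal T_N=\{-N/2,\dots,N/2-1\}$, $X_N=\{u=(u_0,\dots,u_N)^T\in\mathbb C^{N+1}:u_0=u_N\}$, $Y_N={\rm span}\{e^{i\mu_l(x-a)}:l\in\mathcal T_N\}$. For $u\in X_N$ (or for a continuous periodic function $u$, with $u_j=u(x_j)$) put $\widetilde u_l=\frac1N\sum_{j=0}^{N-1}u_je^{-i\mu_l(x_j-a)}$ and $I_Nu=\sum_{l\in\mathcal T_N}\widetilde u_le^{i\mu_l(x-a)}\in Y_N$ (trigonometric interpolation). TSFP method (Strang splitting): $\psi^0_j=\psi_0(x_j)$ and, for $n\ge0$, $j=0,\dots,N$, $$\psi^{(1)}_j=\sum_{l\in\mathcal T_N}e^{-i\tau\mu_l^2/2}\,\widetilde{(\psi^n)}_l\,e^{i\mu_l(x_j-a)},\quad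 \psi^{(2)}_j=e^{-i\varepsilon\tau V(x_j)}\psi^{(1)}_j,\quad \psi^{n+1}_j=\sum_{l\in\mathcal T_N}e^{-i\tau\mu_l^2/2}\,\widetilde{(\psi^{(2)})}_l\,e^{i\mu_l(x_j-a)},$$ with $\psi^n=(\psi^n_0,\dots,\psi^n_N)^T\in X_N$. *)

(* Defs.v *)
From mathcomp Require Import all_boot all_order all_algebra.
From mathcomp Require Import complex.
From mathcomp Require Import all_classical all_reals all_analysis.

Set Implicit Arguments.
Unset Strict Implicit.
Unset Printing Implicit Defensive.

Import Order.TTheory GRing.Theory Num.Theory.
Import numFieldNormedType.Exports.
Import complex.ComplexField.Normc.

Local Open Scope classical_set_scope.
Local Open Scope ring_scope.
Local Open Scope complex_scope.

Section Definitions.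
Context {R : realType}.
Implicit Types (a b : R) (f g : R -> R[i]).

Definition expi (theta : R) : R[i] := cos theta +i* sin theta.

Definition ofreal (V : R -> R) : R -> R[i] := fun x => (V x)%:C.

Definition freq a b (l : int) : R := 2 * pi * l%:~R / (b - a).

Definition cintegral a b f : R[i] :=
  (\int[lebesgue_measure]_(x in `]a, b[) complex.Re (f x))
  +i* (\int[lebesgue_measure]_(x in `]a, b[) complex.Im (f x)).

Definition L2norm a b f : \bar R :=
  sqrte (\int[lebesgue_measure]_(x in `]a, b[) ((normc (f x)) ^+ 2)%:E)%E.

Definition L2 a b f : Prop :=
  [/\ measurable_fun `]a, b[ (fun x => complex.Re (f x)),
      measurable_fun `]a, b[ (fun x => complex.Im (f x))
    & (L2norm a b f < +oo)%E].

(* Test functions are taken in C^1_c(a, b), as is usual in one dimension;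
   this gives the same weak derivatives as C^oo_c(a, b). *)
Definition test_function a b (chi : R -> R) : Prop :=
  [/\ forall x, derivable chi x 1,
      continuous (derive1 chi)
    & exists c d, [/\ a < c, d < b & forall x, x \notin `[c, d] -> chi x = 0]].

Definition weak_derivative a b f g : Prop :=
  forall chi, test_function a b chi ->
    cintegral a b (fun x => f x * (derive1 chi x)%:C)
    = - cintegral a b (fun x => g x * (chi x)%:C).

Definition continuous_on a b f : Prop :=
  {within `[a, b], continuous (fun x => complex.Re (f x))} /\
  {within `[a, b], continuous (fun x => complex.Im (f x))}.

(* [D k] is the k-th weak derivative of [phi]. For k < m it lies in H^1(a, b),
   and it is taken to be its representative continuous on [a, b], so that its
   values at the endpoints make sense. In particular, if m > 0 then [phi] itself
   is the continuous representative, and may be sampled at points. *)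
Definition Hper_derivatives a b (m : nat) (phi : R -> R[i])
    (D : nat -> R -> R[i]) : Prop :=
  [/\ {in `[a, b], D 0%N =1 phi},
      forall k, (k <= m)%N -> L2 a b (D k),
      forall k, (k < m)%N -> weak_derivative a b (D k) (D k.+1)
    & forall k, (k < m)%N -> continuous_on a b (D k) /\ D k a = D k b].

Definition Hper a b (m : nat) (phi : R -> R[i]) : Prop :=
  exists D, Hper_derivatives a b m phi D.

Definition fourier_coef a b (phi : R -> R[i]) (l : int) : R[i] :=
  ((b - a)^-1)%:C *
  cintegral a b (fun x => phi x * expi (- (freq a b l * (x - a)))).

Definition Hnorm a b (m : nat) (phi : R -> R[i]) : \bar R :=
  sqrte (\esum_(l in [set: int])
    ((1 + freq a b l ^+ 2) ^+ m * normc (fourier_coef a b phi l) ^+ 2)%:E).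

(* u : [0, S] -> H^m_per with || u ||_{L^oo([0, S]; H^m_per)} <= M *)
Definition Linfty_Hper_le a b (m : nat) (S : R) (u : R -> R -> R[i]) (M : R) :
    Prop :=
  {ae lebesgue_measure, forall t, t \in `[0, S] ->
    Hper a b m (u t) /\ (Hnorm a b m (u t) <= M%:E)%E}.

(* The periodic Schroedinger equation
      i d_t psi = - d_xx psi + eps V psi,   psi(0) = psi0,
    in the sense of strong solutions: psi is an L^2-valued function of time,
    continuous at 0, with values in H^2_per (the domain of the Laplacian with
    periodic boundary conditions), and its time derivative [dpsi] is the limit of
    the difference quotients in L^2. *)
Definition exact_solution a b (V : R -> R) (eps : R) (psi0 : R -> R[i])
    (psi dpsi : R -> R -> R[i]) : Prop :=
  [/\ {in `[a, b], psi 0 =1 psi0},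
      forall t, 0 <= t -> Hper a b 2 (psi t),
      L2norm a b (fun x => psi s x - psi 0 x) @[s --> 0^'+] --> 0%E,
      forall t, 0 < t ->
        L2 a b (dpsi t) /\
        L2norm a b (fun x => (s^-1)%:C * (psi (t + s) x - psi t x) - dpsi t x)
          @[s --> 0^'] --> 0%E
    & forall t, 0 < t ->
        exists2 D, Hper_derivatives a b 2 (psi t) D &
          {ae lebesgue_measure, forall x, x \in `]a, b[ ->
            'i%C * dpsi t x = - D 2%N x + (eps * V x)%:C * psi t x}].

Section Grid.
Variables (a b : R) (N : nat).

Definition mesh : R := (b - a) / N%:R.

Definition node (j : nat) : R := a + j%:R * mesh.

(* the k-th element of T_N = {-N/2, ..., N/2 - 1}, for k < N *)
Definition mode (k : nat) : int := k%:Z - (N./2)%:Z.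

(* Elements of X_N are columns (u_0, ..., u_N); the constraint u_0 = u_N holds
   for all the grid functions below, and u_N is not used by the transform. *)
Definition discrete_coef (u : 'cV[R[i]]_N.+1) (l : int) : R[i] :=
  N%:R^-1 * \sum_(j < N) u (widen_ord (leqnSn N) j) 0 *
                         expi (- (freq a b l * (node j - a))).

Definition interpolant (u : 'cV[R[i]]_N.+1) (x : R) : R[i] :=
  \sum_(k < N) discrete_coef u (mode k) *
               expi (freq a b (mode k) * (x - a)).

Definition sample (f : R -> R[i]) : 'cV[R[i]]_N.+1 := \col_j f (node j).

Definition kinetic_half_step (tau : R) (u : 'cV[R[i]]_N.+1) : 'cV[R[i]]_N.+1 :=
  \col_j \sum_(k < N) expi (- (tau * freq a b (mode k) ^+ 2 / 2)) *
                      discrete_coef u (mode k) *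
                      expi (freq a b (mode k) * (node j - a)).

Definition potential_step (V : R -> R) (eps tau : R) (u : 'cV[R[i]]_N.+1) :
    'cV[R[i]]_N.+1 :=
  \col_j (expi (- (eps * tau * V (node j))) * u j 0).

Definition strang_step (V : R -> R) (eps tau : R) (u : 'cV[R[i]]_N.+1) :
    'cV[R[i]]_N.+1 :=
  kinetic_half_step tau (potential_step V eps tau (kinetic_half_step tau u)).

Definition tsfp (V : R -> R) (eps tau : R) (psi0 : R -> R[i]) (n : nat) :
    'cV[R[i]]_N.+1 :=
  iter n (strang_step V eps tau) (sample psi0).

End Grid.

End Definitions.

(* Main.v *)
(** In terms of the Fourier coefficients c_l(t) of psi(t), the equation reads
    c' = -i (mu_l^2 c + eps (V psi)^), and the H^m bound is a weighted l^2 bound on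
    c. Passing to the interaction picture centred at the midpoint of a step and
    undoing the potential flow on the grid turns the local error into the integral
    over the step of eps times a commutator of V with the kinetic phase. The part
    of this commutator linear in the distance to the midpoint is integrated by
    parts: only its time derivative, again O(eps), remains. The quadratic remainder
    is O(tau^2) and falls on V as four derivatives in l^1, hence the H^5 bound on
    V; aliasing adds O(h^m). Both substeps are isometries of the discrete l^2 norm,
    so the local errors eps tau O(h^m + tau^2) add up. The solution is related to
    its grid values by uniform convergence of its Fourier series, and the bounds,
    assumed for almost every time, extend to all times by continuity of c. *)

Require Import Defs.
From mathcomp Require Import all_boot all_order all_algebra.
From mathcomp Require Import complex.
From mathcomp Require Import all_classical all_reals all_analysis.
From mathcomp Require Import measurable_realfun.
From mathcomp Require Import ring lra zify.

Import Order.TTheory GRing.Theory Num.Theory.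
Import numFieldNormedType.Exports.
Import complex.ComplexField.Normc.

Local Open Scope ring_scope.
Local Open Scope complex_scope.

Set Implicit Arguments.
Unset Strict Implicit.
Unset Printing Implicit Defensive.

Local Notation Re := (@complex.Re _).
Local Notation Im := (@complex.Im _).

(** * Complex-valued functions of a real variable *)

(** The obstacle is that psi has only two derivatives, whereas a Strang error of order tau^2
    normally costs a double commutator with the Laplacian, that is, four derivatives. Shifting a
    frequency by mu_j changes its modulus by at most that of mu_j, so a difference of squared
    frequencies grows at most linearly in the frequency of psi; its square costs two derivatives of
    psi and four of V. Summing four derivatives of V in l^1 takes a fifth by Cauchy-Schwarz. On the
    grid the shift is modulo N, and representatives of least modulus keep the same bound. The
    midpoint is chosen because (s - tau/2)^2 / 2, the antiderivative of the linear weight, has equal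
    values at both ends of a step: the boundary terms merge into an increment of a quantity whose
    derivative is O(eps^2). Only finite sums are manipulated. V is replaced by a partial Fourier sum
    over (2P+1)N modes, a whole number of residue blocks, and the truncation error [del] tends to 0
    while N and tau are fixed, so its factors may depend on N in any way. *)

Lemma le_of_eq {R : realType} (x y : R) : x = y -> x <= y.
Proof. by move=> ->. Qed.

Section ComplexNumbers.
Context {R : realType}.
Implicit Types (x y t : R) (z w : R[i]).

Lemma ReD z w : Re (z + w) = Re z + Re w.
Proof. by case: z w => [? ?] [? ?]. Qed.

Lemma ImD z w : Im (z + w) = Im z + Im w.
Proof. by case: z w => [? ?] [? ?]. Qed.

Lemma ReN z : Re (- z) = - Re z.
Proof. by case: z. Qed.

Lemma ImN z : Im (- z) = - Im z.
Proof. by case: z. Qed.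

Lemma ReM z w : Re (z * w) = Re z * Re w - Im z * Im w.
Proof. by case: z w => [? ?] [? ?]. Qed.

Lemma ImM z w : Im (z * w) = Re z * Im w + Im z * Re w.
Proof. by case: z w => [? ?] [? ?]. Qed.

Lemma Re_sum (I : Type) (r : seq I) (P : pred I) (F : I -> R[i]) :
  Re (\sum_(i <- r | P i) F i) = \sum_(i <- r | P i) Re (F i).
Proof. exact: (big_morph _ ReD (erefl : Re (0 : R[i]) = 0)). Qed.

Lemma complex_eq z w : Re z = Re w -> Im z = Im w -> z = w.
Proof. by case: z w => [a b] [c d] /= -> ->. Qed.

Lemma sqr_normcE z : normc z ^+ 2 = Re z ^+ 2 + Im z ^+ 2.
Proof. by case: z => a b /=; rewrite sqr_sqrtr // addr_ge0 ?sqr_ge0. Qed.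

Lemma normc_ge0 z : 0 <= normc z.
Proof. by case: z => a b /=; rewrite sqrtr_ge0. Qed.

Lemma normc_real x : normc (x%:C) = `|x|.
Proof. by rewrite /= expr0n addr0 sqrtr_sqr. Qed.

Lemma normcX z n : normc (z ^+ n) = normc z ^+ n.
Proof.
elim: n => [|n IHn]; first by rewrite !expr0 normc1.
by rewrite !exprS normcM IHn.
Qed.

Lemma normcB z w : normc (z - w) <= normc z + normc w.
Proof. by rewrite -(normcN w) le_normcD. Qed.

Lemma normc_subC z w : normc (z - w) = normc (w - z).
Proof. by rewrite -opprB normcN. Qed.

Lemma normc_sum (I : Type) (r : seq I) (P : pred I) (F : I -> R[i]) :
  normc (\sum_(i <- r | P i) F i) <= \sum_(i <- r | P i) normc (F i).
Proof.
elim/big_rec2: _ => [|i u v _ le_uv]; first by rewrite normc0.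
by rewrite (le_trans (le_normcD _ _)) // lerD2l.
Qed.

Lemma normc_le_ReIm z : normc z <= `|Re z| + `|Im z|.
Proof.
rewrite -(ler_pXn2r (n := 2)) ?nnegrE ?addr_ge0 ?normc_ge0 //.
rewrite sqr_normcE sqrrD -(real_normK (num_real (Re z))).
rewrite -(real_normK (num_real (Im z))) lerD2r lerDl.
by rewrite mulrn_wge0 // mulr_ge0.
Qed.

Lemma Re_le_normc z : `|Re z| <= normc z.
Proof.
rewrite -(ler_pXn2r (n := 2)) ?nnegrE ?normc_ge0 //.
by rewrite real_normK ?num_real // sqr_normcE lerDl sqr_ge0.
Qed.

Lemma Im_le_normc z : `|Im z| <= normc z.
Proof.
rewrite -(ler_pXn2r (n := 2)) ?nnegrE ?normc_ge0 //.
by rewrite real_normK ?num_real // sqr_normcE lerDr sqr_ge0.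
Qed.

Lemma normc_conj z : normc (conjc z) = normc z.
Proof. by case: z => a b; rewrite /normc /= sqrrN. Qed.

Lemma conjcM z w : conjc (z * w) = conjc z * conjc w.
Proof. exact: rmorphM. Qed.

Lemma conjcD z w : conjc (z + w) = conjc z + conjc w.
Proof. exact: rmorphD. Qed.

Lemma conjcN z : conjc (- z) = - conjc z.
Proof. exact: rmorphN. Qed.

Lemma conjc_sum (I : Type) (r : seq I) (P : pred I) (F : I -> R[i]) :
  conjc (\sum_(i <- r | P i) F i) = \sum_(i <- r | P i) conjc (F i).
Proof. exact: rmorph_sum. Qed.

Lemma mul_conjc z : z * conjc z = (normc z ^+ 2)%:C.
Proof.
apply: complex_eq; rewrite ?ReM ?ImM.
  by rewrite [RHS]sqr_normcE; case: z => a b /=; rewrite mulrN opprK.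
by case: z => a b /=; rewrite mulrN mulrC addNr.
Qed.

Lemma expiD x y : expi (x + y) = expi x * expi y.
Proof.
by apply: complex_eq; rewrite ?ReM ?ImM /= ?cosD ?sinD // addrC [cos x * _]mulrC.
Qed.

Lemma expi0 : expi (0 : R) = 1.
Proof. by rewrite /expi cos0 sin0. Qed.

Lemma normc_expi x : normc (expi x) = 1.
Proof. by rewrite /= cos2Dsin2 sqrtr1. Qed.

Lemma conjc_expi x : conjc (expi x) = expi (- x).
Proof. by rewrite /expi /= cosN sinN. Qed.

Lemma expiNK x : expi (- x) * expi x = 1.
Proof. by rewrite -expiD addNr expi0. Qed.

Lemma expi_pi_nat n : expi (pi *+ 2 * n%:R : R) = 1.
Proof.
elim: n => [|n IHn]; first by rewrite mulr0 expi0.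
by rewrite -natr1 mulrDr mulr1 expiD IHn mul1r /expi cos2pi sin2pi.
Qed.

Lemma expi_pi_int (l : int) : expi (pi *+ 2 * l%:~R : R) = 1.
Proof.
case: l => n; first exact: expi_pi_nat.
rewrite NegzE mulrNz mulrN; have := expiNK (pi *+ 2 * n.+1%:R : R).
by rewrite expi_pi_nat mulr1.
Qed.

Lemma is_derive_expi (k : R) t :
  is_derive t 1 (fun s => cos (k * s)) (- (k * sin (k * t))) /\
  is_derive t 1 (fun s => sin (k * s)) (k * cos (k * t)).
Proof.
have dk : is_derive t 1 (fun s : R => k * s) k.
  by apply: is_derive_eq; rewrite ?scaler0 ?addr0 ?mulr1 // /GRing.scale /= mulr1.
split.
  have := @is_derive1_comp R cos (fun s => k * s) t _ _ (is_derive_cos _) dk.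
  by rewrite mulNr mulrC.
have := @is_derive1_comp R sin (fun s => k * s) t _ _ (is_derive_sin _) dk.
by rewrite mulrC.
Qed.

(* The derivative of a complex-valued function of a real variable, taken
   componentwise because [R[i]] carries no normed module structure over [R]. *)
Definition is_cderive (f : R -> R[i]) t (d : R[i]) : Prop :=
  is_derive t 1 (fun s => Re (f s)) (Re d) /\
  is_derive t 1 (fun s => Im (f s)) (Im d).

Definition ccontinuous (f : R -> R[i]) : Prop :=
  continuous (fun s => Re (f s)) /\ continuous (fun s => Im (f s)).

Lemma is_cderive_eq f t d d' : is_cderive f t d -> d = d' -> is_cderive f t d'.
Proof. by move=> ? <-. Qed.

Lemma is_cderive_cst z t : is_cderive (fun=> z) t 0.
Proof. by split; exact: is_derive_cst. Qed.

Lemma is_cderiveD f g t df dg : is_cderive f t df -> is_cderive g t dg ->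
  is_cderive (fun s => f s + g s) t (df + dg).
Proof.
move=> [fr fi] [gr gi]; split.
  rewrite ReD; under eq_fun do rewrite ReD.
  exact: (is_deriveD fr gr).
rewrite ImD; under eq_fun do rewrite ImD.
exact: (is_deriveD fi gi).
Qed.

Lemma is_cderiveM f g t df dg : is_cderive f t df -> is_cderive g t dg ->
  is_cderive (fun s => f s * g s) t (df * g t + f t * dg).
Proof.
move=> [fr fi] [gr gi]; split.
  under eq_fun do rewrite ReM.
  have h := is_deriveB (is_deriveM fr gr) (is_deriveM fi gi).
  apply: (is_derive_eq h); rewrite /GRing.scale /= !(ReD, ReM); ring.
under eq_fun do rewrite ImM.
have h := is_deriveD (is_deriveM fr gi) (is_deriveM fi gr).
by apply: (is_derive_eq h); rewrite /GRing.scale /= !(ImD, ImM); ring.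
Qed.

Lemma is_cderiveZ z f t df : is_cderive f t df ->
  is_cderive (fun s => z * f s) t (z * df).
Proof.
move=> fd; apply: is_cderive_eq; first exact: is_cderiveM (is_cderive_cst z t) fd.
by rewrite mul0r add0r.
Qed.

Lemma is_cderive_sum n (f : 'I_n -> R -> R[i]) t (df : 'I_n -> R[i]) :
  (forall i, is_cderive (f i) t (df i)) ->
  is_cderive (fun s => \sum_(i < n) f i s) t (\sum_(i < n) df i).
Proof.
elim: n f df => [|n IHn] f df fd.
  rewrite big_ord0; under eq_fun do rewrite big_ord0.
  exact: is_cderive_cst.
rewrite big_ord_recr /=; under eq_fun do rewrite big_ord_recr /=.
by apply: is_cderiveD => //; exact: IHn.
Qed.

Lemma is_cderive_expi (k : R) t :
  is_cderive (fun s => expi (k * s)) t ('i%C * k%:C * expi (k * t)).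
Proof.
have [dc ds] := is_derive_expi k t; split; rewrite ?ReM ?ImM /=.
  by apply: (is_derive_eq dc); ring.
by apply: (is_derive_eq ds); ring.
Qed.

Lemma is_cderive_real (f : R -> R) t df : is_derive t 1 f df ->
  is_cderive (fun s => (f s)%:C) t df%:C.
Proof. by move=> fd; split => //=; exact: is_derive_cst. Qed.

Lemma ccontinuous_cst z : ccontinuous (fun=> z).
Proof. by split=> x; exact: cvg_cst. Qed.

Lemma ccontinuousD f g : ccontinuous f -> ccontinuous g ->
  ccontinuous (fun s => f s + g s).
Proof.
move=> [fr fi] [gr gi]; split=> x.
  under eq_fun do rewrite ReD.
  by apply: cvgD; [exact: fr|exact: gr].
under eq_fun do rewrite ImD.
by apply: cvgD; [exact: fi|exact: gi].
Qed.

Lemma ccontinuousM f g : ccontinuous f -> ccontinuous g ->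
  ccontinuous (fun s => f s * g s).
Proof.
move=> [fr fi] [gr gi]; split=> x.
  under eq_fun do rewrite ReM.
  by apply: cvgB; apply: cvgM; [exact: fr|exact: gr|exact: fi|exact: gi].
under eq_fun do rewrite ImM.
by apply: cvgD; apply: cvgM; [exact: fr|exact: gi|exact: fi|exact: gr].
Qed.

Lemma ccontinuous_sum n (f : 'I_n -> R -> R[i]) :
  (forall i, ccontinuous (f i)) -> ccontinuous (fun s => \sum_(i < n) f i s).
Proof.
elim: n f => [|n IHn] f fc.
  by under eq_fun do rewrite big_ord0; exact: ccontinuous_cst.
under eq_fun do rewrite big_ord_recr /=.
by apply: ccontinuousD => //; exact: IHn.
Qed.

Lemma ccontinuous_expi (k : R) : ccontinuous (fun s => expi (k * s)).
Proof.
have kc : continuous (fun s : R => k * s).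
  by move=> x; apply: cvgM; [exact: cvg_cst|exact: cvg_id].
split=> x /=.
  by apply: (continuous_comp (kc x)); exact: continuous_cos.
by apply: (continuous_comp (kc x)); exact: continuous_sin.
Qed.

Lemma ccontinuous_real (f : R -> R) : continuous f ->
  ccontinuous (fun s => (f s)%:C).
Proof. by move=> fc; split => // x; exact: cvg_cst. Qed.

Lemma le_dist_of_derive_bound (f df : R -> R) (B x y : R) :
  (forall t, is_derive t 1 f (df t)) ->
  (forall t, Num.min x y <= t <= Num.max x y -> `|df t| <= B) ->
  `|f y - f x| <= B * `|y - x|.
Proof.
move=> fd; have fc : continuous f.
  by move=> t; apply/differentiable_continuous/derivable1_diffP; case: (fd t).
wlog : x y / x <= y => [H|le_xy].
  case/orP: (le_total x y) => [/H//|yx B_df].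
  rewrite -normrN opprB -[X in _ * X]normrN opprB H // => t.
  by rewrite minC maxC; exact: B_df.
rewrite min_l ?max_r // => B_df.
have [c cxy ->] := MVT_segment le_xy (fun t _ => fd t) (continuous_subspaceT fc).
by rewrite normrM ler_wpM2r // B_df.
Qed.

Lemma cos_sub1_le x : `|cos x - 1| <= `|x|.
Proof.
have := @le_dist_of_derive_bound cos (fun t => - sin t) 1 0 x
  (fun t => is_derive_cos t).
rewrite cos0 subr0 mul1r; apply=> t _.
by rewrite normrN sin_max.
Qed.

(** The factor 2 is one for each component: by the mean value theorem, both derivatives are at most
    [|x|] on the segment from 0 to [x]. The sharp constant 1/2 is not sought. *)
Lemma normc_expi_sub1_sub x :
  normc (expi x - 1 - 'i%C * x%:C) <= 2 * x ^+ 2.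
Proof.
apply: (le_trans (normc_le_ReIm _)); rewrite !(ReD, ImD, ReN, ImN, ReM, ImM) /=.
have abst t : Num.min 0 x <= t <= Num.max 0 x -> `|t| <= `|x|.
  have [x0|x0] := leP 0 x => /andP[h1 h2].
    by rewrite (ger0_norm x0) ger0_norm.
  by rewrite (ltr0_norm x0) ler0_norm // lerN2.
have -> : cos x - 1 - (0 * x - 1 * 0) = cos x - cos 0 by rewrite cos0; ring.
have -> : sin x - 0 - (0 * 0 + 1 * x) = (sin x - x) - (sin 0 - 0).
  by rewrite sin0; ring.
rewrite mulr_natl mulr2n -(real_normK (num_real x)) expr2; apply: lerD.
  have := @le_dist_of_derive_bound cos (fun t => - sin t) `|x| 0 x
    (fun t => is_derive_cos t).
  rewrite subr0; apply=> t /abst; apply: le_trans; rewrite normrN.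
  have := @le_dist_of_derive_bound sin cos 1 0 t (fun t => is_derive_sin t).
  by rewrite sin0 !subr0 mul1r; apply=> ? _; exact: cos_max.
rewrite -[X in _ <= _ * `|X|]subr0.
apply: (@le_dist_of_derive_bound (fun t => sin t - t) (fun t => cos t - 1)).
by move=> t /abst; apply: le_trans; exact: cos_sub1_le.
Qed.

End ComplexNumbers.

(** * Finite sums and the l^2 norm of finite complex vectors *)

Section FiniteSums.
Context {R : realType}.

Lemma le_of_sqr (x y : R) : 0 <= y -> x ^+ 2 <= y ^+ 2 -> x <= y.
Proof.
move=> y0 xy; have [x0|/ltW x0] := leP 0 x; last exact: le_trans x0 y0.
by rewrite -(ler_pXn2r (n := 2)) ?nnegrE.
Qed.

Lemma cauchy_schwarz (I : Type) (r : seq I) (f g : I -> R) :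
  (\sum_(i <- r) f i * g i) ^+ 2 <=
  (\sum_(i <- r) f i ^+ 2) * (\sum_(i <- r) g i ^+ 2).
Proof.
elim: r => [|i r IHr]; first by rewrite !big_nil expr0n mulr0.
rewrite !big_cons; move: IHr.
set P := \sum_(j <- r) _ * _; set S := \sum_(j <- r) f j ^+ 2.
set T := \sum_(j <- r) g j ^+ 2 => IHr.
have S0 : 0 <= S by apply: sumr_ge0 => j _; exact: sqr_ge0.
have T0 : 0 <= T by apply: sumr_ge0 => j _; exact: sqr_ge0.
(* The cross term of the new square. Squaring both sides, the induction hypothesis bounds the left
   by 4 f^2 g^2 S T, and the arithmetic-geometric mean inequality for f^2 T and S g^2 concludes. *)
have cross : 2 * P * f i * g i <= f i ^+ 2 * T + S * g i ^+ 2.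
  apply: le_of_sqr; first by apply: addr_ge0; apply: mulr_ge0; rewrite ?sqr_ge0.
  have : (f i * g i) ^+ 2 * P ^+ 2 <= (f i * g i) ^+ 2 * (S * T).
    by rewrite ler_wpM2l ?sqr_ge0.
  move=> h1; have h2 := sqr_ge0 (f i ^+ 2 * T - S * g i ^+ 2); nra.
nra.
Qed.

Lemma cauchy_schwarz_sqrt (I : Type) (r : seq I) (f g : I -> R) :
  \sum_(i <- r) f i * g i <=
  Num.sqrt (\sum_(i <- r) f i ^+ 2) * Num.sqrt (\sum_(i <- r) g i ^+ 2).
Proof.
apply: le_of_sqr; first by rewrite mulr_ge0 ?sqrtr_ge0.
by rewrite exprMn !sqr_sqrtr ?cauchy_schwarz // sumr_ge0 // => i _; exact: sqr_ge0.
Qed.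

Definition n2 n (x : 'I_n -> R[i]) : R := Num.sqrt (\sum_i normc (x i) ^+ 2).

Variable n : nat.
Implicit Types x y : 'I_n -> R[i].

Lemma n2_ge0 x : 0 <= n2 x.
Proof. exact: sqrtr_ge0. Qed.

Lemma sqr_n2 x : n2 x ^+ 2 = \sum_i normc (x i) ^+ 2.
Proof. by rewrite sqr_sqrtr // sumr_ge0 // => i _; exact: sqr_ge0. Qed.

Lemma n2_leP x B : 0 <= B -> \sum_i normc (x i) ^+ 2 <= B ^+ 2 -> n2 x <= B.
Proof. by move=> B0 xB; rewrite -(ler_pXn2r (n := 2)) ?nnegrE ?n2_ge0 // sqr_n2. Qed.

Lemma n2_le x y : (forall i, normc (x i) <= normc (y i)) -> n2 x <= n2 y.
Proof.
move=> xy; apply: n2_leP; rewrite ?n2_ge0 // sqr_n2; apply: ler_sum => i _.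
by rewrite ler_pXn2r ?nnegrE ?normc_ge0.
Qed.

Lemma n2_eq x y : x =1 y -> n2 x = n2 y.
Proof. by move=> xy; congr Num.sqrt; apply: eq_bigr => i _; rewrite xy. Qed.

Lemma n2_0 : n2 (fun _ : 'I_n => 0) = 0.
Proof.
by rewrite /n2 big1 ?sqrtr0 // => i _; rewrite normc0 expr0n.
Qed.

(** The factor [n] is crude, the square root would do; the bound is applied only to truncation
    errors that can be made arbitrarily small for fixed [n]. *)
Lemma n2_cst_le x B : 0 <= B -> (forall i, normc (x i) <= B) ->
  n2 x <= n%:R * B.
Proof.
move=> B0 xB; apply: n2_leP; first by rewrite mulr_ge0.
apply: (@le_trans _ _ (\sum_(i < n) B ^+ 2)).
  by apply: ler_sum => i _; rewrite ler_pXn2r ?nnegrE ?normc_ge0.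
rewrite sumr_const card_ord -[leLHS]mulr_natl exprMn ler_wpM2r ?sqr_ge0 //.
by case: (n) => [|k]; rewrite expr2 ?mul0r // ler_peMl // ler1n.
Qed.

Lemma n2_sum_mul x y : \sum_i normc (x i) * normc (y i) <= n2 x * n2 y.
Proof. exact: cauchy_schwarz_sqrt. Qed.

Lemma n2D x y : n2 (fun i => x i + y i) <= n2 x + n2 y.
Proof.
apply: n2_leP; first by rewrite addr_ge0 ?n2_ge0.
apply: (@le_trans _ _ (\sum_i (normc (x i) + normc (y i)) ^+ 2)).
  apply: ler_sum => i _.
  by rewrite ler_pXn2r ?nnegrE ?addr_ge0 ?normc_ge0 ?le_normcD.
have -> : \sum_i (normc (x i) + normc (y i)) ^+ 2 =
    n2 x ^+ 2 + n2 y ^+ 2 + 2 * \sum_i normc (x i) * normc (y i).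
  by rewrite !sqr_n2 mulr_sumr -!big_split; apply: eq_bigr => i _ /=; ring.
have h := n2_sum_mul x y; nra.
Qed.

Lemma n2Z (z : R[i]) x : n2 (fun i => z * x i) = normc z * n2 x.
Proof.
rewrite /n2; under eq_bigr do rewrite normcM exprMn.
by rewrite -mulr_sumr sqrtrM ?sqr_ge0 // sqrtr_sqr ger0_norm ?normc_ge0.
Qed.

Lemma n2N x : n2 (fun i => - x i) = n2 x.
Proof. by rewrite /n2; under eq_bigr do rewrite normcN. Qed.

Lemma n2_le_normM (z : 'I_n -> R[i]) B x : 0 <= B -> (forall i, normc (z i) <= B) ->
  n2 (fun i => z i * x i) <= B * n2 x.
Proof.
move=> B0 zB; apply: (@le_trans _ _ (n2 (fun i => B%:C * x i))).
  apply: n2_le => i; rewrite !normcM normc_real (ger0_norm B0).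
  by rewrite ler_wpM2r ?normc_ge0.
by rewrite n2Z normc_real ger0_norm.
Qed.

Lemma n2_isometryM (z : 'I_n -> R[i]) x : (forall i, normc (z i) = 1) ->
  n2 (fun i => z i * x i) = n2 x.
Proof. by move=> z1; rewrite /n2; under eq_bigr do rewrite normcM z1 mul1r. Qed.

(** Minkowski's inequality for entrywise domination, so that the triangle inequality inside each
    entry is left to the caller. *)
Lemma n2_sum (m : nat) (X : 'I_n -> R[i]) (x : 'I_m -> 'I_n -> R[i]) :
  (forall i, normc (X i) <= \sum_j normc (x j i)) -> n2 X <= \sum_j n2 (x j).
Proof.
move=> Xx; apply: (@le_trans _ _ (n2 (fun i => (\sum_j normc (x j i))%:C))).
  apply: n2_le => i; rewrite normc_real ger0_norm ?Xx //.
  by apply: sumr_ge0 => j _; exact: normc_ge0.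
elim: m x {Xx} => [|m IHm] x.
  rewrite big_ord0 (@n2_eq _ (fun=> 0)) ?n2_0 // => i.
  by rewrite big_ord0.
rewrite big_ord_recr /= (@n2_eq _
  (fun i => (\sum_(j < m) normc (x (widen_ord (leqnSn m) j) i))%:C +
     (normc (x ord_max i))%:C)); last first.
  by move=> i; rewrite big_ord_recr rmorphD.
apply: (le_trans (n2D _ _)); rewrite lerD //.
by apply: n2_le => i; rewrite normc_real ger0_norm ?normc_ge0.
Qed.

(** Young's inequality for l^1 against l^2, the tool for all convolutions below: [a] holds the
    moduli of one factor and the [x j] are shifts of the other, all of norm at most [B]. *)
Lemma n2_sum_le (m : nat) (X : 'I_n -> R[i]) (a : 'I_m -> R)
    (x : 'I_m -> 'I_n -> R[i]) B :
  (forall j, 0 <= a j) -> (forall j, n2 (x j) <= B) ->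
  (forall i, normc (X i) <= \sum_j a j * normc (x j i)) ->
  n2 X <= (\sum_j a j) * B.
Proof.
move=> a0 xB Xx; rewrite mulr_suml.
apply: (@le_trans _ _ (\sum_j n2 (fun i => (a j)%:C * x j i))).
  apply: n2_sum => i; apply: (le_trans (Xx i)); apply: ler_sum => j _.
  by rewrite normcM normc_real ger0_norm.
by apply: ler_sum => j _; rewrite n2Z normc_real ger0_norm // ler_wpM2l.
Qed.

(* Test the increment against itself and apply the real mean value theorem. *)
Lemma n2_mean_value (q dq : 'I_n -> R -> R[i]) (tau B : R) : 0 < tau ->
  (forall i, ccontinuous (q i)) ->
  (forall s, 0 < s < tau -> forall i, is_cderive (q i) s (dq i s)) ->
  (forall s, 0 < s < tau -> n2 (dq ^~ s) <= B) ->
  n2 (fun i => q i tau - q i 0) <= tau * B.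
Proof.
move=> tau0 qc qd dqB; set p := fun i => q i tau - q i 0.
pose F s := Re (\sum_i conjc (p i) * q i s).
pose dF s := Re (\sum_i conjc (p i) * dq i s).
have Fd s : s \in `]0, tau[ -> is_derive s 1 F (dF s).
  rewrite in_itv => /qd {}qd; suff [] : is_cderive
    (fun s => \sum_i conjc (p i) * q i s) s (\sum_i conjc (p i) * dq i s) by [].
  by apply: is_cderive_sum => i; apply: is_cderiveZ.
have Fc : continuous F.
  suff [] : ccontinuous (fun s => \sum_i conjc (p i) * q i s) by [].
  by apply: ccontinuous_sum => i; apply: ccontinuousM => //; exact: ccontinuous_cst.
have [s s0t] := MVT tau0 Fd (continuous_subspaceT Fc).
have -> : F tau - F 0 = n2 p ^+ 2.
  rewrite /F -ReN -ReD -sumrB sqr_n2 Re_sum; apply: eq_bigr => i _.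
  by rewrite -mulrBr mulrC mul_conjc.
rewrite subr0 => eF; move: s0t; rewrite in_itv => /dqB dqsB.
have dFB : dF s <= n2 p * B.
  apply: (@le_trans _ _ (n2 p * n2 (dq ^~ s))); last by rewrite ler_wpM2l ?n2_ge0.
  apply: (@le_trans _ _ (\sum_i normc (p i) * normc (dq i s))); last exact: n2_sum_mul.
  apply: (le_trans (ler_norm _)); apply: (le_trans (Re_le_normc _)).
  apply: (le_trans (normc_sum _ _ _)); apply: ler_sum => i _.
  by rewrite normcM normc_conj.
have [p0|p0] := ltP 0 (n2 p); last first.
  apply: (le_trans p0); apply: mulr_ge0; first exact: ltW.
  exact: le_trans (n2_ge0 _) dqsB.
rewrite -(ler_pM2l p0) -expr2 eF mulrCA [X in _ <= X]mulrC.
by rewrite ler_pM2r.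
Qed.

End FiniteSums.

(** * Frequencies and the discrete Fourier transform *)

Section Residues.
Variable N : nat.
Hypothesis N_gt0 : (0 < N)%N.
Hypothesis N_even : ~~ odd N.

(* The representative of [l] modulo [N] in T_N; it minimizes the absolute value
   over the residue class, which keeps all frequency weights under control. *)
Definition rep (l : int) : int := ((l + (N./2)%:Z) %% N)%Z - (N./2)%:Z.

Lemma half_double : N%:Z = 2 * (N./2)%:Z.
Proof. by rewrite -{1}(even_halfK N_even) -mul2n PoszM. Qed.

Lemma rep_ge l : - (N./2)%:Z <= rep l.
Proof. by rewrite /rep; have := @modz_ge0 (l + (N./2)%:Z) N; lia. Qed.

Lemma rep_lt l : rep l < (N./2)%:Z.
Proof.
rewrite /rep; have := @ltz_pmod (l + (N./2)%:Z) N; have := half_double; lia.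
Qed.

Lemma repE l : exists p : int, l = rep l + p * N%:Z.
Proof.
exists ((l + (N./2)%:Z) %/ N)%Z; rewrite /rep.
have := divz_eq (l + (N./2)%:Z) N; lia.
Qed.

Lemma repD_mul l p : rep (l + p * N%:Z) = rep l.
Proof. congr (_ - _); rewrite -[in RHS](modzMDl p) [_ + (l + _)]addrA.
by rewrite [_ + l]addrC. Qed.

Lemma rep_id l : - (N./2)%:Z <= l -> l < (N./2)%:Z -> rep l = l.
Proof.
move=> h1 h2; rewrite /rep modz_small; first by rewrite addrK.
by have := half_double; lia.
Qed.

Lemma rep_eq l k p : l = k + p * N%:Z -> rep l = rep k.
Proof. by move->; rewrite repD_mul. Qed.

Definition kap_subproof l : (`|((l + (N./2)%:Z) %% N)%Z| < N)%N.
Proof.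
have := @modz_ge0 (l + (N./2)%:Z) N; have := @ltz_pmod (l + (N./2)%:Z) N; lia.
Qed.

(** Position of the class of [l] in the enumeration of T_N; shifts and reflections of T_N modulo N
    become permutations of ['I_N], available for reindexing sums. *)
Definition kap l : 'I_N := Ordinal (kap_subproof l).

Lemma mode_kap l : mode N (kap l) = rep l.
Proof. by rewrite /mode /rep /=; have := @modz_ge0 (l + (N./2)%:Z) N; lia. Qed.

Lemma mode_ge (k : 'I_N) : - (N./2)%:Z <= mode N k.
Proof. by rewrite /mode; lia. Qed.

Lemma mode_lt (k : 'I_N) : mode N k < (N./2)%:Z.
Proof. by rewrite /mode; have := ltn_ord k; have := half_double; lia. Qed.

Lemma rep_mode (k : 'I_N) : rep (mode N k) = mode N k.
Proof. by apply: rep_id; [exact: mode_ge|exact: mode_lt]. Qed.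

Lemma mode_inj : injective (fun k : 'I_N => mode N k).
Proof. by move=> k k'; rewrite /mode => e; apply: val_inj => /=; lia. Qed.

Lemma repDl l k : rep (rep l + k) = rep (l + k).
Proof. have [p e] := repE l; apply/esym/(@rep_eq _ _ p); lia. Qed.

Lemma repBr l k : rep (k - rep l) = rep (k - l).
Proof. have [p e] := repE l; apply: (@rep_eq _ _ p); lia. Qed.

Lemma kap_shift_inj j : injective (fun k : 'I_N => kap (mode N k - j)).
Proof.
move=> k k' /(congr1 (fun k : 'I_N => rep (mode N k + j))).
by rewrite !mode_kap !repDl !subrK !rep_mode => /mode_inj.
Qed.

Lemma kap_reflect_inj l : injective (fun k : 'I_N => kap (l - mode N k)).
Proof.
move=> k k' /(congr1 (fun k : 'I_N => rep (l - mode N k))).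
by rewrite !mode_kap !repBr !subKr !rep_mode => /mode_inj.
Qed.

Lemma rep_min l : `|rep l| <= `|l|.
Proof.
have [p e] := repE l; have := rep_ge l; have := rep_lt l; have := half_double.
move: (rep l) e => r e hN r1 r2.
have [p0|[p0|p0]] : p = 0 \/ p >= 1 \/ p <= -1 by lia.
- by rewrite e p0; lia.
- have : N%:Z <= p * N%:Z by rewrite ler_peMl.
  lia.
- have : p * N%:Z <= - N%:Z by rewrite -mulN1r ler_wpM2r.
  lia.
Qed.

(* Block index: [j < (2P+1) N] is [q N + k], of frequency [mode N k + (q - P) N]. *)
Lemma mode_block (P q : nat) (k : nat) :
  mode ((2 * P + 1) * N) (q * N + k) = mode N k + (q%:Z - P%:Z) * N%:Z.
Proof.
have -> : ((2 * P + 1) * N)%N = (P * N + N./2).*2.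
  by have := half_double; lia.
by rewrite /mode doubleK; lia.
Qed.

(** With an odd number of blocks the enlarged range is symmetric and cut exactly at block
    boundaries; block [P] is T_N itself, and an inner sum runs over frequencies that the grid cannot
    tell apart. *)
Lemma sum_blocks (V : nmodType) (P : nat) (F : int -> V) :
  \sum_(j < (2 * P + 1) * N) F (mode ((2 * P + 1) * N) j) =
  \sum_(k < N) \sum_(q < 2 * P + 1) F (mode N k + (q%:Z - P%:Z) * N%:Z).
Proof.
rewrite exchange_big /= -(big_mkord xpredT
  (fun j => F (mode ((2 * P + 1) * N) j))) big_nat_mul big_mkord.
apply: eq_bigr => q _; rewrite -{1}[(q * N)%N]add0n [(q.+1 * N)%N]mulSn big_addn addnK.
by rewrite big_mkord; apply: eq_bigr => k _; rewrite [(k + _)%N]addnC mode_block.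
Qed.

End Residues.

Section Waves.
Context {R : realType}.
Variables a b : R.
Hypothesis lt_ab : a < b.

Definition wave (l : int) (x : R) : R[i] := expi (freq a b l * (x - a)).

Let L_gt0 : 0 < b - a. Proof. by rewrite subr_gt0. Qed.
Let L_neq0 : b - a != 0. Proof. by rewrite gt_eqF. Qed.

Lemma freqD l k : freq a b (l + k) = freq a b l + freq a b k.
Proof. by rewrite /freq rmorphD mulrDr mulrDl. Qed.

Lemma freqN l : freq a b (- l) = - freq a b l.
Proof. by rewrite /freq rmorphN mulrN mulNr. Qed.

Lemma freq0 : freq a b 0 = 0.
Proof. by rewrite /freq mulr0 mul0r. Qed.

Lemma waveD l k x : wave (l + k) x = wave l x * wave k x.
Proof. by rewrite /wave freqD mulrDl expiD. Qed.

Lemma waveN l x : wave (- l) x = conjc (wave l x).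
Proof. by rewrite /wave freqN mulNr conjc_expi. Qed.

Lemma waveNE l x : expi (- (freq a b l * (x - a))) = wave (- l) x.
Proof. by rewrite /wave freqN mulNr. Qed.

Lemma wave0 x : wave 0 x = 1.
Proof. by rewrite /wave freq0 mul0r expi0. Qed.

Lemma normc_wave l x : normc (wave l x) = 1.
Proof. exact: normc_expi. Qed.

Definition weight (l : int) : R := 1 + freq a b l ^+ 2.

Lemma weight_ge1 l : 1 <= weight l.
Proof. by rewrite lerDl sqr_ge0. Qed.

Lemma weight_gt0 l : 0 < weight l.
Proof. exact: lt_le_trans (weight_ge1 l). Qed.

Lemma weight_ge0 l : 0 <= weight l.
Proof. exact: ltW (weight_gt0 l). Qed.

(** Peetre's inequality. *)
Lemma weightD l k : weight (l + k) <= 2 * weight l * weight k.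
Proof.
rewrite /weight freqD; move: (freq a b l) (freq a b k) => x y.
have := sqr_ge0 (x - y); have := sqr_ge0 (x * y); nra.
Qed.

Lemma norm_freq l : `|freq a b l| = 2 * pi / (b - a) * `|l|%:~R.
Proof.
rewrite /freq mulrAC normrM intr_norm ger0_norm //.
by rewrite divr_ge0 ?mulr_ge0 ?pi_ge0 // ltW.
Qed.

Lemma le_norm_freq l k : `|l| <= `|k| -> `|freq a b l| <= `|freq a b k|.
Proof.
move=> lk; rewrite !norm_freq ler_wpM2l ?ler_int //.
by rewrite divr_ge0 ?mulr_ge0 ?pi_ge0 // ltW.
Qed.

Lemma weight_freq l : weight l = 1 + `|freq a b l| ^+ 2.
Proof. by rewrite real_normK ?num_real. Qed.

Lemma le_weight l k : `|l| <= `|k| -> weight l <= weight k.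
Proof.
by move=> /le_norm_freq lk; rewrite !weight_freq lerD2l ler_pXn2r ?nnegrE.
Qed.

Section Grid.
Variable N : nat.
Hypothesis N_gt0 : (0 < N)%N.
Hypothesis N_even : ~~ odd N.

Let N_neq0 : N%:R != 0 :> R. Proof. by rewrite pnatr_eq0 -lt0n. Qed.
Let NC_neq0 : N%:R != 0 :> R[i]. Proof. by rewrite pnatr_eq0 -lt0n. Qed.
Lemma wave_node l i :
  wave l (node a b N i) = expi (pi *+ 2 * (l%:~R * i%:R) / N%:R).
Proof.
rewrite /wave; congr expi; rewrite /freq /node /mesh mulr2n; field.
by rewrite N_neq0 L_neq0.
Qed.

Lemma wave_rep l i : wave (rep N l) (node a b N i) = wave l (node a b N i).
Proof.
have [p {2}->] := repE N_gt0 N_even l; rewrite waveD [X in _ * X]wave_node.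
have -> : pi *+ 2 * ((p * N%:Z)%:~R * i%:R) / N%:R = pi *+ 2 * (p * i%:Z)%:~R :> R.
  by rewrite !rmorphM /= -!pmulrn mulr2n; field.
by rewrite expi_pi_int mulr1.
Qed.

Lemma expi_root_neq1 (d : int) : d != 0 -> `|d| < N%:Z ->
  expi (pi *+ 2 * d%:~R / N%:R : R) != 1.
Proof.
wlog d_gt0 : d / 0 < d => [H d0 dN|_ dN].
  have [/H/(_ d0 dN)//|d_lt0|d_eq0] := ltgtP 0 d; last by rewrite -d_eq0 eqxx in d0.
  have := H (- d); rewrite oppr_gt0 oppr_eq0 normrN => /(_ d_lt0 d0 dN).
  rewrite rmorphN mulrN mulNr -conjc_expi; apply: contra => /eqP ->.
  by rewrite conjc1.
apply/eqP => /(congr1 Re) /=.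
(* Half the angle lies strictly between 0 and pi, so its sine is positive and cos 2t = 1 - 2 sin^2 t
   differs from 1. *)
have -> : pi *+ 2 * d%:~R / N%:R = (pi * (d%:~R / N%:R)) *+ 2 :> R.
  by ring.
set t := pi * _; rewrite cos_mulr2n cos2sin2 => h.
have : 0 < sin t.
  apply: sin_gt0_pi; rewrite mulr_gt0 ?pi_gt0 ?divr_gt0 ?ltr0z ?ltr0n //=.
  rewrite gtr_pMr ?pi_gt0 // ltr_pdivrMr ?ltr0n // mul1r.
  by move: dN; rewrite gtr0_norm // -(ltr_int R).
move=> s_gt0; have := exprn_gt0 2 s_gt0; lra.
Qed.

Lemma sum_expi_root (d : int) : d != 0 -> `|d| < N%:Z ->
  \sum_(k < N) expi (pi *+ 2 * (d%:~R * k%:R) / N%:R : R) = 0.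
Proof.
move=> d0 dN; pose om : R[i] := expi (pi *+ 2 * d%:~R / N%:R).
have powE k : expi (pi *+ 2 * (d%:~R * k%:R) / N%:R) = om ^+ k.
  elim: k => [|k IHk]; first by rewrite !mulr0 mul0r expi0.
  rewrite exprS -IHk -expiD; congr expi; rewrite -natr1; ring.
under eq_bigr do rewrite powE.
have := subrX1 om N.
have -> : om ^+ N = 1.
  by rewrite -powE -mulrA mulfK // expi_pi_int.
rewrite subrr => /esym/eqP; rewrite mulf_eq0 subr_eq0.
by rewrite (negbTE (expi_root_neq1 d0 dN)) => /eqP.
Qed.

Lemma sum_wave_node (k k' : 'I_N) :
  \sum_(i < N) wave (mode N k) (node a b N i) * wave (- mode N k') (node a b N i) =
  (N%:R * (k == k')%:R).
Proof.
under eq_bigr do rewrite -waveD wave_node.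
have [->|kk'] := eqVneq k k'.
  under eq_bigr do rewrite subrr mul0r mulr0 mul0r expi0.
  by rewrite sumr_const card_ord mulr1.
rewrite mulr0; apply: sum_expi_root.
  by rewrite subr_eq0; apply: contra kk' => /eqP/(mode_inj N_gt0 N_even) ->.
by rewrite /mode; have := ltn_ord k; have := ltn_ord k'; lia.
Qed.

(** The dual of [sum_wave_node]: one relation recovers coefficients from grid values, the other grid
    values from coefficients. *)
Lemma sum_wave_mode (i i' : 'I_N) :
  \sum_(k < N) wave (mode N k) (node a b N i) * wave (- mode N k) (node a b N i') =
  (N%:R * (i == i')%:R).
Proof.
have [->|ii'] := eqVneq i i'.
  under eq_bigr do rewrite -waveD subrr wave0.
  by rewrite sumr_const card_ord mulr1.
rewrite mulr0.
(* T_N starts at -N/2; this offset is a phase common to all terms, and the remaining sum runs over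
   powers of a root of unity. *)
pose ph : R[i] := expi (pi *+ 2 * (- (N./2)%:Z%:~R * (i%:Z - i'%:Z)%:~R) / N%:R).
rewrite (eq_bigr (fun k : 'I_N =>
  ph * expi (pi *+ 2 * ((i%:Z - i'%:Z)%:~R * k%:R) / N%:R))) => [|k _].
  rewrite -mulr_sumr sum_expi_root ?mulr0 //.
    by rewrite subr_eq0 eqz_nat; apply: contra ii' => /eqP/val_inj ->.
  by have := ltn_ord i; have := ltn_ord i'; lia.
rewrite !wave_node /ph -!expiD; congr expi; rewrite /mode !rmorphN !rmorphB /=.
by rewrite -!pmulrn; ring.
Qed.

Definition trigpoly (y : int -> R[i]) (x : R) : R[i] :=
  \sum_(k < N) y (mode N k) * wave (mode N k) x.

Lemma trigpolyD y z x : trigpoly y x + trigpoly z x = trigpoly (fun l => y l + z l) x.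
Proof. by rewrite /trigpoly -big_split; apply: eq_bigr => k _; rewrite mulrDl. Qed.

Lemma trigpolyB y z x : trigpoly y x - trigpoly z x = trigpoly (fun l => y l - z l) x.
Proof. by rewrite /trigpoly -sumrB; apply: eq_bigr => k _; rewrite mulrBl. Qed.

Lemma trigpolyZ z y x : z * trigpoly y x = trigpoly (fun l => z * y l) x.
Proof. by rewrite /trigpoly mulr_sumr; apply: eq_bigr => k _; rewrite mulrA. Qed.

Lemma eq_trigpoly y z x : (forall k : 'I_N, y (mode N k) = z (mode N k)) ->
  trigpoly y x = trigpoly z x.
Proof. by move=> yz; apply: eq_bigr => k _; rewrite yz. Qed.

Lemma discrete_coef_trigpoly (y : int -> R[i]) (u : 'cV[R[i]]_N.+1) (k : 'I_N) :
  (forall i : 'I_N, u (widen_ord (leqnSn N) i) 0 = trigpoly y (node a b N i)) ->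
  discrete_coef a b u (mode N k) = y (mode N k).
Proof.
move=> uy; rewrite /discrete_coef.
under eq_bigr do rewrite uy waveNE mulr_suml.
rewrite exchange_big /=.
under eq_bigr => k' _ do (under eq_bigr do rewrite -mulrA;
  rewrite -mulr_sumr sum_wave_node).
rewrite (bigD1 k) //= eqxx mulr1 big1 => [|k' /negbTE ->]; last by rewrite !mulr0.
by rewrite addr0 mulrC mulfK.
Qed.

Lemma trigpoly_discrete_coef (u : 'cV[R[i]]_N.+1) (i : 'I_N) :
  trigpoly (discrete_coef a b u) (node a b N i) = u (widen_ord (leqnSn N) i) 0.
Proof.
rewrite /trigpoly /discrete_coef.
under eq_bigr => k _ do (rewrite -mulrA mulr_suml; under eq_bigr do
  rewrite waveNE -mulrA [wave _ _ * wave _ _]mulrC).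
rewrite -mulr_sumr exchange_big /=.
under eq_bigr do rewrite -mulr_sumr sum_wave_mode.
rewrite (bigD1 i) //= eqxx mulr1 big1 => [|i' /negbTE]; last first.
  by rewrite eq_sym => ->; rewrite !mulr0.
by rewrite addr0 [u _ _ * _]mulrC mulKf.
Qed.

Definition nmode (y : int -> R[i]) : R := n2 (fun k : 'I_N => y (mode N k)).

Definition nnode (f : R -> R[i]) : R := n2 (fun i : 'I_N => f (node a b N i)).

Lemma discrete_parseval y : nnode (trigpoly y) = Num.sqrt N%:R * nmode y.
Proof.
rewrite /nnode /nmode /n2 -sqrtrM ?ler0n //; congr Num.sqrt; apply: complexI.
rewrite rmorphM rmorph_nat !rmorph_sum /=.
under eq_bigr => i _ do rewrite -mul_conjc /trigpoly conjc_sum mulr_suml.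
rewrite exchange_big mulr_sumr; apply: eq_bigr => k _ /=.
under eq_bigr => i _ do rewrite mulr_sumr.
rewrite exchange_big /=.
under eq_bigr => k' _ do (under eq_bigr => i _ do
  rewrite conjcM -waveN mulrACA; rewrite -mulr_sumr sum_wave_node).
rewrite (bigD1 k) //= eqxx mulr1 big1 => [|k' /negbTE].
  by rewrite addr0 mul_conjc mulrC.
by rewrite eq_sym => ->; rewrite !mulr0.
Qed.

(** A shift modulo N permutes T_N. This is why an aliased convolution obeys the same l^2 bounds as a
    true one. *)
Lemma nmode_rep_shift y j : nmode (fun l => y (rep N (l - j))) = nmode y.
Proof.
rewrite /nmode /n2; congr Num.sqrt.
rewrite [RHS](reindex_inj (@kap_shift_inj N N_gt0 N_even j)).
by apply: eq_bigr => k _; rewrite mode_kap.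
Qed.

End Grid.

End Waves.

(** * Weighted sequences and aliasing *)

Section InverseSquares.
Context {R : realType}.

(** The value 1 at 0 makes it a summable majorant on all integers, up to a constant, of the inverse
    weights. *)
Definition invsq (l : int) : R := if l == 0 then 1 else (`|l| ^+ 2)%:~R^-1.

Lemma invsq_ge0 l : 0 <= invsq l.
Proof. by rewrite /invsq; case: eqP => // _; rewrite invr_ge0 ler0z exprn_ge0. Qed.

Lemma invsqN l : invsq (- l) = invsq l.
Proof. by rewrite /invsq oppr_eq0 normrN. Qed.

Lemma sum_inv_sqr n : \sum_(j < n) ((j.+1%:R ^+ 2)^-1 : R) <= 2.
Proof.
case: n => [|n]; first by rewrite big_ord0.
(* Strengthened to the telescoping bound that comes from 1/(k+1)^2 <= 1/k - 1/(k+1). *)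
suff: \sum_(j < n.+1) ((j.+1%:R ^+ 2)^-1 : R) <= 2 - n.+1%:R^-1.
  by move/le_trans; apply; rewrite lerBlDr lerDl invr_ge0.
elim: n => [|n IHn]; first by rewrite big_ord_recl big_ord0 /= invr1 expr1n invr1; lra.
rewrite big_ord_recr /=; apply: (le_trans (lerD IHn (lexx _))).
have x0 : 0 < n.+1%:R :> R by rewrite ltr0n.
rewrite -[n.+2%:R]natr1; move: (n.+1%:R : R) x0 => x x0.
rewrite -subr_ge0.
have -> : 2 - (x + 1)^-1 - (2 - x^-1 + ((x + 1) ^+ 2)^-1) =
    (x * (x + 1) ^+ 2)^-1 :> R.
  by field; apply/andP; split; lra.
by rewrite invr_ge0 mulr_ge0 ?sqr_ge0 // ltW.
Qed.

(** 5 is 1 for the central term plus 2 for each side. *)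
Lemma sum_invsq n p : \sum_(j < n) invsq (j%:Z - p%:Z) <= 5.
Proof.
(* The range is enlarged so that the centre [j = p] certainly belongs to it and the sum can be split
   there. *)
apply: (@le_trans _ _ (\sum_(j < p + n.+1) invsq (j%:Z - p%:Z))).
  rewrite -!(big_mkord xpredT (fun j => invsq (j%:Z - p%:Z))).
  rewrite (@big_cat_nat _ _ _ n 0 (p + n.+1)) //=; last by lia.
  by rewrite lerDl sumr_ge0 // => j _; exact: invsq_ge0.
rewrite big_split_ord /= big_ord_recl /= addn0 subrr /invsq eqxx -/invsq.
rewrite (reindex_inj rev_ord_inj) /=.
have h1 : \sum_(j < p) invsq ((p - j.+1)%N%:Z - p%:Z) <= 2.
  apply: le_trans (sum_inv_sqr p); apply: ler_sum => j _.
  have -> : (p - j.+1)%N%:Z - p%:Z = - (j.+1)%:Z by have := ltn_ord j; lia.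
  by rewrite invsqN /invsq /= rmorphXn /=.
have h2 : \sum_(j < n) invsq ((p + bump 0 j)%N%:Z - p%:Z) <= 2.
  apply: le_trans (sum_inv_sqr n); apply: ler_sum => j _.
  have -> : (p + bump 0 j)%N%:Z - p%:Z = (j.+1)%:Z by rewrite /bump; lia.
  by rewrite /invsq /= rmorphXn /=.
by rewrite /invsq in h1 h2 *; lra.
Qed.

End InverseSquares.

Section WeightedBounds.
Context {R : realType}.
Variables a b : R.
Hypothesis lt_ab : a < b.

Local Notation weight := (weight a b).

(* The norm of H^p is at most [B], in terms of Fourier coefficients and without
   reference to infinite sums. *)
Definition wbound (p : nat) (x : int -> R[i]) (B : R) : Prop :=
  forall s : seq int, uniq s ->
    \sum_(l <- s) weight l ^+ p * normc (x l) ^+ 2 <= B ^+ 2.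

Lemma wbound_le p q x B : (p <= q)%N -> wbound q x B -> wbound p x B.
Proof.
move=> pq xB s us; apply: le_trans (xB s us); apply: ler_sum => l _.
by rewrite ler_wpM2r ?sqr_ge0 // ler_weXn2l // weight_ge1.
Qed.

Lemma wbound_inj p x B n (f : 'I_n -> int) : injective f -> wbound p x B ->
  \sum_(i < n) weight (f i) ^+ p * normc (x (f i)) ^+ 2 <= B ^+ 2.
Proof.
move=> fI xB; have := xB (map f (enum 'I_n)).
by rewrite map_inj_uniq ?enum_uniq // big_map big_enum => /(_ isT).
Qed.

Lemma wbound_n2 x B n (f : 'I_n -> int) : 0 <= B -> injective f ->
  wbound 2 x B -> n2 (fun i => (weight (f i))%:C * x (f i)) <= B.
Proof.
move=> B0 fI xB; apply: n2_leP => //; apply: le_trans (wbound_inj fI xB).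
apply: ler_sum => i _; rewrite normcM normc_real exprMn.
by rewrite ger0_norm ?weight_ge0.
Qed.

Lemma wbound_n2_0 x B n (f : 'I_n -> int) : 0 <= B -> injective f ->
  wbound 0 x B -> n2 (fun i => x (f i)) <= B.
Proof.
move=> B0 fI xB; apply: n2_leP => //; apply: le_trans (wbound_inj fI xB).
by apply: ler_sum => i _; rewrite expr0 mul1r.
Qed.

(** Bounds the sum of the inverse weights: 5 comes from [sum_invsq], the other factor from
    [inv_weight]. *)
Definition c_l1 : R := 5 * (1 + (b - a) ^+ 2).

Lemma c_l1_ge1 : 1 <= c_l1.
Proof. by rewrite /c_l1; have := sqr_ge0 (b - a); lra. Qed.

Lemma inv_weight l : (weight l)^-1 <= (1 + (b - a) ^+ 2) * invsq l.
Proof.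
rewrite /invsq; case: eqP => [_|/eqP l0].
  rewrite mulr1 (le_trans (y := 1)) ?lerDl ?sqr_ge0 //.
  by rewrite invf_le1 ?weight_gt0 ?weight_ge1.
have lr0 : 0 < `|l|%:~R :> R by rewrite ltr0z normr_gt0.
have L0 : 0 < b - a by rewrite subr_gt0.
rewrite rmorphXn -[leLHS]mulr1 ler_pdivlMr ?exprn_gt0 //.
rewrite mulr1 mulrC ler_pdivrMr ?weight_gt0 // weight_freq.
rewrite norm_freq // exprMn.
have pi1 : 1 <= pi :> R by rewrite (le_trans _ (pi_ge2 _)) // ler1n.
set l2 := `|l|%:~R ^+ 2; have l20 : 0 <= l2 by exact: sqr_ge0.
have : l2 <= (b - a) ^+ 2 * ((2 * pi / (b - a)) ^+ 2 * l2).
  have -> : (b - a) ^+ 2 * ((2 * pi / (b - a)) ^+ 2 * l2) = (2 * pi) ^+ 2 * l2.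
    by field; rewrite gt_eqF.
  by rewrite ler_peMl // exprn_ege1 //; lra.
have : 0 <= (2 * pi / (b - a)) ^+ 2 * l2 by rewrite mulr_ge0 ?sqr_ge0.
have := sqr_ge0 (b - a).
by move: ((2 * pi / (b - a)) ^+ 2 * l2) ((b - a) ^+ 2) => u v; nra.
Qed.

(** Cauchy-Schwarz against the square root of the inverse weight, which is square summable in
    dimension one: a weighted l^1 bound costs one derivative beyond the 2p of the weight. For
    [p = 2] this is the H^5 bound on the potential. *)
Lemma wbound_l1 p x B K : 0 <= B -> wbound (2 * p + 1) x B ->
  \sum_(j < K) weight (mode K j) ^+ p * normc (x (mode K j)) <= c_l1 * B.
Proof.
move=> B0 xB; pose sw l : R := Num.sqrt (weight l).
have sw0 l : 0 < sw l by rewrite sqrtr_gt0 weight_gt0.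
have sw2 l : sw l ^+ 2 = weight l by rewrite sqr_sqrtr ?weight_ge0.
rewrite (eq_bigr (fun j : 'I_K => (sw (mode K j))^-1 *
  (sw (mode K j) * (weight (mode K j) ^+ p * normc (x (mode K j)))))); last first.
  by move=> j _; rewrite [RHS]mulrA mulVf ?mul1r // gt_eqF.
apply: (le_trans (cauchy_schwarz_sqrt _ _ _)); apply: ler_pM; rewrite ?sqrtr_ge0 //.
  (* Since [c_l1] is at least 1 it dominates its own square root, which disappears from all later
     constants. *)
  apply: (@le_trans _ _ (Num.sqrt c_l1)).
    apply: ler_wsqrtr; apply: (@le_trans _ _ ((1 + (b - a) ^+ 2) *
      \sum_(j < K) invsq (mode K j))).
      rewrite mulr_sumr; apply: ler_sum => j _.
      by rewrite exprVn sw2 inv_weight.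
    rewrite /c_l1 mulrC ler_wpM2r ?addr_ge0 ?sqr_ge0 //.
    exact: sum_invsq.
  apply: le_of_sqr; first exact: le_trans c_l1_ge1.
  rewrite sqr_sqrtr; last exact: le_trans c_l1_ge1.
  by rewrite expr2 ler_peMl ?c_l1_ge1 //; exact: le_trans c_l1_ge1.
apply: le_of_sqr => //; rewrite sqr_sqrtr; last first.
  by apply: sumr_ge0 => i _; exact: sqr_ge0.
have mI : injective (fun j : 'I_K => mode K j).
  by move=> j j'; rewrite /mode => e; apply: val_inj => /=; lia.
apply: le_trans (wbound_inj mI xB); apply: ler_sum => j _.
by rewrite !exprMn sw2 -exprM mulrA exprD expr1 [weight _ * _]mulrC [(p * 2)%N]mulnC.
Qed.

Section Aliasing.
Variable N : nat.
Hypothesis N_gt0 : (0 < N)%N.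
Hypothesis N_even : ~~ odd N.

Local Notation h := (mesh a b N).

Lemma mesh_gt0 : 0 < h.
Proof. by rewrite divr_gt0 ?subr_gt0 ?ltr0n. Qed.

(** The modulus of mu_l is then at least (pi/2) p/h, and pi >= 2. *)
Lemma high_weight (l : int) (p : nat) : N%:Z * p%:Z <= 4 * `|l| ->
  (p%:R / h) ^+ 2 <= weight l.
Proof.
move=> Npl; rewrite weight_freq (le_trans (y := `|freq a b l| ^+ 2)) ?lerDr //.
have L0 : 0 < b - a by rewrite subr_gt0.
have N0 : 0 < N%:R :> R by rewrite ltr0n.
rewrite ler_pXn2r ?nnegrE ?divr_ge0 ?(ltW mesh_gt0) ?(ltW L0) //.
rewrite norm_freq // /mesh.
have -> : p%:R / ((b - a) / N%:R) = (N%:R * p%:R) / (b - a) :> R.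
  by field; rewrite !gt_eqF.
rewrite [leRHS]mulrAC ler_pM2r ?invr_gt0 //.
move: Npl; rewrite -(ler_int R) !rmorphM /= -!pmulrn => Npl.
have pi2 := pi_ge2 R; have l0 : 0 <= `|l|%:~R :> R by rewrite ler0z.
by move: (N%:R * p%:R) Npl => u Npl; nra.
Qed.

(** The threshold is N/4 rather than the Nyquist frequency N/2: if a product of two modes is
    aliased, one of the frequencies involved must exceed N/4, see [aliasing_pointwise]. *)
Definition high (x : int -> R[i]) (l : int) : R[i] :=
  if N%:Z <= 4 * `|l| then x l else 0.

(** The level [p] measures how far out the selected frequencies lie. Its inverse power [m] is kept
    because it makes the sum over residue blocks converge. *)
Lemma high_n2 m x B n (f : 'I_n -> int) (p : nat) : (0 < p)%N -> 0 <= B ->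
  injective f -> wbound m x B ->
  (forall i, high x (f i) != 0 -> N%:Z * p%:Z <= 4 * `|f i|) ->
  n2 (fun i => high x (f i)) <= (h / p%:R) ^+ m * B.
Proof.
move=> p0 B0 fI xB hp; have h0 := mesh_gt0.
have pr0 : 0 < p%:R :> R by rewrite ltr0n.
apply: n2_leP; first by rewrite mulr_ge0 // exprn_ge0 // divr_ge0 // ltW.
rewrite exprMn; apply: (@le_trans _ _ (((h / p%:R) ^+ m) ^+ 2 *
    \sum_(i < n) weight (f i) ^+ m * normc (x (f i)) ^+ 2)); last first.
  by rewrite ler_wpM2l ?sqr_ge0 // (wbound_inj fI xB).
rewrite mulr_sumr; apply: ler_sum => i _.
have rhs0 : 0 <= ((h / p%:R) ^+ m) ^+ 2 * (weight (f i) ^+ m * normc (x (f i)) ^+ 2).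
  apply: mulr_ge0; first exact: sqr_ge0.
  by apply: mulr_ge0; [rewrite exprn_ge0 ?weight_ge0|exact: sqr_ge0].
have [->|hx] := eqVneq (high x (f i)) 0; first by rewrite normc0 expr0n.
have /high_weight hw := hp _ hx; move: hx; rewrite /high; case: ifP => [_ _|].
  rewrite mulrA ler_peMl ?sqr_ge0 // exprAC -exprMn exprn_ege1 //.
  have e1 : 1 = (h / p%:R) ^+ 2 * (p%:R / h) ^+ 2 by field; rewrite !gt_eqF.
  by rewrite [leLHS]e1 ler_wpM2l ?sqr_ge0.
by rewrite eqxx.
Qed.

Lemma high_nmode m x B : 0 <= B -> wbound m x B -> nmode N (high x) <= h ^+ m * B.
Proof.
move=> B0 xB; rewrite -[h]divr1 /nmode.
apply: (@high_n2 m x B N (fun k => mode N k) 1) => //; first exact: mode_inj.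
by move=> i; rewrite /high mulr1; case: ifP => //; rewrite eqxx.
Qed.

Lemma high_nmode_shift m x B j : 0 <= B -> wbound m x B ->
  nmode N (fun l => high x (l - j)) <= h ^+ m * B.
Proof.
move=> B0 xB; rewrite -[h]divr1 /nmode.
apply: (@high_n2 m x B N (fun k => mode N k - j) 1) => //.
  by move=> k k' /addIr; exact: mode_inj.
by move=> i; rewrite /high mulr1; case: ifP => //; rewrite eqxx.
Qed.

(** Majorant of what sampling folds onto the mode [l]. Within T_N, the central block [q = P]
    contributes only frequencies above N/4. *)
Definition fold_high (P : nat) (x : int -> R[i]) (l : int) : R[i] :=
  (\sum_(q < 2 * P + 1) normc (high x (l + (q%:Z - P%:Z) * N%:Z)))%:C.

(* Minkowski over the blocks; block [q] carries weights at least ((q - P) / h)^2. *)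
Lemma fold_high_le m P x B : (2 <= m)%N -> 0 <= B -> wbound m x B ->
  nmode N (fold_high P x) <= 5 * h ^+ m * B.
Proof.
move=> m2 B0 xB; apply: (@le_trans _ _ (\sum_(q < 2 * P + 1)
    n2 (fun k : 'I_N => high x (mode N k + (q%:Z - P%:Z) * N%:Z)))).
  apply: n2_sum => k; rewrite normc_real ger0_norm //.
  by apply: sumr_ge0 => q _; exact: normc_ge0.
have h0 := ltW mesh_gt0.
apply: (@le_trans _ _ (\sum_(q < 2 * P + 1) invsq (q%:Z - P%:Z) * (h ^+ m * B))).
  apply: ler_sum => q _; set d := q%:Z - P%:Z.
  (* In a block [d] other than 0 the frequency is at least (|d| - 1/2) N >= |d| N/2, well above
     level |d|; the central block has level 1 by definition of [high]. Later [m >= 2] replaces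
     |d|^-m by [invsq d]. *)
  apply: (@le_trans _ _ ((h / (maxn 1 `|d|%N)%:R) ^+ m * B)).
    apply: high_n2 => //; first by rewrite leq_max.
      by move=> k k' /addIr; exact: mode_inj.
    move=> k; rewrite /high; case: ifP => [hi _|]; last by rewrite eqxx.
    have := mode_ge N_gt0 N_even k; have := mode_lt N_gt0 N_even k; have := half_double N_even.
    have [d0|d0] := eqVneq d 0; first by move: hi; rewrite d0 mul0r addr0 /= mulr1.
    have -> : maxn 1 `|d| = `|d|%N by move: d0; lia.
    move: hi => _ hN mlt mge.
    have [p0|p0] : d >= 1 \/ d <= -1 by move: d0; lia.
      have : N%:Z * 1 <= N%:Z * d by rewrite ler_wpM2l.
      rewrite mulrC; move: (mode N k) mlt mge => r; rewrite abszE ger0_norm; lia.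
    have : N%:Z * d <= N%:Z * (-1) by rewrite ler_wpM2l.
    rewrite mulrC; move: (mode N k) mlt mge => r; rewrite abszE ler0_norm; lia.
  rewrite exprMn [_ * (_ * B)]mulrA [invsq d * _]mulrC ler_wpM2r //.
  rewrite ler_wpM2l ?exprn_ge0 // exprVn /invsq.
  have [->|d0] := eqVneq d 0; first by rewrite expr1n invr1.
  have -> : maxn 1 `|d| = `|d|%N by move: d0; lia.
  have d1 : 1 <= `|d|%N%:R :> R by rewrite ler1n; move: d0; lia.
  rewrite rmorphXn /= -abszE -pmulrn lef_pV2 ?posrE ?exprn_gt0 //; try lra.
  by rewrite ler_weXn2l.
rewrite -mulr_suml mulrA ler_wpM2r // ler_wpM2r ?exprn_ge0 //.
exact: sum_invsq.
Qed.

End Aliasing.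

End WeightedBounds.

Ltac nonneg := repeat first
  [ done | exact: normc_ge0 | exact: n2_ge0 | exact: sqr_ge0 | exact: weight_ge0
  | apply: exprn_ge0 | apply: addr_ge0 | apply: mulr_ge0 ].

(** * Aliased convolutions: dispersion and aliasing estimates *)

Section Convolutions.
Context {R : realType}.
Variables a b : R.
Hypothesis lt_ab : a < b.
Variable N : nat.
Hypothesis N_gt0 : (0 < N)%N.
Hypothesis N_even : ~~ odd N.

Local Notation weight := (weight a b).
Local Notation freq := (freq a b).
Local Notation wave := (wave a b).
Local Notation wbound := (wbound a b).
Local Notation h := (mesh a b N).
Local Notation nmode := (nmode N).
Local Notation rep := (rep N).
Local Notation node := (node a b N).
Local Notation trigpoly := (trigpoly a b N).

Lemma nmodeD y z : nmode (fun l => y l + z l) <= nmode y + nmode z :> R.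
Proof. exact: n2D. Qed.

Lemma nmode_le y z : (forall k : 'I_N, normc (y (mode N k)) <= normc (z (mode N k))) ->
  nmode y <= nmode z :> R.
Proof. by move=> yz; apply: n2_le. Qed.

Lemma nmode_sum_le (n : nat) (X : int -> R[i]) (al : 'I_n -> R)
    (x : 'I_n -> int -> R[i]) B :
  (forall j, 0 <= al j) -> (forall j, nmode (x j) <= B) ->
  (forall k : 'I_N, normc (X (mode N k)) <= \sum_j al j * normc (x j (mode N k))) ->
  nmode X <= (\sum_j al j) * B.
Proof. by move=> al0 xB Xx; apply: (n2_sum_le (x := fun j k => x j (mode N k))). Qed.

Lemma wave_mul_trigpoly j y (i : 'I_N) :
  wave j (node i) * trigpoly y (node i) =
  trigpoly (fun l => y (rep (l - j))) (node i).
Proof.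
rewrite /trigpoly mulr_sumr [LHS](reindex_inj (@kap_shift_inj N N_gt0 N_even j)) /=.
apply: eq_bigr => k _; rewrite mode_kap // (mulrCA (wave j _)); congr (_ * _).
by rewrite wave_rep // -waveD addrC subrK.
Qed.

(** On the nodes a product is again a trigonometric polynomial over T_N, its coefficients being a
    convolution with indices reduced modulo N. *)
Lemma sum_wave_mul_trigpoly n (f : 'I_n -> int) (v : int -> R[i]) y (i : 'I_N) :
  (\sum_(j < n) v (f j) * wave (f j) (node i)) * trigpoly y (node i) =
  trigpoly (fun l => \sum_(j < n) v (f j) * y (rep (l - f j))) (node i).
Proof.
rewrite mulr_suml; under eq_bigr do rewrite -mulrA wave_mul_trigpoly trigpolyZ.
rewrite /trigpoly exchange_big /=; apply: eq_bigr => k _.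
by rewrite mulr_suml.
Qed.

(* [rep] minimizes the modulus, so frequencies change by at most [freq j] under
   the aliased shift, exactly as they do without aliasing. *)
Lemma freq_rep_dist (k : 'I_N) j :
  `| `|freq (mode N k)| - `|freq (rep (mode N k - j))| | <= `|freq j|.
Proof.
set l := mode N k; set r := rep (l - j).
have h1 : `|freq r| <= `|freq l| + `|freq j|.
  apply: le_trans (le_norm_freq lt_ab (rep_min N_gt0 N_even (l - j))) _.
  by rewrite freqD freqN (le_trans (ler_normB _ _)).
have h2 : `|freq l| <= `|freq r| + `|freq j|.
  have -> : l = rep (r + j) by rewrite repDl // subrK rep_mode.
  apply: le_trans (le_norm_freq lt_ab (rep_min N_gt0 N_even (r + j))) _.
  by rewrite freqD ler_normD.
by rewrite ler_norml; apply/andP; split; lra.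
Qed.

(** Symbol of the commutator of minus the Laplacian with the mode [j] of the potential, as it acts
    on the grid. *)
Definition dispersion (l j : int) : R := freq l ^+ 2 - freq (rep (l - j)) ^+ 2.

Lemma dispersion_le (k : 'I_N) j : `|dispersion (mode N k) j| <=
  `|freq j| * (2 * `|freq (rep (mode N k - j))| + `|freq j|).
Proof.
rewrite /dispersion -[X in _ - X](real_normK (num_real _)).
rewrite -[X in X - _](real_normK (num_real _)) subr_sqr normrM.
apply: ler_pM => //; first exact: freq_rep_dist.
rewrite ger0_norm ?addr_ge0 //.
by have := freq_rep_dist k j; rewrite ler_norml => /andP[]; lra.
Qed.

(** Two derivatives on each factor, enough for the commutator itself and for its time derivative. *)
Lemma dispersion_weight (k : 'I_N) j : `|dispersion (mode N k) j| <=
  2 * weight j * weight (rep (mode N k - j)).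
Proof.
apply: (le_trans (dispersion_le k j)); rewrite !weight_freq.
move: `|freq j| (normr_ge0 (freq j)) => x x0.
move: `|freq _| (normr_ge0 (freq (rep (mode N k - j)))) => y y0.
have := sqr_ge0 (x - y); have := sqr_ge0 (x * y); nra.
Qed.

(** The squared symbol has degree four, but by [dispersion_le] only degree two in the shifted
    frequency: the remaining derivatives fall on [j], that is on the potential. Squaring
    [dispersion_weight] would demand H^4 of the solution. *)
Lemma dispersion_sqr_weight (k : 'I_N) j : dispersion (mode N k) j ^+ 2 <=
  8 * weight j ^+ 2 * weight (rep (mode N k - j)).
Proof.
rewrite -(real_normK (num_real _)).
have : `|dispersion (mode N k) j| ^+ 2 <=
    (`|freq j| * (2 * `|freq (rep (mode N k - j))| + `|freq j|)) ^+ 2.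
  by rewrite ler_pXn2r ?nnegrE ?dispersion_le // mulr_ge0 ?addr_ge0 ?mulr_ge0.
move/le_trans; apply; rewrite !weight_freq.
move: `|freq j| (normr_ge0 (freq j)) => x x0.
move: `|freq _| (normr_ge0 (freq (rep (mode N k - j)))) => y y0.
have := sqr_ge0 (x * (2 * y - x)); have := sqr_ge0 (x * y).
have := sqr_ge0 (x ^+ 2 * y); have := sqr_ge0 (x ^+ 2); have := sqr_ge0 y; nra.
Qed.

Variables (v : int -> R[i]) (mV m : nat) (Bv M : R).
Hypothesis (Bv_ge0 : 0 <= Bv) (M_ge0 : 0 <= M).
Hypothesis (m_ge2 : (2 <= m)%N) (mV_ge5 : (5 <= mV)%N) (mV_ge : (m <= mV)%N).
Hypothesis v_bound : wbound mV v Bv.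

Variable P : nat.
Local Notation K := ((2 * P + 1) * N)%N.
Local Notation jm j := (mode K (nat_of_ord j)).
Local Notation S := (c_l1 a b * Bv).

Lemma S_ge0 : 0 <= S.
Proof. by rewrite mulr_ge0 // (le_trans _ (c_l1_ge1 _ _)). Qed.

Lemma sum_v_weight p : (p <= 2)%N ->
  \sum_(j < K) normc (v (jm j)) * weight (jm j) ^+ p <= S.
Proof.
move=> p2; apply: le_trans (wbound_l1 lt_ab (p := 2) K Bv_ge0 _); last first.
  exact: wbound_le v_bound.
apply: ler_sum => j _; rewrite mulrC ler_wpM2r ?normc_ge0 //.
by rewrite ler_weXn2l ?weight_ge1.
Qed.

Lemma nmode_weight (c : int -> R[i]) : wbound m c M ->
  nmode (fun l => (weight l)%:C * c l) <= M.
Proof.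
move=> cM; apply: wbound_n2 => //; first exact: mode_inj.
exact: wbound_le cM.
Qed.

Lemma nmode_wbound (c : int -> R[i]) : wbound m c M -> nmode c <= M.
Proof.
move=> cM; apply: wbound_n2_0 => //; first exact: mode_inj.
exact: wbound_le cM.
Qed.

(** Serves the quadratic Taylor remainder of the phase at distance [th] from the midpoint. 16 is 8
    from [dispersion_sqr_weight] times 2 from [normc_expi_sub1_sub]. *)
Lemma nmode_dispersion_remainder (c X : int -> R[i]) (th : R) : wbound m c M ->
  (forall k : 'I_N, normc (X (mode N k)) <= \sum_(j < K) normc (v (jm j)) *
     (2 * (dispersion (mode N k) (jm j) * th) ^+ 2) *
     normc (c (rep (mode N k - jm j)))) ->
  nmode X <= 16 * th ^+ 2 * S * M.
Proof.
move=> cM Xc.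
apply: (@le_trans _ _ ((\sum_(j < K) normc (v (jm j)) * weight (jm j) ^+ 2 *
    (16 * th ^+ 2)) * M)).
  apply: (nmode_sum_le (x := fun j l => (weight (rep (l - jm j)))%:C *
      c (rep (l - jm j)))) => [j|j|k].
  - by nonneg.
  - rewrite (nmode_rep_shift N_gt0 N_even (fun l => (weight l)%:C * c l)).
    exact: nmode_weight.
  - apply: (le_trans (Xc k)); apply: ler_sum => j _.
    rewrite normcM normc_real (ger0_norm (weight_ge0 _ _ _)) [leRHS]mulrA.
    rewrite ler_wpM2r ?normc_ge0 //.
    move: (dispersion_sqr_weight k (jm j)) (normc_ge0 (v (jm j))) (sqr_ge0 th).
    rewrite exprMn; move: (normc (v _)) (dispersion _ _ ^+ 2) (th ^+ 2) => u x y.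
    rewrite -(subr_ge0 x) => xw u0 y0.
    by have := mulr_ge0 (mulr_ge0 u0 y0) xw; lra.
rewrite -mulr_suml ler_wpM2r // mulrC ler_wpM2l //; last exact: sum_v_weight.
by nonneg.
Qed.

Lemma nmode_dispersion (y X : int -> R[i]) B : 0 <= B ->
  nmode (fun l => (weight l)%:C * y l) <= B ->
  (forall k : 'I_N, normc (X (mode N k)) <= \sum_(j < K) normc (v (jm j)) *
     `|dispersion (mode N k) (jm j)| * normc (y (rep (mode N k - jm j)))) ->
  nmode X <= 2 * S * B.
Proof.
move=> B0 yB Xy.
apply: (@le_trans _ _ ((\sum_(j < K) normc (v (jm j)) * weight (jm j) ^+ 1 * 2) * B)).
  apply: (nmode_sum_le (x := fun j l => (weight (rep (l - jm j)))%:C *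
      y (rep (l - jm j)))) => [j|j|k].
  - by nonneg.
  - by rewrite (nmode_rep_shift N_gt0 N_even (fun l => (weight l)%:C * y l)).
  - apply: (le_trans (Xy k)); apply: ler_sum => j _.
    rewrite normcM normc_real (ger0_norm (weight_ge0 _ _ _)) [leRHS]mulrA.
    rewrite ler_wpM2r ?normc_ge0 //.
    have := dispersion_weight k (jm j); rewrite -(subr_ge0 `|_|) => hd.
    by have := mulr_ge0 (normc_ge0 (v (jm j))) hd; rewrite expr1; lra.
rewrite -mulr_suml ler_wpM2r // mulrC ler_wpM2l //.
exact: sum_v_weight.
Qed.

(** Up to truncation, an H^2 bound on the product of the potential and the solution: Peetre's
    inequality distributes the weight. *)
Lemma nmode_weight_conv (c : int -> R[i]) : wbound m c M ->
  nmode (fun l => (weight l)%:C * \sum_(j < K) v (jm j) * c (l - jm j)) <= 2 * S * M.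
Proof.
move=> cM.
apply: (@le_trans _ _ ((\sum_(j < K) normc (v (jm j)) * weight (jm j) ^+ 1 * 2) * M)).
  apply: (nmode_sum_le (x := fun j l => (weight (l - jm j))%:C *
      c (l - jm j))) => [j|j|k].
  - by nonneg.
  - apply: wbound_n2 => //; last exact: wbound_le cM.
    by move=> k k' /addIr; exact: mode_inj.
  - rewrite mulr_sumr; apply: (le_trans (normc_sum _ _ _)); apply: ler_sum => j _.
    rewrite !normcM !normc_real !(ger0_norm (weight_ge0 _ _ _)).
    have := weightD a b (jm j) (mode N k - jm j).
    rewrite addrC subrK -(subr_ge0 (weight _)) => hw.
    have := mulr_ge0 (mulr_ge0 (normc_ge0 (v (jm j)))
      (normc_ge0 (c (mode N k - jm j)))) hw; rewrite expr1; lra.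
rewrite -mulr_suml ler_wpM2r // mulrC ler_wpM2l //.
exact: sum_v_weight.
Qed.

(** If reduction modulo N changes l - j, then l - j lies outside T_N and is high. Its representative
    r is either high too, or below N/4; in the latter case l - j = r + pN with p nonzero forces |j|
    >= N - N/2 - N/4 = N/4, so the potential mode is high. *)
Lemma aliasing_pointwise (c : int -> R[i]) (k : 'I_N) j l : l = mode N k ->
  normc (v j) * normc (c (rep (l - j)) - c (l - j)) <=
  normc (v j) * normc (high N c (rep (l - j))) +
  normc (v j) * normc (high N c (l - j)) +
  normc (high N v j) * normc (c (rep (l - j))).
Proof.
move=> lE.
have rhs0 : 0 <= normc (v j) * normc (high N c (rep (l - j))) +
    normc (v j) * normc (high N c (l - j)) +
    normc (high N v j) * normc (c (rep (l - j))).
  by nonneg.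
have [->|neq] := eqVneq (rep (l - j)) (l - j).
  by rewrite subrr normc0 mulr0 !addr_ge0 ?mulr_ge0 ?normc_ge0.
have hN := half_double N_even.
have hi : N%:Z <= 4 * `|l - j|.
  have : ~ (- (N./2)%:Z <= l - j /\ l - j < (N./2)%:Z).
    by move=> [h1 h2]; move: neq; rewrite rep_id ?eqxx.
  lia.
have -> : high N c (l - j) = c (l - j) by rewrite /high hi.
have tri : normc (c (rep (l - j)) - c (l - j)) <=
    normc (c (rep (l - j))) + normc (c (l - j)) by exact: normcB.
have v0 := normc_ge0 (v j).
have := ler_wpM2l v0 tri; rewrite mulrDr.
have [hr|hr] := boolP (N%:Z <= 4 * `|rep (l - j)|).
  have -> : high N c (rep (l - j)) = c (rep (l - j)) by rewrite /high hr.
  have : 0 <= normc (high N v j) * normc (c (rep (l - j))).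
    by rewrite mulr_ge0 ?normc_ge0.
  lra.
have -> : high N v j = v j.
  rewrite /high ifT //.
  have := mode_lt N_gt0 N_even k; have := mode_ge N_gt0 N_even k; rewrite -lE.
  have [p e] := repE N_gt0 N_even (l - j); move: neq hr e.
  move: (rep (l - j)) => r neq hr e h1 h2.
  have [p0|[p0|p0]] : p = 0 \/ p >= 1 \/ p <= -1 by lia.
  - by move: neq; rewrite e p0 mul0r addr0 eqxx.
  - have : N%:Z <= p * N%:Z by rewrite ler_peMl.
    lia.
  - have : p * N%:Z <= - N%:Z by rewrite -mulN1r ler_wpM2r.
    lia.
have : 0 <= normc (v j) * normc (high N c (rep (l - j))).
  by rewrite mulr_ge0 ?normc_ge0.
lra.
Qed.

(** 7 = 1 + 1 + 5, for the three terms of [aliasing_pointwise]. In the first two, [v] is in l^1 and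
    the high part of [c] in l^2. *)
Lemma nmode_aliasing (c X : int -> R[i]) : wbound m c M ->
  (forall k : 'I_N, normc (X (mode N k)) <= \sum_(j < K) normc (v (jm j)) *
     normc (c (rep (mode N k - jm j)) - c (mode N k - jm j))) ->
  nmode X <= 7 * S * M * h ^+ m.
Proof.
move=> cM Xc; have h0 := ltW (mesh_gt0 lt_ab N_gt0).
have hm0 : 0 <= h ^+ m by rewrite exprn_ge0.
pose X1 l : R[i] := (\sum_(j < K) normc (v (jm j)) * normc (high N c (rep (l - jm j))))%:C.
pose X2 l : R[i] := (\sum_(j < K) normc (v (jm j)) * normc (high N c (l - jm j)))%:C.
pose X3 l : R[i] := (\sum_(j < K) normc (high N v (jm j)) * normc (c (rep (l - jm j))))%:C.
have posE n (f g : 'I_n -> R[i]) : normc (\sum_j normc (f j) * normc (g j))%:C =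
    \sum_j normc (f j) * normc (g j).
  rewrite normc_real ger0_norm // sumr_ge0 // => j _.
  by rewrite mulr_ge0 ?normc_ge0.
have bX1 : nmode X1 <= S * (h ^+ m * M).
  apply: (@le_trans _ _ ((\sum_(j < K) normc (v (jm j)) * weight (jm j) ^+ 0) * (h ^+ m * M))).
    apply: (nmode_sum_le (x := fun j l => high N c (rep (l - jm j)))) => [j|j|k].
    - by rewrite mulr_ge0 ?normc_ge0.
    - by rewrite nmode_rep_shift //; exact: (high_nmode lt_ab).
    - by rewrite posE; apply: ler_sum => j _; rewrite expr0 mulr1.
  by rewrite ler_wpM2r ?mulr_ge0 // sum_v_weight.
have bX2 : nmode X2 <= S * (h ^+ m * M).
  apply: (@le_trans _ _ ((\sum_(j < K) normc (v (jm j)) * weight (jm j) ^+ 0) * (h ^+ m * M))).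
    apply: (nmode_sum_le (x := fun j l => high N c (l - jm j))) => [j|j|k].
    - by rewrite mulr_ge0 ?normc_ge0.
    - exact: (high_nmode_shift lt_ab).
    - by rewrite posE; apply: ler_sum => j _; rewrite expr0 mulr1.
  by rewrite ler_wpM2r ?mulr_ge0 // sum_v_weight.
(* Here the roles are exchanged: [c] is summed in l^1, and the high part of [v] is taken in l^2
   after folding its blocks onto T_N. An l^1 bound on high modes of [v] would lose a derivative when
   [m] equals [mV]. *)
have bX3 : nmode X3 <= c_l1 a b * M * (5 * h ^+ m * Bv).
  apply: (@le_trans _ _ ((\sum_(k < N) normc (c (mode N k))) * (5 * h ^+ m * Bv))).
    apply: (nmode_sum_le (x := fun (k : 'I_N) l =>
        fold_high N P v (rep (l - mode N k)))) => [k|k|k].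
    - exact: normc_ge0.
    - rewrite nmode_rep_shift //; apply: (fold_high_le lt_ab) => //.
      exact: wbound_le v_bound.
    - rewrite posE (sum_blocks N_gt0 N_even P (fun j =>
        normc (high N v j) * normc (c (rep (mode N k - j))))).
      rewrite [leLHS](reindex_inj (@kap_reflect_inj N N_gt0 N_even (mode N k))).
      apply: ler_sum => k' _; rewrite mode_kap // /fold_high normc_real ger0_norm; last first.
        by apply: sumr_ge0 => q _; exact: normc_ge0.
      rewrite mulr_sumr; apply: ler_sum => q _; rewrite mulrC.
      rewrite (@rep_eq N _ (mode N k - rep (mode N k - mode N k')) (P%:Z - q%:Z)).
        by rewrite repBr // subKr rep_mode.
      by ring.
  rewrite ler_wpM2r ?mulr_ge0 //.
  rewrite (eq_bigr (fun j : 'I_N => weight (mode N j) ^+ 0 * normc (c (mode N j)))).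
    by apply: wbound_l1 => //; apply: wbound_le cM; lia.
  by move=> j _; rewrite expr0 mul1r.
apply: (@le_trans _ _ (nmode (fun l => (X1 l + X2 l) + X3 l))).
  apply: nmode_le => k; apply: (le_trans (Xc k)).
  have addC x y : x%:C + y%:C = (x + y)%:C :> R[i] by rewrite rmorphD.
  rewrite /X1 /X2 /X3 !addC normc_real -!big_split /= ger0_norm; last first.
    by apply: sumr_ge0 => j _; rewrite !addr_ge0 ?mulr_ge0 ?normc_ge0.
  by apply: ler_sum => j _; exact: (aliasing_pointwise _ _ (erefl _)).
apply: (le_trans (nmodeD _ _)).
have := nmodeD X1 X2; lra.
Qed.

End Convolutions.

(** * Error of the splitting *)

Section LocalError.
Context {R : realType}.
Variables a b : R.
Hypothesis lt_ab : a < b.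
Variable N : nat.
Hypothesis N_gt0 : (0 < N)%N.
Hypothesis N_even : ~~ odd N.

Local Notation weight := (weight a b).
Local Notation freq := (freq a b).
Local Notation wave := (wave a b).
Local Notation wbound := (wbound a b).
Local Notation h := (mesh a b N).
Local Notation nmode := (nmode N).
Local Notation nnode := (nnode a b N).
Local Notation rep := (rep N).
Local Notation node := (node a b N).
Local Notation trigpoly := (trigpoly a b N).
Local Notation dispersion := (dispersion a b N).

Lemma is_cderive_trigpoly (f : R -> int -> R[i]) (df : int -> R[i]) x t :
  (forall l, is_cderive (f ^~ l) t (df l)) ->
  is_cderive (fun s => trigpoly (f s) x) t (trigpoly df x).
Proof.
move=> fd; apply: is_cderive_sum => k; apply: is_cderive_eq.
  by apply: is_cderiveM; [exact: fd|exact: is_cderive_cst].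
by rewrite mulr0 addr0.
Qed.

Lemma ccontinuous_trigpoly (f : R -> int -> R[i]) x :
  (forall l, ccontinuous (f ^~ l)) -> ccontinuous (fun s => trigpoly (f s) x).
Proof.
move=> fc; apply: ccontinuous_sum => k; apply: ccontinuousM => //.
exact: ccontinuous_cst.
Qed.

Lemma expi_shiftE (k t0 s : R) : expi (k * (s - t0)) = expi (- (k * t0)) * expi (k * s).
Proof. by rewrite -expiD; congr expi; ring. Qed.

Lemma is_cderive_expi_shift (k t0 t : R) :
  is_cderive (fun s => expi (k * (s - t0))) t ('i%C * k%:C * expi (k * (t - t0))).
Proof.
under eq_fun do rewrite expi_shiftE.
apply: is_cderive_eq; first by apply: is_cderiveZ; exact: is_cderive_expi.
by rewrite expi_shiftE; ring.
Qed.

Lemma ccontinuous_expi_shift (k t0 : R) : ccontinuous (fun s => expi (k * (s - t0))).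
Proof.
under eq_fun do rewrite expi_shiftE.
by apply: ccontinuousM; [exact: ccontinuous_cst|exact: ccontinuous_expi].
Qed.

Variables (v : int -> R[i]) (mV m : nat) (Bv M : R).
Hypothesis (Bv_ge0 : 0 <= Bv) (M_ge0 : 0 <= M).
Hypothesis (m_ge2 : (2 <= m)%N) (mV_ge5 : (5 <= mV)%N) (mV_ge : (m <= mV)%N).
Hypothesis v_bound : wbound mV v Bv.

(** [c] stands for the Fourier coefficients of the solution along one step, [g] for those of its
    product with the potential, and [del] for the error of keeping K modes of the potential, on the
    nodes as well as in the convolution. *)
Variables (P : nat) (V : R -> R) (eps tau del : R) (c g : R -> int -> R[i]).

Local Notation K := ((2 * P + 1) * N)%N.
Local Notation jm j := (mode K (nat_of_ord j)).
Local Notation S := (c_l1 a b * Bv).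

Hypothesis (eps_gt0 : 0 < eps) (eps_le1 : eps <= 1) (tau_gt0 : 0 < tau).
Hypothesis (del_ge0 : 0 <= del).
Hypothesis c_cont : forall l, ccontinuous (c ^~ l).
Hypothesis c_deriv : forall s, 0 < s < tau -> forall l, is_cderive (c ^~ l) s
  (- 'i%C * ((freq l ^+ 2)%:C * c s l + eps%:C * g s l)).
Hypothesis c_bound : forall s, 0 < s < tau -> wbound m (c s) M.
Hypothesis V_approx : forall i : 'I_N,
  normc ((V (node i))%:C - \sum_(j < K) v (jm j) * wave (jm j) (node i)) <= del.
Hypothesis g_approx : forall s, 0 < s < tau -> forall k : 'I_N,
  normc (g s (mode N k) - \sum_(j < K) v (jm j) * c s (mode N k - jm j)) <= del.

Definition phase (s : R) (l : int) : R[i] := expi (freq l ^+ 2 * (s - tau / 2)).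

(* Interaction picture at the midpoint, followed by the inverse of the potential
   flow on the grid: the increment over [0, tau] is the local error of a step. *)
Definition zfun (i : 'I_N) (s : R) : R[i] :=
  expi (eps * V (node i) * s) * trigpoly (fun l => phase s l * c s l) (node i).

(** The commutator with the Laplacian applied to the interaction picture. The operator does not
    depend on [s] and free evolution has been removed from its argument, so the time derivative
    [Ycomm'] is of order eps. *)
Definition Ycomm (s : R) (l : int) : R[i] := \sum_(j < K)
  v (jm j) * (dispersion l (jm j))%:C *
  (phase s (rep (l - jm j)) * c s (rep (l - jm j))).

Definition Ycomm' (s : R) (l : int) : R[i] := \sum_(j < K)
  v (jm j) * (dispersion l (jm j))%:C *
  (- 'i%C * eps%:C * (phase s (rep (l - jm j)) * g s (rep (l - jm j)))).

(** Factor of s - tau/2 in the derivative of [zfun]. Its own derivative [Lfun'] is O(eps^2): one eps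
    is explicit, the other comes from the potential flow or from [Ycomm']. *)
Definition Lfun (i : 'I_N) (s : R) : R[i] :=
  eps%:C * (expi (eps * V (node i) * s) * trigpoly (Ycomm s) (node i)).

Definition Lfun' (i : 'I_N) (s : R) : R[i] :=
  eps%:C * expi (eps * V (node i) * s) *
    ('i%C * (eps * V (node i))%:C * trigpoly (Ycomm s) (node i) +
     trigpoly (Ycomm' s) (node i)).

Lemma normc_phase s l : normc (phase s l) = 1.
Proof. exact: normc_expi. Qed.

Lemma phase_cderive s l : 0 < s < tau ->
  is_cderive (fun s => phase s l * c s l) s (- 'i%C * eps%:C * (phase s l * g s l)).
Proof.
move=> /c_deriv cd; apply: is_cderive_eq.
  by apply: is_cderiveM; [exact: is_cderive_expi_shift|exact: cd].
by rewrite -/(phase s l); cbv beta; ring.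
Qed.

Lemma phase_ccontinuous l : ccontinuous (fun s => phase s l * c s l).
Proof. by apply: ccontinuousM => //; exact: ccontinuous_expi_shift. Qed.

Lemma Ycomm_cderive s l : 0 < s < tau -> is_cderive (Ycomm ^~ l) s (Ycomm' s l).
Proof.
by move=> hs; apply: is_cderive_sum => j; apply: is_cderiveZ; exact: phase_cderive.
Qed.

Lemma Ycomm_ccontinuous l : ccontinuous (Ycomm ^~ l).
Proof.
apply: ccontinuous_sum => j; apply: ccontinuousM; first exact: ccontinuous_cst.
exact: phase_ccontinuous.
Qed.

Lemma Lfun_cderive s i : 0 < s < tau -> is_cderive (Lfun i) s (Lfun' i s).
Proof.
move=> hs; apply: is_cderive_eq.
  apply: is_cderiveZ; apply: is_cderiveM; first exact: is_cderive_expi.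
  by apply: is_cderive_trigpoly => l; exact: Ycomm_cderive.
by rewrite /Lfun'; ring.
Qed.

Lemma Lfun_ccontinuous i : ccontinuous (Lfun i).
Proof.
apply: ccontinuousM; first exact: ccontinuous_cst.
apply: ccontinuousM; first exact: ccontinuous_expi.
by apply: ccontinuous_trigpoly => l; exact: Ycomm_ccontinuous.
Qed.

Lemma zfun_ccontinuous i : ccontinuous (zfun i).
Proof.
apply: ccontinuousM; first exact: ccontinuous_expi.
by apply: ccontinuous_trigpoly => l; exact: phase_ccontinuous.
Qed.

(** Multiplication by the potential before and after the free flow, compared on the grid; up to a
    factor of modulus eps this is the derivative of [zfun]. *)
Definition bracket (s : R) (i : 'I_N) : R[i] :=
  (V (node i))%:C * trigpoly (fun l => phase s l * c s l) (node i) -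
  trigpoly (fun l => phase s l * g s l) (node i).

Lemma zfun_cderive s i : 0 < s < tau -> is_cderive (zfun i) s
  ('i%C * eps%:C * expi (eps * V (node i) * s) * bracket s i).
Proof.
move=> hs; apply: is_cderive_eq.
  apply: is_cderiveM; first exact: is_cderive_expi.
  by apply: is_cderive_trigpoly => l; exact: phase_cderive.
rewrite -trigpolyZ /bracket rmorphM /=; ring.
Qed.

(** Taylor remainder of the relative phase. [X2] is the aliasing error, and [zeta] and [eta] are the
    truncation errors of [g] and [V]. *)
Definition X1 (s : R) (l : int) : R[i] := \sum_(j < K)
  v (jm j) * (phase s (rep (l - jm j)) * c s (rep (l - jm j))) *
  - (expi (dispersion l (jm j) * (s - tau / 2)) - 1 -
     'i%C * (dispersion l (jm j) * (s - tau / 2))%:C).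

Definition X2 (s : R) (l : int) : R[i] := \sum_(j < K)
  v (jm j) * (phase s l * (c s (rep (l - jm j)) - c s (l - jm j))).

Definition zeta (s : R) (l : int) : R[i] :=
  g s l - \sum_(j < K) v (jm j) * c s (l - jm j).

Definition eta (i : 'I_N) : R[i] :=
  (V (node i))%:C - \sum_(j < K) v (jm j) * wave (jm j) (node i).

Lemma phase_dispersion s l j :
  phase s l = phase s (rep (l - j)) * expi (dispersion l j * (s - tau / 2)).
Proof. by rewrite /phase -expiD; congr expi; rewrite /dispersion; ring. Qed.

(** Once the products are written as aliased convolutions, the difference of the phases of l and of
    its shift is expanded at the midpoint; adding back the linear term leaves only small terms on
    the right. *)
Lemma bracketE s i : bracket s i + 'i%C * (s - tau / 2)%:C * trigpoly (Ycomm s) (node i) =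
  trigpoly (fun l => X1 s l + X2 s l) (node i) +
  (eta i * trigpoly (fun l => phase s l * c s l) (node i) -
   trigpoly (fun l => phase s l * zeta s l) (node i)).
Proof.
have -> : bracket s i = eta i * trigpoly (fun l => phase s l * c s l) (node i) +
   (\sum_(j < K) v (jm j) * wave (jm j) (node i)) *
     trigpoly (fun l => phase s l * c s l) (node i) -
   trigpoly (fun l => phase s l * g s l) (node i).
  by rewrite /bracket /eta; ring.
rewrite sum_wave_mul_trigpoly // [X in _ + X = _]trigpolyZ.
set A := eta i * _; set B := trigpoly _ _; set C := trigpoly _ _.
set D := trigpoly _ _; set E := trigpoly _ _; set F := trigpoly _ _.
suff -> : E = B - C + D + F by ring.
rewrite /B /C /D /E /F trigpolyB !trigpolyD; apply: eq_trigpoly => k.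
set l := mode N k; rewrite /zeta mulrBr.
have -> : X1 s l + X2 s l = \sum_(j < K) v (jm j) *
    (phase s (rep (l - jm j)) * c s (rep (l - jm j))) -
    phase s l * (\sum_(j < K) v (jm j) * c s (l - jm j)) +
    'i%C * (s - tau / 2)%:C * Ycomm s l.
  rewrite /X1 /X2 /Ycomm !mulr_sumr -!sumrB -!big_split; apply: eq_bigr => j _ /=.
  rewrite (phase_dispersion s l (jm j)) rmorphM /=; ring.
by ring.
Qed.

Lemma X1_le s : 0 < s < tau -> nmode (X1 s) <= 4 * tau ^+ 2 * S * M.
Proof.
move=> hs; apply: (@le_trans _ _ (16 * (s - tau / 2) ^+ 2 * S * M)).
  apply: (nmode_dispersion_remainder (P := P) lt_ab N_gt0 N_even Bv_ge0 M_ge0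
    m_ge2 mV_ge5 v_bound (c_bound hs)) => k.
  apply: (le_trans (normc_sum _ _ _)); apply: ler_sum => j _.
  rewrite !normcM normc_phase mul1r normcN [leLHS]mulrAC ler_wpM2r ?normc_ge0 //.
  by rewrite ler_wpM2l ?normc_ge0 // normc_expi_sub1_sub.
rewrite ler_wpM2r // ler_wpM2r ?S_ge0 //.
have : (s - tau / 2) ^+ 2 <= (tau / 2) ^+ 2; last by lra.
rewrite -[leLHS](real_normK (num_real _)) ler_pXn2r ?nnegrE //; last by lra.
by rewrite ler_norml; apply/andP; split; lra.
Qed.

Lemma X2_le s : 0 < s < tau -> nmode (X2 s) <= 7 * S * M * h ^+ m.
Proof.
move=> hs; apply: (nmode_aliasing (P := P) lt_ab N_gt0 N_even Bv_ge0 M_ge0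
    m_ge2 mV_ge5 mV_ge v_bound (c_bound hs)) => k.
apply: (le_trans (normc_sum _ _ _)); apply: ler_sum => j _.
by rewrite !normcM normc_phase mul1r.
Qed.

Lemma nmode_phase (y : int -> R[i]) s : nmode (fun l => phase s l * y l) = nmode y.
Proof. by apply: n2_isometryM => k; exact: normc_phase. Qed.

Lemma Ycomm_le s : 0 < s < tau -> nmode (Ycomm s) <= 2 * S * M.
Proof.
move=> hs; apply: (nmode_dispersion (P := P) lt_ab N_gt0 N_even Bv_ge0 mV_ge5
    v_bound M_ge0 (nmode_weight N_gt0 N_even M_ge0 m_ge2 (c_bound hs))) => k.
apply: (le_trans (normc_sum _ _ _)); apply: ler_sum => j _.
by rewrite !normcM normc_phase mul1r normc_real.
Qed.

(** The largest weight on T_N. It grows with N, but only ever multiplies [del]. *)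
Definition top_weight : R := weight (N./2)%:Z.

Lemma zeta_weight_le s : 0 < s < tau ->
  nmode (fun l => (weight l)%:C * zeta s l) <= N%:R * (top_weight * del).
Proof.
move=> hs; apply: n2_cst_le => [|k].
  by rewrite mulr_ge0 // weight_ge0.
rewrite normcM normc_real ger0_norm ?weight_ge0 //.
apply: ler_pM; rewrite ?weight_ge0 ?normc_ge0 //; last exact: g_approx.
apply: (le_weight lt_ab).
by have := mode_ge N_gt0 N_even k; have := mode_lt N_gt0 N_even k; lia.
Qed.

Lemma zeta_le s : 0 < s < tau -> nmode (zeta s) <= N%:R * del.
Proof. by move=> hs; apply: n2_cst_le => // k; exact: g_approx. Qed.

Lemma Ycomm'_le s : 0 < s < tau ->
  nmode (Ycomm' s) <= eps * (2 * S * (2 * S * M + N%:R * (top_weight * del))).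
Proof.
move=> hs; pose Z l := \sum_(j < K) v (jm j) * (dispersion l (jm j))%:C *
  (phase s (rep (l - jm j)) * g s (rep (l - jm j))).
have -> : nmode (Ycomm' s) = eps * nmode Z.
  rewrite -[eps in RHS](ger0_norm (ltW eps_gt0)) -normc_real -n2Z.
  apply: (@etrans _ _ (n2 (fun k : 'I_N => - 'i%C * (eps%:C * Z (mode N k))))).
    apply: n2_eq => k; rewrite /Ycomm' /Z !mulr_sumr; apply: eq_bigr => j _; ring.
  by apply: n2_isometryM => k; rewrite normcN /normc /= expr0n add0r expr1n sqrtr1.
rewrite ler_wpM2l //; first exact: ltW.
have S0 := S_ge0 a b Bv_ge0.
apply: (nmode_dispersion (P := P) (y := g s) lt_ab N_gt0 N_even Bv_ge0 mV_ge5 v_bound).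
- apply: addr_ge0; first by apply: mulr_ge0 => //; apply: mulr_ge0.
  by apply: mulr_ge0 => //; apply: mulr_ge0 => //; exact: weight_ge0.
- apply: (@le_trans _ _ (nmode (fun l => (weight l)%:C *
      (\sum_(j < K) v (jm j) * c s (l - jm j)) + (weight l)%:C * zeta s l))).
    by apply: nmode_le => k; rewrite -mulrDr /zeta [_ + (g s _ - _)]addrC subrK.
  apply: (le_trans (nmodeD _ _ _)); apply: lerD; last exact: zeta_weight_le.
  exact: (nmode_weight_conv lt_ab N_gt0 N_even Bv_ge0 M_ge0 m_ge2 mV_ge5 v_bound P
    (c_bound hs)).
- move=> k; apply: (le_trans (normc_sum _ _ _)); apply: ler_sum => j _.
  by rewrite !normcM normc_phase mul1r normc_real.
Qed.

Lemma V_le (i : 'I_N) : `|V (node i)| <= S + del.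
Proof.
rewrite -normc_real.
have -> : (V (node i))%:C = (\sum_(j < K) v (jm j) * wave (jm j) (node i)) + eta i.
  by rewrite /eta addrC subrK.
apply: (le_trans (le_normcD _ _)); apply: lerD; last exact: V_approx.
apply: (le_trans (normc_sum _ _ _)).
apply: le_trans (sum_v_weight lt_ab N Bv_ge0 mV_ge5 v_bound P (p := 0) isT).
by apply: ler_sum => j _; rewrite normcM normc_wave expr0.
Qed.

Local Notation sqN := (Num.sqrt (N%:R : R)).

(** 6 = 2 + 4: the potential flow contributes S times 2SM, and the derivative of the commutator 2S
    times 2SM. *)
Definition Lam : R := 6 * S ^+ 2 * M + del * (2 * S * M + 2 * S * N%:R * top_weight).

Lemma Lfun'_le s : 0 < s < tau -> n2 (Lfun' ^~ s) <= eps ^+ 2 * sqN * Lam.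
Proof.
move=> hs; have S0 := S_ge0 a b Bv_ge0; have e0 := ltW eps_gt0.
rewrite (@n2_eq _ _ _ (fun i : 'I_N => expi (eps * V (node i) * s) * (eps%:C *
  ('i%C * (eps * V (node i))%:C * trigpoly (Ycomm s) (node i) +
     trigpoly (Ycomm' s) (node i))))); last by move=> i; rewrite /Lfun'; ring.
rewrite n2_isometryM => [|i]; last exact: normc_expi.
rewrite n2Z normc_real ger0_norm // expr2 -!mulrA ler_wpM2l //.
apply: (le_trans (n2D _ _)).
have h1 : n2 (fun i : 'I_N => 'i%C * (eps * V (node i))%:C *
    trigpoly (Ycomm s) (node i)) <= eps * (S + del) * (sqN * (2 * S * M)).
  have B0 : 0 <= eps * (S + del) by rewrite mulr_ge0 // addr_ge0.
  apply: (@le_trans _ _ (eps * (S + del) * nnode (trigpoly (Ycomm s)))).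
    apply: n2_le_normM => // i.
    rewrite normcM normc_real normrM (ger0_norm e0) /normc /= expr0n add0r expr1n.
    by rewrite sqrtr1 mul1r ler_wpM2l // V_le.
  rewrite ler_wpM2l // discrete_parseval // ler_wpM2l ?sqrtr_ge0 //.
  exact: Ycomm_le.
have h2 : n2 (fun i : 'I_N => trigpoly (Ycomm' s) (node i)) <=
    sqN * (eps * (2 * S * (2 * S * M + N%:R * (top_weight * del)))).
  rewrite -[n2 _]/(nnode (trigpoly (Ycomm' s))) discrete_parseval //.
  by rewrite ler_wpM2l ?sqrtr_ge0 // Ycomm'_le.
apply: (le_trans (lerD h1 h2)); rewrite /Lam le_eqVlt; apply/orP; left; apply/eqP.
by ring.
Qed.

(** Collects all factors of [del]. *)
Definition local_error_cst : R :=
  (M + N%:R) + tau ^+ 2 / 4 * (2 * S * M + 2 * S * N%:R * top_weight).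

Lemma local_error :
  n2 (fun i => zfun i tau - zfun i 0) <= eps * tau * sqN *
    ((7 * S * M + 2 * S ^+ 2 * M) * (h ^+ m + tau ^+ 2) + del * local_error_cst).
Proof.
have S0 := S_ge0 a b Bv_ge0; have e0 := ltW eps_gt0.
have q0 : 0 <= sqN by exact: sqrtr_ge0.
have W0 : 0 <= top_weight by exact: weight_ge0.
have hm0 : 0 <= h ^+ m by rewrite exprn_ge0 // ltW // mesh_gt0.
have Lam0 : 0 <= Lam.
  by rewrite /Lam; nonneg.
(* Integration by parts carried out before estimating: subtracting this antiderivative cancels the
   linear part of the derivative of [zfun] and leaves a term with [Lfun']. *)
pose q (i : 'I_N) s := zfun i s - ((s - tau / 2) ^+ 2 / 2)%:C * Lfun i s.
pose dq (i : 'I_N) s := 'i%C * eps%:C * expi (eps * V (node i) * s) * bracket s i -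
  ((s - tau / 2)%:C * Lfun i s + ((s - tau / 2) ^+ 2 / 2)%:C * Lfun' i s).
(* The quadratic weight is tau^2/8 at both ends, so the correction only costs an increment of
   [Lfun]. *)
have qE : n2 (fun i => zfun i tau - zfun i 0) <= n2 (fun i => q i tau - q i 0) +
    tau ^+ 2 / 8 * n2 (fun i => Lfun i tau - Lfun i 0).
  rewrite -[tau ^+ 2 / 8]ger0_norm ?divr_ge0 ?sqr_ge0 // -normc_real -n2Z.
  apply: le_trans (n2D _ _); apply: n2_le => i.
  apply: le_of_eq; congr normc.
  have -> : tau ^+ 2 / 8 = (tau - tau / 2) ^+ 2 / 2 by field.
  rewrite /q; have -> : (0 - tau / 2) ^+ 2 / 2 = (tau - tau / 2) ^+ 2 / 2 by field.
  by ring.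
have L_incr : n2 (fun i => Lfun i tau - Lfun i 0) <= tau * (eps ^+ 2 * sqN * Lam).
  apply: (n2_mean_value (dq := Lfun')) => //.
  - by move=> i; exact: Lfun_ccontinuous.
  - by move=> s hs i; exact: Lfun_cderive.
  - exact: Lfun'_le.
have q_incr : n2 (fun i => q i tau - q i 0) <= tau * (eps * sqN *
    (S * M * (4 * tau ^+ 2 + 7 * h ^+ m) + del * (M + N%:R)) +
    tau ^+ 2 / 8 * (eps ^+ 2 * sqN * Lam)).
  have th_deriv (s : R) : is_derive s (1 : R) (fun s : R => (s - tau / 2) ^+ 2 / 2) (s - tau / 2).
    have h1 : is_derive s (1 : R) (fun s : R => s - tau / 2) 1.
      by apply: is_derive_eq; rewrite ?subr0 ?addr0.
    have h2 := is_deriveZ 2^-1 (is_deriveM h1 h1).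
    under eq_fun do rewrite mulrC expr2.
    by apply: (is_derive_eq h2); rewrite /GRing.scale /=; field.
  have th_cont : continuous (fun s : R => (s - tau / 2) ^+ 2 / 2).
    move=> s; apply/differentiable_continuous/derivable1_diffP.
    by case: (th_deriv s).
  apply: (n2_mean_value (dq := dq)) => //.
  - move=> i; rewrite /q; under eq_fun do rewrite -mulN1r.
    apply: ccontinuousD; first exact: zfun_ccontinuous.
    apply: ccontinuousM; first exact: ccontinuous_cst.
    apply: ccontinuousM; first exact: ccontinuous_real.
    exact: Lfun_ccontinuous.
  - move=> s hs i; rewrite /q; under eq_fun do rewrite -mulN1r.
    apply: is_cderive_eq.
      apply: is_cderiveD; first exact: zfun_cderive.
      apply: is_cderiveZ; apply: is_cderiveM; last exact: Lfun_cderive.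
      exact: is_cderive_real.
    by rewrite mulN1r.
  - move=> s hs.
    have th2 : (s - tau / 2) ^+ 2 / 2 <= tau ^+ 2 / 8.
      have : (s - tau / 2) ^+ 2 <= (tau / 2) ^+ 2; last by lra.
      rewrite -[leLHS](real_normK (num_real _)) ler_pXn2r ?nnegrE //; last by lra.
      by rewrite ler_norml; apply/andP; split; lra.
    rewrite (@n2_eq _ _ _ (fun i => eps%:C * ('i%C * expi (eps * V (node i) * s) *
      (trigpoly (fun l => X1 s l + X2 s l) (node i) +
       (eta i * trigpoly (fun l => phase s l * c s l) (node i) -
        trigpoly (fun l => phase s l * zeta s l) (node i)))) +
      (- ((s - tau / 2) ^+ 2 / 2))%:C * Lfun' i s)); last first.
      move=> i; rewrite -bracketE /dq /Lfun [in RHS]rmorphN /=.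
      have ii : 'i%C * 'i%C = -1 :> R[i] by rewrite -expr2 sqr_i.
      set E := expi _; set Y := trigpoly _ _; set D := (_ / 2)%:C; set L := Lfun' _ _.
      set Bk := bracket _ _; rewrite [_ * (Bk + _)]mulrDr.
      have -> : 'i%C * E * ('i%C * (s - tau / 2)%:C * Y) =
        ('i%C * 'i%C) * (E * (s - tau / 2)%:C * Y) by ring.
      by rewrite ii; ring.
    apply: (le_trans (n2D _ _)); apply: lerD; last first.
      rewrite n2Z normc_real normrN ger0_norm ?divr_ge0 ?sqr_ge0 //.
      apply: ler_pM => //; rewrite ?n2_ge0 ?divr_ge0 ?sqr_ge0 //.
      exact: Lfun'_le.
    rewrite n2Z normc_real ger0_norm // -mulrA ler_wpM2l //.
    rewrite n2_isometryM => [|i]; last first.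
      by rewrite normcM normc_expi mulr1 /normc /= expr0n add0r expr1n sqrtr1.
    apply: (le_trans (n2D _ _)).
    have b1 : nnode (trigpoly (fun l => X1 s l + X2 s l)) <=
        sqN * (S * M * (4 * tau ^+ 2 + 7 * h ^+ m)).
      rewrite discrete_parseval // ler_wpM2l //; apply: (le_trans (nmodeD _ _ _)).
      by have := X1_le hs; have := X2_le hs; lra.
    have b2 : n2 (fun i => eta i * trigpoly (fun l => phase s l * c s l) (node i)) <=
        del * (sqN * M).
      apply: (@le_trans _ _ (del * nnode (trigpoly (fun l => phase s l * c s l)))).
        by apply: n2_le_normM => // i; exact: V_approx.
      rewrite discrete_parseval // nmode_phase ler_wpM2l // ler_wpM2l //.
      exact: (nmode_wbound N_gt0 N_even M_ge0 (c_bound hs)).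
    have b3 : nnode (trigpoly (fun l => phase s l * zeta s l)) <=
        sqN * (N%:R * del).
      by rewrite discrete_parseval // nmode_phase ler_wpM2l // zeta_le.
    have b23 := n2D (fun i => eta i * trigpoly (fun l => phase s l * c s l) (node i))
      (fun i : 'I_N => - trigpoly (fun l => phase s l * zeta s l) (node i)).
    rewrite n2N in b23; rewrite mulrDr; apply: lerD; first exact: b1.
    apply: (le_trans b23); apply: (le_trans (lerD b2 b3)).
    by apply: le_of_eq; ring.
(* The spare power of eps is given up, since the bracketed part of the other terms carries only
   one. *)
have e2 : eps ^+ 2 * sqN * Lam <= eps * sqN * Lam.
  by rewrite ler_wpM2r // ler_wpM2r // expr2 ler_piMl.
have t8 : 0 <= tau ^+ 2 / 8 by rewrite divr_ge0 ?sqr_ge0.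
have := ler_wpM2l (ltW tau_gt0) e2; have := ler_wpM2l t8 e2 => /=.
move=> h1 /= h2; apply: (le_trans qE).
apply: (le_trans (lerD q_incr (ler_wpM2l t8 (le_trans L_incr h2)))).
have h3 := ler_wpM2l (ltW tau_gt0) h1; rewrite /= in h3.
rewrite mulrDr; apply: (le_trans (lerD (lerD (lexx _) h3) (lexx _))).
(* Slack for rounding the constants: 4 becomes 7 next to tau^2, the 6/4 from two terms with tau^2/8
   becomes 2, and the S^2 term also receives h^m. *)
have SM0 : 0 <= eps * tau * sqN * (S * M * tau ^+ 2) by nonneg; exact: ltW.
have SM2 : 0 <= eps * tau * sqN * (S ^+ 2 * M * h ^+ m).
  apply: mulr_ge0; last by apply: mulr_ge0 => //; nonneg.
  by nonneg; exact: ltW.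
have SM1 : 0 <= eps * tau * sqN * (S ^+ 2 * M * tau ^+ 2) by nonneg; exact: ltW.
rewrite /Lam /local_error_cst; lra.
Qed.

End LocalError.

(** * Stability and accumulation of the local errors *)

Section GlobalError.
Context {R : realType}.
Variables a b : R.
Hypothesis lt_ab : a < b.
Variable N : nat.
Hypothesis N_gt0 : (0 < N)%N.
Hypothesis N_even : ~~ odd N.

Local Notation freq := (freq a b).
Local Notation wave := (wave a b).
Local Notation wbound := (wbound a b).
Local Notation h := (mesh a b N).
Local Notation nmode := (nmode N).
Local Notation nnode := (nnode a b N).
Local Notation node := (node a b N).
Local Notation trigpoly := (trigpoly a b N).
Local Notation sqN := (Num.sqrt (N%:R : R)).
Local Notation blocks P := ((2 * P + 1) * N)%N.

Variables (v : int -> R[i]) (mV m : nat) (Bv M : R).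
Hypothesis (Bv_ge0 : 0 <= Bv) (M_ge0 : 0 <= M).
Hypothesis (m_ge2 : (2 <= m)%N) (mV_ge5 : (5 <= mV)%N) (mV_ge : (m <= mV)%N).
Hypothesis v_bound : wbound mV v Bv.

Variables (V : R -> R) (eps tau : R) (psi0 : R -> R[i]) (c g : R -> int -> R[i]).
Variable T : R.
Hypothesis (eps_gt0 : 0 < eps) (eps_le1 : eps <= 1) (tau_gt0 : 0 < tau).
Hypothesis c_cont : forall l, ccontinuous (c ^~ l).
Hypothesis c_deriv : forall s, 0 < s -> forall l, is_cderive (c ^~ l) s
  (- 'i%C * ((freq l ^+ 2)%:C * c s l + eps%:C * g s l)).
Hypothesis c_bound : forall s, 0 <= s <= T -> wbound m (c s) M.
Hypothesis Vg_approx : forall del, 0 < del -> exists P,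
  (forall i : 'I_N, normc ((V (node i))%:C -
     \sum_(j < blocks P) v (mode (blocks P) j) * wave (mode (blocks P) j) (node i)) <= del) /\
  (forall s, 0 < s <= T -> forall k : 'I_N, normc (g s (mode N k) -
     \sum_(j < blocks P) v (mode (blocks P) j) *
       c s (mode N k - mode (blocks P) j)) <= del).
Hypothesis psi0_approx : forall del, 0 < del -> exists P, forall i : 'I_N,
  normc (psi0 (node i) -
    \sum_(j < blocks P) c 0 (mode (blocks P) j) * wave (mode (blocks P) j) (node i)) <= del.

Local Notation S := (c_l1 a b * Bv).
Local Notation y n := (discrete_coef a b (tsfp a b N V eps tau psi0 n)).

Definition global_error (n : nat) : R := nmode (fun l => c (n%:R * tau) l - y n l).

Definition step_cst : R := 7 * S * M + 2 * S ^+ 2 * M.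

Let N_gt0R : 0 < sqN.
Proof. by rewrite sqrtr_gt0 ltr0n. Qed.

Lemma sum_blocks_wave i (P : nat) :
  \sum_(j < blocks P) c 0 (mode (blocks P) j) * wave (mode (blocks P) j) (node i) =
  trigpoly (fun l => \sum_(q < 2 * P + 1) c 0 (l + (q%:Z - P%:Z) * N%:Z)) (node i).
Proof.
rewrite (sum_blocks N_gt0 N_even P (fun j => c 0 j * wave j (node i))).
apply: eq_bigr => k _; rewrite mulr_suml; apply: eq_bigr => q _; congr (_ * _).
by rewrite -[LHS]wave_rep // repD_mul wave_rep.
Qed.

(** The block [q = P] is the exact coefficient; every other frequency of the class is at least N/2
    and hence counted by [fold_high]. *)
Lemma alias0_le (P : nat) (k : 'I_N) :
  normc (\sum_(q < 2 * P + 1) c 0 (mode N k + (q%:Z - P%:Z) * N%:Z) - c 0 (mode N k)) <=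
  normc (fold_high N P (c 0) (mode N k)).
Proof.
have P1 : (P < 2 * P + 1)%N by lia.
rewrite (bigD1 (Ordinal P1)) // subrr mul0r addr0 addrAC subrr add0r.
rewrite /fold_high normc_real ger0_norm; last first.
  by apply: sumr_ge0 => q _; exact: normc_ge0.
apply: (le_trans (normc_sum _ _ _)).
rewrite [leRHS](bigD1 (Ordinal P1)) //; apply: ler_wpDl; first exact: normc_ge0.
apply: ler_sum => q; rewrite -val_eqE /= => qP.
rewrite /high ifT //.
have := mode_ge N_gt0 N_even k; have := mode_lt N_gt0 N_even k; have := half_double N_even.
move: (mode N k) => r hN r1 r2; set d := q%:Z - P%:Z.
have [d0|d0] : d >= 1 \/ d <= -1 by rewrite /d; lia.
  have : N%:Z <= d * N%:Z by rewrite ler_peMl.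
  lia.
have : d * N%:Z <= - N%:Z by rewrite -mulN1r ler_wpM2r.
lia.
Qed.

Lemma tsfpS n : tsfp a b N V eps tau psi0 n.+1 =
  strang_step a b V eps tau (tsfp a b N V eps tau psi0 n).
Proof. by []. Qed.

(** At time 0 the error is pure aliasing: interpolation of the initial datum folds the high modes
    onto T_N. The 5 is that of [fold_high_le]. *)
Lemma global_error0 : 0 <= T -> global_error 0 <= 5 * h ^+ m * M.
Proof.
move=> T0; have c0B : wbound m (c 0) M by apply: c_bound; rewrite lexx.
rewrite /global_error mul0r; apply/ler_addgt0Pr => e e0.
(* The accuracy is chosen so that, after the factor N of [n2_cst_le], it is [sqN * e], that is [e]
   after division by the Parseval factor. *)
have [P hP] := psi0_approx (divr_gt0 e0 N_gt0R).
pose F l := \sum_(q < 2 * P + 1) c 0 (l + (q%:Z - P%:Z) * N%:Z).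
rewrite -(ler_pM2l N_gt0R) -(discrete_parseval lt_ab N_gt0 N_even).
apply: (@le_trans _ _ (n2 (fun i : 'I_N =>
    - (trigpoly (fun l => F l - c 0 l) (node i)) +
    - (psi0 (node i) - trigpoly F (node i))))).
  apply: n2_le => i; rewrite -!trigpolyB trigpoly_discrete_coef //=.
  by rewrite mxE le_eqVlt; apply/orP; left; apply/eqP; congr normc; ring.
apply: (le_trans (n2D _ _)); rewrite mulrDr !n2N; apply: lerD.
  rewrite -[n2 _]/(nnode _) discrete_parseval // ler_wpM2l //.
  apply: le_trans (fold_high_le lt_ab N_gt0 N_even P m_ge2 M_ge0 c0B).
  by apply: nmode_le => k; exact: alias0_le.
have -> : sqN * e = N%:R * (e / sqN).
  transitivity (sqN * sqN * (e / sqN)); first by field; rewrite gt_eqF.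
  by rewrite -expr2 sqr_sqrtr.
apply: n2_cst_le => [|i]; first by rewrite divr_ge0 ?ltW.
by rewrite /F -sum_blocks_wave; exact: hP.
Qed.

Lemma local_error_uniform n : (n.+1%:R * tau <= T) ->
  n2 (fun i : 'I_N => zfun a b V eps tau (fun s => c (n%:R * tau + s)) i tau -
    zfun a b V eps tau (fun s => c (n%:R * tau + s)) i 0) <=
  sqN * (eps * tau * (step_cst * (h ^+ m + tau ^+ 2))).
Proof.
move=> nT; apply/ler_addgt0Pr => e e0.
have t0 := ltW tau_gt0; have ep0 := ltW eps_gt0.
set D := local_error_cst a b N Bv M tau.
have D0 : 0 <= D.
  rewrite /D /local_error_cst /top_weight; have := S_ge0 a b Bv_ge0.
  have := weight_ge0 a b (N./2)%:Z.
  move: (weight _ _ _) (c_l1 _ _ * _) => w s w0 s0.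
  by rewrite !addr_ge0 ?mulr_ge0 ?divr_ge0 ?sqr_ge0 ?addr_ge0 ?mulr_ge0.
have A0 : 0 < eps * tau * sqN * D + 1.
  by rewrite ltr_wpDl // !mulr_ge0 // ltW.
(* Truncation is removed here: N and tau are fixed, so [del] may be chosen after [D]. The summand 1
   in the denominator guarantees positivity. *)
have [P [VP gP]] := Vg_approx (divr_gt0 e0 A0).
have in_T s : 0 < s < tau -> 0 < n%:R * tau + s <= T.
  move=> /andP[s0 st]; rewrite ltr_wpDl ?mulr_ge0 //=; apply: le_trans nT.
  by rewrite -[n.+1%:R]natr1 mulrDl mul1r lerD2l ltW.
have cs_deriv s : 0 < s < tau -> forall l,
    is_cderive (fun s => c (n%:R * tau + s) l) s
      (- 'i%C * ((freq l ^+ 2)%:C * c (n%:R * tau + s) l +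
         eps%:C * g (n%:R * tau + s) l)).
  move=> hs l; have /andP[ts _] := in_T _ hs.
  have [dr di] := c_deriv ts l.
  have dsh : is_derive s (1 : R) (fun s : R => n%:R * tau + s) 1.
    by under eq_fun do rewrite addrC; exact: is_derive_shift.
  split.
    by have := is_derive1_comp dr dsh; rewrite mulr1.
  by have := is_derive1_comp di dsh; rewrite mulr1.
have cs_cont l : ccontinuous (fun s => c (n%:R * tau + s) l).
  have sh : continuous (fun s : R => n%:R * tau + s).
    by move=> s; apply: cvgD; [exact: cvg_cst|exact: cvg_id].
  have [cr ci] := c_cont l; split=> s.
    exact: (continuous_comp (sh s) (cr _)).
  exact: (continuous_comp (sh s) (ci _)).
apply: (le_trans (local_error lt_ab N_gt0 N_even Bv_ge0 M_ge0 m_ge2 mV_ge5 mV_ge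
  v_bound eps_gt0 eps_le1 tau_gt0 (ltW (divr_gt0 e0 A0)) cs_cont cs_deriv _ VP _)).
- by move=> s /in_T /andP[/ltW s0 sT]; apply: c_bound; rewrite s0.
- by move=> s /in_T hs k; exact: gP.
rewrite -/D mulrDr; apply: lerD.
  by rewrite /step_cst le_eqVlt; apply/orP; left; apply/eqP; ring.
have -> : eps * tau * sqN * (e / (eps * tau * sqN * D + 1) * D) =
    e * (eps * tau * sqN * D) / (eps * tau * sqN * D + 1) by ring.
by rewrite ler_pdivrMr // ler_wpM2l ?lerDl // ltW.
Qed.

(** Kinetic steps are unimodular on modes and the potential step is unimodular on nodes;
    [discrete_parseval] passes between the two. The old error is therefore transported without
    growth, and what remains is the increment of [zfun]. *)
Lemma global_errorS n : (n.+1%:R * tau <= T) ->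
  global_error n.+1 <= global_error n + eps * tau * (step_cst * (h ^+ m + tau ^+ 2)).
Proof.
move=> nT; rewrite -(ler_pM2l N_gt0R) mulrDr /global_error.
pose D l : R[i] := expi (- (tau * freq l ^+ 2 / 2)).
set u := tsfp a b N V eps tau psi0 n.
pose u1 := kinetic_half_step a b tau u.
pose u2 := potential_step a b V eps tau u1.
pose z := @zfun R a b N V eps tau (fun s => c (n%:R * tau + s)).
have kinE (w : 'cV[R[i]]_N.+1) j : kinetic_half_step a b tau w j 0 =
    trigpoly (fun l => D l * discrete_coef a b w l) (node j).
  by rewrite mxE.
have y1E k : y n.+1 (mode N (nat_of_ord k)) =
    D (mode N k) * discrete_coef a b u2 (mode N (nat_of_ord (k : 'I_N))).
  rewrite tsfpS (discrete_coef_trigpoly lt_ab N_gt0 N_even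
    (y := fun l => D l * discrete_coef a b u2 l)) // => i.
  by rewrite /strang_step kinE.
(* The last kinetic half step is undone on the modes. *)
have -> : nmode (fun l => c (n.+1%:R * tau) l - y n.+1 l) =
    nmode (fun l => expi (tau * freq l ^+ 2 / 2) * c (n.+1%:R * tau) l -
                    discrete_coef a b u2 l).
  transitivity (n2 (fun k : 'I_N => D (mode N k) *
      (expi (tau * freq (mode N k) ^+ 2 / 2) * c (n.+1%:R * tau) (mode N k) -
                    discrete_coef a b u2 (mode N k)))).
    apply: n2_eq => k; rewrite y1E mulrBr; congr (_ - _).
    by rewrite [RHS]mulrA /D expiNK mul1r.
  by apply: n2_isometryM => k; exact: normc_expi.
rewrite -!(discrete_parseval lt_ab N_gt0 N_even).
(* At the left end [zfun] is the first half step applied to the exact solution; at the right end it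
   is the exact solution with the last half step and the potential step undone. *)
have z0E (i : 'I_N) : z i 0 = trigpoly (fun l => D l * c (n%:R * tau) l) (node i).
  rewrite /z /zfun mulr0 expi0 mul1r addr0; apply: eq_trigpoly => k.
  by congr (_ * _); rewrite /phase /D; congr expi; ring.
have zT (i : 'I_N) : z i tau = expi (eps * V (node i) * tau) * trigpoly (fun l =>
    expi (tau * freq l ^+ 2 / 2) * c (n.+1%:R * tau) l) (node i).
  rewrite /z /zfun -[n.+1%:R]natr1 mulrDl mul1r; congr (_ * _); apply: eq_trigpoly => k.
  by congr (_ * _); rewrite /phase; congr expi; field.
(* Multiplying each node by the inverse potential phase cancels the potential step of the scheme. *)
apply: (@le_trans _ _ (n2 (fun i : 'I_N => z i tau -
    trigpoly (fun l => D l * y n l) (node i)))).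
  rewrite /nnode -(@n2_isometryM _ _ (fun i : 'I_N => expi (eps * V (node i) * tau))
    (fun i => trigpoly _ (node i))); last by move=> i; exact: normc_expi.
  apply: n2_le => i; rewrite -trigpolyB mulrBr trigpoly_discrete_coef //.
  rewrite zT /u2 mxE kinE mulrA -expiD [node (widen_ord _ _)]/(node i).
  have -> : eps * V (node i) * tau + - (eps * tau * V (node i)) = 0 by ring.
  by rewrite expi0 mul1r.
apply: (@le_trans _ _ (n2 (fun i : 'I_N =>
    trigpoly (fun l => D l * (c (n%:R * tau) l - y n l)) (node i) +
    (z i tau - z i 0)))).
  apply: n2_le => i; rewrite z0E.
  have -> : trigpoly (fun l => D l * (c (n%:R * tau) l - y n l)) (node i) =
    trigpoly (fun l => D l * c (n%:R * tau) l) (node i) -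
    trigpoly (fun l => D l * y n l) (node i).
    by rewrite trigpolyB; apply: eq_trigpoly => k; rewrite mulrBr.
  by apply: le_of_eq; congr normc; ring.
apply: (le_trans (n2D _ _)); apply: lerD; last exact: local_error_uniform.
rewrite -[n2 _]/(nnode (trigpoly _)) !discrete_parseval // ler_wpM2l ?sqrtr_ge0 //.
by apply: le_of_eq; apply: n2_isometryM => k; exact: normc_expi.
Qed.

Lemma global_error_le n : n%:R * tau <= T -> global_error n <=
  5 * h ^+ m * M + eps * (n%:R * tau) * (step_cst * (h ^+ m + tau ^+ 2)).
Proof.
elim: n => [|n IHn] nT.
  rewrite mul0r mulr0 mul0r addr0; apply: global_error0.
  by rewrite mul0r in nT.
have nT' : n%:R * tau <= T.
  by apply: le_trans nT; rewrite ler_pM2r // ler_nat.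
apply: (le_trans (global_errorS nT)); apply: (le_trans (lerD (IHn nT') (lexx _))).
by rewrite -[n.+1%:R]natr1 le_eqVlt; apply/orP; left; apply/eqP; ring.
Qed.

End GlobalError.

(** * Fourier coefficients *)

Section ComplexIntegral.
Local Open Scope classical_set_scope.
Context {R : realType}.
Variables a b : R.
Hypothesis lt_ab : a < b.

Local Notation mu := (@lebesgue_measure R).
Local Notation Iab := (`]a, b[ : set R).
Local Notation cint f := (cintegral a b f).

Definition rintegrable (f : R -> R) : Prop := mu.-integrable Iab (EFin \o f).

Definition cmeasurable (f : R -> R[i]) : Prop :=
  measurable_fun Iab (fun x => Re (f x)) /\ measurable_fun Iab (fun x => Im (f x)).

Definition cintegrable (f : R -> R[i]) : Prop :=
  rintegrable (fun x => Re (f x)) /\ rintegrable (fun x => Im (f x)).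

Lemma mu_Iab : mu Iab = (b - a)%:E.
Proof. by rewrite lebesgue_measure_itv /= lte_fin lt_ab. Qed.

Lemma Rintegral_Iab_cst k : \int[mu]_(x in Iab) k = k * (b - a).
Proof. by rewrite Rintegral_cst //= lebesgue_measure_itv /= lte_fin lt_ab. Qed.

Lemma mu_Iab_lty : (mu Iab < +oo)%E.
Proof. by rewrite mu_Iab ltry. Qed.

Lemma rintegrableD f g : rintegrable f -> rintegrable g ->
  rintegrable (fun x => f x + g x).
Proof.
move=> fi gi; apply: eq_integrable (integrableD _ fi gi) => //.
Qed.

Lemma rintegrableB f g : rintegrable f -> rintegrable g ->
  rintegrable (fun x => f x - g x).
Proof.
move=> fi gi; apply: eq_integrable (integrableB _ fi gi) => //.
Qed.

Lemma rintegrableZ k f : rintegrable f -> rintegrable (fun x => k * f x).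
Proof.
move=> fi; apply: eq_integrable (integrableZl _ k fi) => //.
Qed.

Lemma rintegrable_le (f g : R -> R) : measurable_fun Iab f ->
  (forall x, Iab x -> `|f x| <= g x) -> rintegrable g -> rintegrable f.
Proof.
move=> mf fg gi; apply: (le_integrable _ _ _ gi) => //.
  exact/measurable_EFinP.
by move=> x xI /=; rewrite lee_fin (le_trans (fg _ xI)) // ler_norm.
Qed.

Lemma rintegrable_cst k : rintegrable (fun=> k).
Proof.
apply: measurable_bounded_integrable => //; first exact: mu_Iab_lty.
exact: bounded_cst.
Qed.

Lemma rintegrable_bounded (f : R -> R) B : measurable_fun Iab f ->
  (forall x, Iab x -> `|f x| <= B) -> rintegrable f.
Proof. by move=> mf fB; exact: rintegrable_le mf fB (rintegrable_cst B). Qed.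

Lemma rintegrable_measurable f : rintegrable f -> measurable_fun Iab f.
Proof. by move=> /measurable_int/measurable_EFinP. Qed.

Lemma cintegrableD f g : cintegrable f -> cintegrable g ->
  cintegrable (fun x => f x + g x).
Proof.
move=> [fr fi] [gr gi]; split.
  by under eq_fun do rewrite ReD; exact: rintegrableD.
by under eq_fun do rewrite ImD; exact: rintegrableD.
Qed.

Lemma cintegrableZ z f : cintegrable f -> cintegrable (fun x => z * f x).
Proof.
move=> [fr fi]; split.
  by under eq_fun do rewrite ReM; apply: rintegrableB; exact: rintegrableZ.
by under eq_fun do rewrite ImM; apply: rintegrableD; exact: rintegrableZ.
Qed.

Lemma cintegrable0 : cintegrable (fun=> 0).
Proof. by split; exact: rintegrable_cst. Qed.

Lemma cintegrable_sum (I : Type) (s : seq I) (F : I -> R -> R[i]) :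
  (forall i, cintegrable (F i)) -> cintegrable (fun x => \sum_(i <- s) F i x).
Proof.
move=> Fi; elim: s => [|i s IHs].
  by under eq_fun do rewrite big_nil; exact: cintegrable0.
by under eq_fun do rewrite big_cons; exact: cintegrableD.
Qed.

Lemma Re_cintegral f : Re (cint f) = \int[mu]_(x in Iab) Re (f x).
Proof. by []. Qed.

Lemma Im_cintegral f : Im (cint f) = \int[mu]_(x in Iab) Im (f x).
Proof. by []. Qed.

Lemma cintegralD f g : cintegrable f -> cintegrable g ->
  cint (fun x => f x + g x) = cint f + cint g.
Proof.
move=> [fr fi] [gr gi]; apply: complex_eq.
  rewrite ReD !Re_cintegral; under eq_Rintegral do rewrite ReD.
  exact: RintegralD.
rewrite ImD !Im_cintegral; under eq_Rintegral do rewrite ImD.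
exact: RintegralD.
Qed.

Lemma cintegralZ z f : cintegrable f -> cint (fun x => z * f x) = z * cint f.
Proof.
move=> [fr fi]; apply: complex_eq.
  rewrite ReM !Re_cintegral Im_cintegral; under eq_Rintegral do rewrite ReM.
  by rewrite RintegralB ?RintegralZl //; exact: rintegrableZ.
rewrite ImM !Im_cintegral Re_cintegral; under eq_Rintegral do rewrite ImM.
by rewrite RintegralD ?RintegralZl //; exact: rintegrableZ.
Qed.

Lemma cintegral0 : cint (fun=> 0) = 0.
Proof.
rewrite -[RHS](mul0r (cint (fun=> 0))) -cintegralZ; last exact: cintegrable0.
by under [in RHS]eq_fun do rewrite mul0r.
Qed.

Lemma cintegralB f g : cintegrable f -> cintegrable g ->
  cint (fun x => f x - g x) = cint f - cint g.
Proof.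
move=> fi gi; under eq_fun do rewrite -mulN1r.
by rewrite cintegralD ?cintegralZ ?mulN1r //; exact: cintegrableZ.
Qed.

Lemma cintegral_sum (I : Type) (s : seq I) (F : I -> R -> R[i]) :
  (forall i, cintegrable (F i)) ->
  cint (fun x => \sum_(i <- s) F i x) = \sum_(i <- s) cint (F i).
Proof.
move=> Fi; elim: s => [|i s IHs].
  by rewrite big_nil; under eq_fun do rewrite big_nil; exact: cintegral0.
rewrite big_cons -IHs -cintegralD //; last exact: cintegrable_sum.
by under eq_fun do rewrite big_cons.
Qed.

Lemma eq_cintegral f g : (forall x, a < x < b -> f x = g x) -> cint f = cint g.
Proof.
move=> fg; apply: complex_eq; rewrite ?Re_cintegral ?Im_cintegral;
  by apply: eq_Rintegral => x; rewrite inE /= in_itv => /fg ->.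
Qed.

(** The factor 2 comes from treating the real and imaginary parts separately; where it matters it
    multiplies only Lipschitz or truncation constants. *)
Lemma normc_cintegral_le f B : cintegrable f -> (forall x, a < x < b -> normc (f x) <= B) ->
  normc (cint f) <= 2 * (B * (b - a)).
Proof.
move=> [fr fi] fB; apply: (le_trans (normc_le_ReIm _)); rewrite mulr_natl mulr2n.
rewrite Re_cintegral Im_cintegral.
have intB := Rintegral_Iab_cst B.
rewrite -intB; apply: lerD.
  apply: (le_trans (le_normr_Rintegral _ fr)) => //.
  apply: le_Rintegral => //; [exact: integrable_norm|exact: rintegrable_cst|].
  by move=> x xI; apply: le_trans (Re_le_normc _) (fB _ _); rewrite /= in_itv in xI.
apply: (le_trans (le_normr_Rintegral _ fi)) => //.
apply: le_Rintegral => //; [exact: integrable_norm|exact: rintegrable_cst|].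
by move=> x xI; apply: le_trans (Im_le_normc _) (fB _ _); rewrite /= in_itv in xI.
Qed.

Lemma cmeasurableD f g : cmeasurable f -> cmeasurable g ->
  cmeasurable (fun x => f x + g x).
Proof.
move=> [fr fi] [gr gi]; split.
  by under [X in measurable_fun _ X]eq_fun do rewrite ReD; exact: measurable_funD.
by under [X in measurable_fun _ X]eq_fun do rewrite ImD; exact: measurable_funD.
Qed.

Lemma cmeasurableM f g : cmeasurable f -> cmeasurable g ->
  cmeasurable (fun x => f x * g x).
Proof.
move=> [fr fi] [gr gi]; split.
  by under [X in measurable_fun _ X]eq_fun do rewrite ReM; apply: measurable_funB; exact: measurable_funM.
by under [X in measurable_fun _ X]eq_fun do rewrite ImM; apply: measurable_funD; exact: measurable_funM.
Qed.

Lemma cmeasurable_cst z : cmeasurable (fun=> z).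
Proof. by split; exact: measurable_cst. Qed.

Lemma cmeasurable_conj f : cmeasurable f -> cmeasurable (fun x => conjc (f x)).
Proof.
have rE x : Re (conjc (f x)) = Re (f x) by case: (f x).
have iE x : Im (conjc (f x)) = - Im (f x) by case: (f x).
move=> [fr fi]; split; first by under [X in measurable_fun _ X]eq_fun do rewrite rE.
by under [X in measurable_fun _ X]eq_fun do rewrite iE; exact: measurable_funN.
Qed.

Lemma cmeasurable_continuous f : ccontinuous f -> cmeasurable f.
Proof.
move=> [fr fi]; split; apply: (@measurable_funS _ _ _ _ setT) => //;
  exact: continuous_measurable_fun.
Qed.

Lemma cmeasurable_continuous_on f : continuous_on a b f -> cmeasurable f.
Proof.
have sub : Iab `<=` `[a, b] by apply: subset_itvW; rewrite bnd_simp.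
move=> [fr fi]; split; apply: (measurable_funS (E := `[a, b])) => //;
  exact: subspace_continuous_measurable_fun.
Qed.

Lemma cmeasurable_sqr f : cmeasurable f ->
  measurable_fun Iab (fun x => normc (f x) ^+ 2).
Proof.
move=> [fr fi]; under [X in measurable_fun _ X]eq_fun do rewrite sqr_normcE !expr2.
by apply: measurable_funD; exact: measurable_funM.
Qed.

Definition L2sq (f : R -> R[i]) : R := \int[mu]_(x in Iab) (normc (f x) ^+ 2).

Lemma L2P f : L2 a b f <-> cmeasurable f /\ rintegrable (fun x => normc (f x) ^+ 2).
Proof.
have I0 : (0 <= \int[mu]_(x in Iab) ((normc (f x)) ^+ 2)%:E)%E.
  by apply: integral_ge0 => x _; rewrite lee_fin sqr_ge0.
have absE : (\int[mu]_(x in Iab) `|(normc (f x) ^+ 2)%:E| =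
    \int[mu]_(x in Iab) ((normc (f x)) ^+ 2)%:E)%E.
  by apply: eq_integral => x _; rewrite gee0_abs // lee_fin sqr_ge0.
split=> [[fr fi fL]|[[fr fi] /integrableP[_ fL]]].
  split; first by split.
  apply/integrableP; split.
    by apply/measurable_EFinP; apply: cmeasurable_sqr; split.
  rewrite /= absE ltNge leye_eq; apply/negP => /eqP Iy.
  by move: fL; rewrite /L2norm Iy.
split=> //; move: fL; rewrite /= absE /L2norm.
rewrite -!ge0_fin_numE ?sqrte_ge0 // sqrte_fin_num //.
Qed.

Lemma L2sq_ge0 f : 0 <= L2sq f.
Proof. by apply: Rintegral_ge0 => x _; exact: sqr_ge0. Qed.

Lemma L2normE f : L2 a b f -> L2norm a b f = (Num.sqrt (L2sq f))%:E.
Proof.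
move=> /L2P[_ fi]; rewrite /L2norm /L2sq /Rintegral.
have /fineK <- // : (\int[mu]_(x in Iab) (normc (f x) ^+ 2)%:E)%E \is a fin_num.
exact: integrable_fin_num fi.
Qed.

Lemma L2_bounded f B : cmeasurable f -> (forall x, a < x < b -> normc (f x) <= B) ->
  L2 a b f.
Proof.
move=> mf fB; apply/L2P; split=> //.
apply: (@rintegrable_bounded _ (B ^+ 2)) => [|x xI]; first exact: cmeasurable_sqr.
have {}fB := fB x; rewrite /= in_itv /= in xI; have {}fB := fB xI.
rewrite ger0_norm ?sqr_ge0 // ler_pXn2r ?nnegrE ?normc_ge0 //.
exact: le_trans (normc_ge0 _) fB.
Qed.

Lemma L2_mul f g : L2 a b f -> L2 a b g -> cintegrable (fun x => f x * g x).
Proof.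
move=> /L2P[mf fi] /L2P[mg gi].
have [mr mi] := cmeasurableM mf mg.
have le2 x : normc (f x * g x) <= normc (f x) ^+ 2 + normc (g x) ^+ 2.
  rewrite normcM; move: (normc (f x)) (normc (g x)) => u v.
  have := sqr_ge0 (u - v); have := sqr_ge0 (u + v); nra.
by split; apply: (rintegrable_le _ _ (rintegrableD fi gi)) => // x _;
  [apply: le_trans (Re_le_normc _) (le2 x)|apply: le_trans (Im_le_normc _) (le2 x)].
Qed.

Lemma L2D f g : L2 a b f -> L2 a b g -> L2 a b (fun x => f x + g x).
Proof.
move=> /L2P[mf fi] /L2P[mg gi]; apply/L2P; split; first exact: cmeasurableD.
have := rintegrableD (rintegrableZ 2 fi) (rintegrableZ 2 gi).
apply: rintegrable_le; first by apply: cmeasurable_sqr; apply: cmeasurableD.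
move=> x _; rewrite ger0_norm ?sqr_ge0 //.
have := le_normcD (f x) (g x); rewrite -(ler_pXn2r (n := 2)) ?nnegrE ?addr_ge0 ?normc_ge0 //.
have := sqr_ge0 (normc (f x) - normc (g x)); nra.
Qed.

Lemma L2_cst z : L2 a b (fun=> z).
Proof. by apply: (@L2_bounded _ (normc z)) => //; exact: cmeasurable_cst. Qed.

Lemma L2_Mbounded f g B : L2 a b f -> cmeasurable g ->
  (forall x, a < x < b -> normc (g x) <= B) -> L2 a b (fun x => f x * g x).
Proof.
move=> /L2P[mf fi] mg gB; apply/L2P; split; first exact: cmeasurableM.
have := rintegrableZ (B ^+ 2) fi.
apply: rintegrable_le; first by apply: cmeasurable_sqr; apply: cmeasurableM.
move=> x xI; rewrite /= in_itv /= in xI; have {}gB := gB _ xI.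
rewrite ger0_norm ?sqr_ge0 // normcM exprMn mulrC ler_wpM2r ?sqr_ge0 //.
by rewrite ler_pXn2r ?nnegrE ?normc_ge0 // (le_trans (normc_ge0 _) gB).
Qed.

Lemma L2Z z f : L2 a b f -> L2 a b (fun x => z * f x).
Proof.
move=> fL; under eq_fun do rewrite mulrC.
by apply: (@L2_Mbounded _ _ (normc z)) => //; exact: cmeasurable_cst.
Qed.

Lemma L2B f g : L2 a b f -> L2 a b g -> L2 a b (fun x => f x - g x).
Proof.
move=> fL gL; under eq_fun do rewrite -mulN1r.
by apply: L2D => //; exact: L2Z.
Qed.

Lemma L2_sum (I : Type) (s : seq I) (F : I -> R -> R[i]) :
  (forall i, L2 a b (F i)) -> L2 a b (fun x => \sum_(i <- s) F i x).
Proof.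
move=> Fi; elim: s => [|i s IHs].
  by under eq_fun do rewrite big_nil; exact: L2_cst.
by under eq_fun do rewrite big_cons; exact: L2D.
Qed.

Lemma L2_conj f : L2 a b f -> L2 a b (fun x => conjc (f x)).
Proof.
move=> /L2P[mf fi]; apply/L2P; split; first exact: cmeasurable_conj.
by under eq_fun do rewrite normc_conj.
Qed.

Lemma cintegrable_L2 f : L2 a b f -> cintegrable f.
Proof.
move=> fL; have := L2_mul fL (L2_cst 1).
by under eq_fun do rewrite mulr1.
Qed.

Lemma eq_L2 f g : (forall x, a < x < b -> f x = g x) -> L2 a b f -> L2 a b g.
Proof.
move=> fg [mr mi fL]; split.
- by apply: eq_measurable_fun mr => x; rewrite inE /= in_itv => /fg ->.
- by apply: eq_measurable_fun mi => x; rewrite inE /= in_itv => /fg ->.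
- move: fL; rewrite /L2norm.
  suff -> : (\int[mu]_(x in Iab) (normc (f x) ^+ 2)%:E =
    \int[mu]_(x in Iab) (normc (g x) ^+ 2)%:E)%E by [].
  by apply: eq_integral => x; rewrite inE /= in_itv => /fg ->.
Qed.

Lemma wave_ccontinuous l : ccontinuous (wave a b l).
Proof.
rewrite /wave; under eq_fun do rewrite mulrBr addrC expiD.
by apply: ccontinuousM; [exact: ccontinuous_cst|exact: ccontinuous_expi].
Qed.

Lemma wave_cmeasurable l : cmeasurable (wave a b l).
Proof. exact/cmeasurable_continuous/wave_ccontinuous. Qed.

Lemma wave_L2 l : L2 a b (wave a b l).
Proof.
by apply: (L2_bounded (wave_cmeasurable l)) => x _; rewrite normc_wave.
Qed.

Lemma L2_wave f l : L2 a b f -> L2 a b (fun x => f x * wave a b l x).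
Proof.
by move=> fL; apply: (L2_Mbounded (B := 1) fL (wave_cmeasurable l)) => x _; rewrite normc_wave.
Qed.

Lemma Rintegral_derive (F f : R -> R) : (forall x : R, is_derive x 1 F (f x)) ->
  continuous f -> \int[mu]_(x in Iab) f x = F b - F a.
Proof.
move=> Fd fc; have Fc : continuous F.
  by move=> x; apply/differentiable_continuous/derivable1_diffP; case: (Fd x).
have fi : mu.-integrable `[a, b] (EFin \o f).
  apply: continuous_compact_integrable; first exact: segment_compact.
  exact: continuous_subspaceT.
have h : (\int[mu]_(x in `[a, b]) (f x)%:E = (F b)%:E - (F a)%:E)%E.
  apply: continuous_FTC2 => //; first exact: continuous_subspaceT.
    split; [by move=> x _; case: (Fd x)|exact/cvg_at_right_filter/Fc|].
    exact/cvg_at_left_filter/Fc.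
  by move=> x _; rewrite derive1E; case: (Fd x).
rewrite -[RHS]/(fine ((F b)%:E - (F a)%:E)) -h -/(Rintegral mu `[a, b] f).
rewrite -Rintegral_itv_obnd_cbnd; last first.
  apply: integrableS fi => // x /=; rewrite !in_itv /= => /andP[h1 h2].
  by rewrite (ltW h1) h2.
rewrite -Rintegral_itv_bndo_bndc //.
apply: integrableS fi => // x /=; rewrite !in_itv /= => /andP[h1 h2].
by rewrite (ltW h1) (ltW h2).
Qed.

Let L_neq0 : b - a != 0. Proof. by rewrite subr_eq0 gt_eqF. Qed.

Lemma freq_period l : freq a b l * (b - a) = pi *+ 2 * l%:~R.
Proof. by rewrite /freq mulr2n; field. Qed.

Lemma cintegral_wave l : cint (wave a b l) = (b - a)%:C * (l == 0)%:R.
Proof.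
have [->|l0] := eqVneq l 0.
  rewrite mulr1 /cintegral; apply: complex_eq => /=.
    rewrite (@eq_Rintegral _ _ _ mu _ (fun=> 1)) ?Rintegral_Iab_cst ?mul1r //.
    by move=> x _; rewrite freq0 mul0r cos0.
  rewrite (@eq_Rintegral _ _ _ mu _ (fun=> 0)) ?Rintegral_Iab_cst ?mul0r //.
  by move=> x _; rewrite freq0 mul0r sin0.
have k0 : freq a b l != 0.
  rewrite /freq !mulf_eq0 !negb_or invr_eq0 intr_eq0 l0 L_neq0 pnatr_eq0 /=.
  by rewrite andbT gt_eqF ?pi_gt0.
rewrite mulr0; set k := freq a b l in k0 *.
have [cc cs] := wave_ccontinuous l; rewrite /wave -/k /= in cc cs.
have aff (x : R) : is_derive x (1 : R) (fun x : R => k * (x - a)) k.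
  by apply: is_derive_eq; rewrite ?scaler0 ?addr0 ?subr0 /GRing.scale /= ?mulr1.
have e : expi (k * (b - a)) = 1 by rewrite freq_period expi_pi_int.
have ce := congr1 Re e; have se := congr1 Im e; rewrite /= in ce se.
have dS (x : R) : is_derive x 1 (fun x => k^-1 * sin (k * (x - a))) (cos (k * (x - a))).
  have h := is_deriveZ k^-1 (@is_derive1_comp R sin (fun x => k * (x - a)) x _ _ (is_derive_sin _) (aff x)).
  by apply: (is_derive_eq h); rewrite /GRing.scale /= mulrC mulfK.
have dC (x : R) : is_derive x 1 (fun x => - k^-1 * cos (k * (x - a))) (sin (k * (x - a))).
  have h := is_deriveZ (- k^-1) (@is_derive1_comp R cos (fun x => k * (x - a)) x _ _ (is_derive_cos _) (aff x)).
  by apply: (is_derive_eq h); rewrite /GRing.scale /= mulrC mulNr mulrNN mulfK.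
apply: complex_eq; rewrite /cintegral /= -/k.
  by rewrite (Rintegral_derive dS cc) se !(subrr, mulr0, sin0).
by rewrite (Rintegral_derive dC cs) ce !(subrr, mulr0, cos0).
Qed.

End ComplexIntegral.

(** * Fourier coefficients, finite Parseval identity and Bessel's inequality *)

Section Bessel.
Local Open Scope classical_set_scope.
Context {R : realType}.
Variables a b : R.
Hypothesis lt_ab : a < b.

Local Notation cint f := (cintegral a b f).
Local Notation fc f l := (fourier_coef a b f l).
Local Notation wave := (wave a b).
Local Notation L2 := (L2 a b).
Local Notation L2sq := (L2sq a b).

Let L_gt0 : 0 < b - a. Proof. by rewrite subr_gt0. Qed.
Let L_neq0 : b - a != 0. Proof. by rewrite gt_eqF. Qed.
Let LC_neq0 : (b - a)%:C != 0 :> R[i].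
Proof. by rewrite -(rmorph0 (real_complex R)) (inj_eq (@complexI R)). Qed.

Lemma fourier_coefE f l : fc f l = ((b - a)^-1)%:C * cint (fun x => f x * wave (- l) x).
Proof.
rewrite /fourier_coef; congr (_ * _); apply: eq_cintegral => x _.
by rewrite waveNE.
Qed.

Lemma cintegral_fourier_coef f l : cint (fun x => f x * wave (- l) x) = (b - a)%:C * fc f l.
Proof. by rewrite fourier_coefE mulrA -rmorphM divff // mul1r. Qed.

Lemma eq_fourier_coef f g l : (forall x, a < x < b -> f x = g x) -> fc f l = fc g l.
Proof.
move=> fg; rewrite !fourier_coefE; congr (_ * _); apply: eq_cintegral => x xI.
by rewrite fg.
Qed.

Lemma fourier_coefD f g l : L2 f -> L2 g ->
  fc (fun x => f x + g x) l = fc f l + fc g l.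
Proof.
move=> fL gL; rewrite !fourier_coefE -mulrDr -cintegralD //; last 2 first.
- (apply: cintegrable_L2 => //; exact: L2_wave).
- (apply: cintegrable_L2 => //; exact: L2_wave).
by congr (_ * _); apply: eq_cintegral => x _; rewrite mulrDl.
Qed.

Lemma fourier_coefZ z f l : L2 f -> fc (fun x => z * f x) l = z * fc f l.
Proof.
move=> fL; rewrite !fourier_coefE.
have fi : cintegrable a b (fun x => f x * wave (- l) x).
  by apply: cintegrable_L2 => //; exact: L2_wave.
rewrite [RHS]mulrCA -(cintegralZ z fi); congr (_ * _).
by apply: eq_cintegral => x _; rewrite mulrA.
Qed.

Lemma fourier_coefB f g l : L2 f -> L2 g ->
  fc (fun x => f x - g x) l = fc f l - fc g l.
Proof.
move=> fL gL; rewrite -mulN1r -fourier_coefZ // -fourier_coefD //; last exact: L2Z.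
by apply: eq_fourier_coef => x _; rewrite mulN1r.
Qed.

Lemma fourier_coef_sum (I : Type) (s : seq I) (F : I -> R -> R[i]) l :
  (forall i, L2 (F i)) ->
  fc (fun x => \sum_(i <- s) F i x) l = \sum_(i <- s) fc (F i) l.
Proof.
move=> FL; rewrite fourier_coefE.
under [RHS]eq_bigr do rewrite fourier_coefE.
have Fi i : cintegrable a b (fun x => F i x * wave (- l) x).
  by apply: cintegrable_L2 => //; exact: L2_wave.
rewrite -mulr_sumr -(cintegral_sum lt_ab s Fi).
by congr (_ * _); apply: eq_cintegral => x _; rewrite mulr_suml.
Qed.

Lemma fourier_coefMwave f j l : fc (fun x => f x * wave j x) l = fc f (l - j).
Proof.
rewrite !fourier_coefE; congr (_ * _); apply: eq_cintegral => x _.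
by rewrite -mulrA -waveD opprB.
Qed.

Lemma fourier_coef_cst z l : fc (fun=> z) l = z * (l == 0)%:R.
Proof.
rewrite fourier_coefE cintegralZ; last by apply: cintegrable_L2 => //; exact: wave_L2.
rewrite cintegral_wave // oppr_eq0 mulrCA [X in _ * X]mulrA -rmorphM mulVf //.
by rewrite mul1r.
Qed.

Lemma cintegral_conj f : cintegrable a b f -> cint (fun x => conjc (f x)) = conjc (cint f).
Proof.
have rE z : Re (conjc z) = Re z by move: z => [].
have iE z : Im (conjc z) = - Im z by move: z => [].
move=> [fr fi]; apply: complex_eq.
  by rewrite rE !Re_cintegral; apply: eq_Rintegral => x _; rewrite rE.
rewrite iE !Im_cintegral -mulN1r -RintegralZl //.
by apply: eq_Rintegral => x _; rewrite iE mulN1r.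
Qed.

Lemma L2sq_cintegral f : (L2sq f)%:C = cint (fun x => f x * conjc (f x)).
Proof.
apply: complex_eq.
  by rewrite Re_cintegral; apply: eq_Rintegral => x _; rewrite mul_conjc.
rewrite Im_cintegral -[LHS](mul0r (b - a)) -Rintegral_Iab_cst //.
by apply: eq_Rintegral => x _; rewrite mul_conjc.
Qed.

Definition trig (s : seq int) (y : int -> R[i]) (x : R) : R[i] :=
  \sum_(l <- s) y l * wave l x.

Lemma trig_L2 s y : L2 (trig s y).
Proof. by apply: L2_sum => // l; apply: L2Z => //; exact: wave_L2. Qed.

Lemma fourier_coef_wave j l : fc (wave j) l = (j == l)%:R.
Proof.
have -> : fc (wave j) l = fc (fun x => 1 * wave j x) l.
  by apply: eq_fourier_coef => x _; rewrite mul1r.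
by rewrite fourier_coefMwave fourier_coef_cst mul1r subr_eq0 eq_sym.
Qed.

Lemma fourier_coef_trig s y l : uniq s -> l \in s -> fc (trig s y) l = y l.
Proof.
move=> us ls; rewrite fourier_coef_sum //; last by move=> j; apply: L2Z => //; exact: wave_L2.
rewrite (bigD1_seq l) //= fourier_coefZ ?fourier_coef_wave ?eqxx ?mulr1; last exact: wave_L2.
rewrite big1 ?addr0 // => j /negbTE jl.
by rewrite fourier_coefZ ?fourier_coef_wave ?jl ?mulr0 //; exact: wave_L2.
Qed.

Lemma cintegral_mul_trig f s y : L2 f ->
  cint (fun x => f x * conjc (trig s y x)) =
  (b - a)%:C * \sum_(l <- s) conjc (y l) * fc f l.
Proof.
move=> fL; rewrite (eq_cintegral (g := fun x =>
  \sum_(l <- s) conjc (y l) * (f x * wave (- l) x))); last first.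
  move=> x _; rewrite /trig conjc_sum mulr_sumr; apply: eq_bigr => l _.
  by rewrite conjcM -waveN mulrCA.
have int l : cintegrable a b (fun x => f x * wave (- l) x).
  by apply: cintegrable_L2 => //; exact: L2_wave.
rewrite cintegral_sum //; last by move=> l; exact: cintegrableZ.
rewrite mulr_sumr; apply: eq_bigr => l _.
by rewrite cintegralZ // cintegral_fourier_coef mulrCA.
Qed.

Lemma parseval_trig s y : uniq s ->
  L2sq (trig s y) = (b - a) * \sum_(l <- s) normc (y l) ^+ 2.
Proof.
move=> us; apply: complexI; rewrite L2sq_cintegral cintegral_mul_trig; last exact: trig_L2.
rewrite rmorphM rmorph_sum /=; congr (_ * _); apply: eq_big_seq => l ls.
by rewrite fourier_coef_trig // mulrC mul_conjc.
Qed.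

Lemma bessel f s : L2 f -> uniq s ->
  (b - a) * \sum_(l <- s) normc (fc f l) ^+ 2 <= L2sq f.
Proof.
move=> fL us; set S := trig s (fun l => fc f l).
have SL : L2 S by exact: trig_L2.
have fcL : L2 (fun x => conjc (f x)) by exact: L2_conj.
have ScL : L2 (fun x => conjc (S x)) by exact: L2_conj.
have fS : cint (fun x => f x * conjc (S x)) = ((b - a) * \sum_(l <- s) normc (fc f l) ^+ 2)%:C.
  rewrite cintegral_mul_trig // rmorphM rmorph_sum /=; congr (_ * _).
  by apply: eq_bigr => l _; rewrite mulrC mul_conjc.
have Sf : cint (fun x => S x * conjc (f x)) = cint (fun x => f x * conjc (S x)).
  transitivity (cint (fun x => conjc (f x * conjc (S x)))).
    by apply: eq_cintegral => x _; rewrite conjcM conjcK mulrC.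
  by rewrite cintegral_conj ?fS ?conjc_real //; apply: L2_mul.
have SS : L2sq S = (b - a) * \sum_(l <- s) normc (fc f l) ^+ 2 by exact: parseval_trig.
have : 0 <= L2sq (fun x => f x - S x) by exact: L2sq_ge0.
suff -> : L2sq (fun x => f x - S x) = L2sq f - L2sq S by rewrite subr_ge0 SS.
apply: complexI; rewrite L2sq_cintegral rmorphB /= !L2sq_cintegral.
transitivity (cint (fun x => (f x * conjc (f x) - f x * conjc (S x)) -
    (S x * conjc (f x) - S x * conjc (S x)))).
  by apply: eq_cintegral => x _; rewrite conjcD conjcN; ring.
have i1 := L2_mul fL fcL; have i2 := L2_mul fL ScL.
have i3 := L2_mul SL fcL; have i4 := L2_mul SL ScL.
have cB F G : cintegrable a b F -> cintegrable a b G -> cintegrable a b (fun x => F x - G x).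
  move=> Fi Gi; have := cintegrableD Fi (cintegrableZ (-1) Gi).
  by under eq_fun do rewrite mulN1r.
rewrite !cintegralB //; try exact: cB.
by rewrite Sf fS -!L2sq_cintegral SS; ring.
Qed.

Lemma fourier_coef_le f l : L2 f -> normc (fc f l) ^+ 2 <= L2sq f / (b - a).
Proof.
move=> fL; rewrite ler_pdivlMr // mulrC.
by have := bessel (s := [:: l]) fL isT; rewrite big_seq1.
Qed.

End Bessel.

(** * Weak derivatives and Fourier inversion *)

Section SmoothStep.
Context {R : realType}.
Implicit Types (u x : R).

Definition pos u : R := Num.max u 0.

Lemma posE u : 0 <= u -> pos u = u. Proof. by move=> u0; rewrite /pos max_l. Qed.
Lemma pos0 u : u <= 0 -> pos u = 0. Proof. by move=> u0; rewrite /pos max_r. Qed.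

Lemma pos_continuous : continuous pos.
Proof. by move=> u; apply: continuous_max; [exact: cvg_id|exact: cvg_cst]. Qed.

Lemma is_derive_pos_sqr u : is_derive u 1 (fun x => pos x ^+ 2) (2 * pos u).
Proof.
have [u0|u0|u0] := ltgtP u 0.
- rewrite pos0 ?mulr0; last exact: ltW.
  apply: (near_eq_is_derive _ (is_derive_cst (0 : R) u (1 : R))).
  near=> x; rewrite pos0 ?expr0n //; apply: ltW.
  by near: x; exact: lt_nbhsl.
- rewrite posE; last exact: ltW.
  have h := is_deriveM (is_derive_id u (1 : R)) (is_derive_id u (1 : R)).
  apply: (near_eq_is_derive (f := (@id R) * id)).
    by near=> x; rewrite posE ?expr2 //; apply: ltW; near: x; exact: lt_nbhsr.
  by apply: (is_derive_eq h); rewrite /GRing.scale /= mulr1; ring.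
(* At the kink the difference quotient of the squared positive part is the positive part itself,
   which is continuous and vanishes at 0. *)
- rewrite u0 pos0 // mulr0; apply/is_derive1_caratheodory.
  exists pos; split; last by rewrite pos0.
    move=> z; rewrite (pos0 (lexx 0)) expr0n subr0 subr0.
    by have [z0|/ltW z0] := leP 0 z; [rewrite posE // expr2|rewrite pos0 // expr0n mul0r].
  exact: pos_continuous.
Unshelve. all: by end_near.
Qed.

(** A quadratic spline from 0 to 1, whose derivative is the tent of height 2 over [0, 1]. Test
    functions need only be C^1, so exponential bumps are avoided. *)
Definition step u : R := 2 * (pos u ^+ 2 - 2 * pos (u - 2^-1) ^+ 2 + pos (u - 1) ^+ 2).

Definition step' u : R := 4 * (pos u - 2 * pos (u - 2^-1) + pos (u - 1)).

Lemma is_derive_step u : is_derive u 1 step (step' u).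
Proof.
have sh k : is_derive u (1 : R) (fun x => pos (x - k) ^+ 2) (2 * pos (u - k)).
  have dk : is_derive u (1 : R) (fun x : R => x - k) 1.
    by apply: is_derive_eq; rewrite ?subr0 ?addr0.
  have := @is_derive1_comp R (fun x => pos x ^+ 2) (fun x => x - k) u _ _
    (is_derive_pos_sqr (u - k)) dk.
  by rewrite mulr1.
have h := is_deriveZ 2 (is_deriveD (is_deriveB (is_derive_pos_sqr u)
  (is_deriveZ 2 (sh 2^-1))) (sh 1)).
by apply: (is_derive_eq h); rewrite /step' /GRing.scale /=; ring.
Qed.

Lemma step'_continuous : continuous step'.
Proof.
have sh k : continuous (fun x => pos (x - k)).
  move=> x; apply: (continuous_comp (f := fun x => x - k)); last exact: pos_continuous.
  by apply: cvgB; [exact: cvg_id|exact: cvg_cst].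
move=> x; apply: cvgM; first exact: cvg_cst.
apply: cvgD; last exact: sh.
by apply: cvgB; [exact: pos_continuous|apply: cvgM; [exact: cvg_cst|exact: sh]].
Qed.

Lemma step0 u : u <= 0 -> step u = 0.
Proof. by move=> u0; rewrite /step !pos0 //; [ring|lra|lra]. Qed.

Lemma step1 u : 1 <= u -> step u = 1.
Proof. by move=> u1; rewrite /step !posE //; [field|lra|lra|lra]. Qed.

Lemma step'0 u : u <= 0 -> step' u = 0.
Proof. by move=> u0; rewrite /step' !pos0 //; [ring|lra|lra]. Qed.

Lemma step'1 u : 1 <= u -> step' u = 0.
Proof. by move=> u1; rewrite /step' !posE //; [field|lra|lra|lra]. Qed.

Lemma step'_ge0 u : 0 <= step' u.
Proof.
rewrite /step'; have [u0|/ltW u0] := leP u 0; first by rewrite !pos0 //; lra.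
have [u1|/ltW u1] := leP 1 u; first by rewrite !posE //; lra.
have [uh|/ltW uh] := leP u 2^-1.
  by rewrite (posE u0) !pos0; lra.
by rewrite (posE u0) (@posE (u - 2^-1)) ?(@pos0 (u - 1)); lra.
Qed.

Lemma step_bound u : 0 <= step u <= 1.
Proof.
have [u0|/ltW u0] := leP u 0; first by rewrite step0 // lexx ler01.
have [u1|/ltW u1] := leP 1 u; first by rewrite step1 // lexx ler01.
rewrite /step; have [uh|/ltW uh] := leP u 2^-1.
  by rewrite (posE u0) !pos0; [apply/andP; split; nra|lra|lra].
rewrite (posE u0) (@posE (u - 2^-1)) ?(@pos0 (u - 1)); try lra.
by apply/andP; split; nra.
Qed.

Section Cutoff.
Variables c d del : R.
Hypothesis del_gt0 : 0 < del.
Hypothesis del_le : 4 * del <= d - c.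

(** Rises on [c + del, c + 2 del] and falls on [d - 2 del, d - del]. The margin [del] keeps the
    support away from c and d, so that it is admissible even when these are [a] and [b]. The two
    tents are approximate Dirac masses at the ends. *)
Definition cutoff x : R := step ((x - c) / del - 1) - step ((x - d) / del + 2).

Definition tentl x : R := del^-1 * step' ((x - c) / del - 1).
Definition tentr x : R := del^-1 * step' ((x - d) / del + 2).

Lemma is_derive_step_affine (p q x : R) :
  is_derive x 1 (fun x => step ((x - p) / del + q)) (del^-1 * step' ((x - p) / del + q)).
Proof.
have dk : is_derive x (1 : R) (fun x : R => (x - p) / del + q) del^-1.
  under eq_fun do rewrite mulrC.
  have h1 : is_derive x (1 : R) (fun x : R => x - p) 1.
    by apply: is_derive_eq; rewrite ?subr0 ?addr0.
  have h := is_deriveD (is_deriveZ del^-1 h1) (is_derive_cst q x (1 : R)).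
  by apply: (is_derive_eq h); rewrite /GRing.scale /= mulr1 addr0.
have := @is_derive1_comp R step _ x _ _ (is_derive_step _) dk.
by rewrite mulrC.
Qed.

Lemma step'_affine_continuous (p q : R) :
  continuous (fun x => del^-1 * step' ((x - p) / del + q)).
Proof.
move=> x; apply: cvgM; first exact: cvg_cst.
apply: (continuous_comp (f := fun x => (x - p) / del + q)); last exact: step'_continuous.
apply: cvgD; last exact: cvg_cst.
apply: cvgM; last exact: cvg_cst.
by apply: cvgB; [exact: cvg_id|exact: cvg_cst].
Qed.

Lemma is_derive_cutoff x : is_derive x 1 cutoff (tentl x - tentr x).
Proof. exact: (is_deriveB (is_derive_step_affine c (-1) x) (is_derive_step_affine d 2 x)). Qed.

Lemma tentl_continuous : continuous tentl.
Proof. exact: step'_affine_continuous. Qed.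

Lemma tentr_continuous : continuous tentr.
Proof. exact: step'_affine_continuous. Qed.

Lemma tentl_ge0 x : 0 <= tentl x.
Proof. by rewrite mulr_ge0 ?invr_ge0 ?step'_ge0 // ltW. Qed.

Lemma tentr_ge0 x : 0 <= tentr x.
Proof. by rewrite mulr_ge0 ?invr_ge0 ?step'_ge0 // ltW. Qed.

Lemma not_itvP (p q x : R) : ~~ (p <= x <= q) -> x < p \/ q < x.
Proof. by rewrite negb_and -!ltNge => /orP[]; [left|right]. Qed.

Lemma affine_le (p q r x : R) : x <= p + (r - q) * del -> (x - p) / del + q <= r.
Proof. by move=> h; rewrite -lerBrDr ler_pdivrMr // lerBlDl. Qed.

Lemma affine_ge (p q r x : R) : p + (r - q) * del <= x -> r <= (x - p) / del + q.
Proof. by move=> h; rewrite -lerBlDr ler_pdivlMr // lerBrDl. Qed.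

Lemma tentl_support x : ~~ (c <= x <= c + 2 * del) -> tentl x = 0.
Proof.
have d0 := del_gt0; have d4 := del_le; case/not_itvP => xc; rewrite /tentl.
  by rewrite step'0 ?mulr0 //; apply: affine_le; lra.
by rewrite step'1 ?mulr0 //; apply: affine_ge; lra.
Qed.

Lemma tentr_support x : ~~ (d - 2 * del <= x <= d) -> tentr x = 0.
Proof.
have d0 := del_gt0; have d4 := del_le; case/not_itvP => xc; rewrite /tentr.
  by rewrite step'0 ?mulr0 //; apply: affine_le; lra.
by rewrite step'1 ?mulr0 //; apply: affine_ge; lra.
Qed.

Lemma cutoff_support x : ~~ (c + del <= x <= d - del) -> cutoff x = 0.
Proof.
have d0 := del_gt0; have d4 := del_le; case/not_itvP => xc; rewrite /cutoff.
  by rewrite !step0 ?subrr //; apply: affine_le; lra.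
by rewrite !step1 ?subrr //; apply: affine_ge; lra.
Qed.

Lemma cutoff_eq1 x : c + 2 * del <= x <= d - 2 * del -> cutoff x = 1.
Proof.
have d0 := del_gt0; have d4 := del_le => /andP[xc xd]; rewrite /cutoff step1 ?step0 ?subr0 //.
  by apply: affine_le; lra.
by apply: affine_ge; lra.
Qed.

Lemma cutoff_bound x : `|cutoff x| <= 1.
Proof.
rewrite /cutoff; have /andP[h1 h2] := step_bound ((x - c) / del - 1).
have /andP[h3 h4] := step_bound ((x - d) / del + 2).
by rewrite ler_norml; apply/andP; split; lra.
Qed.

Lemma cutoff_continuous : continuous cutoff.
Proof.
move=> x; apply/differentiable_continuous/derivable1_diffP.
by case: (is_derive_cutoff x).
Qed.

End Cutoff.

End SmoothStep.

(** * Integration by parts for weak derivatives up to the boundary *)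

Section WeakDerivative.
Local Open Scope classical_set_scope.
Context {R : realType}.
Variables a b : R.
Hypothesis lt_ab : a < b.

Local Notation mu := (@lebesgue_measure R).
Local Notation Iab := (`]a, b[ : set R).
Local Notation rint f := (\int[mu]_(x in Iab) f x).

Lemma Rintegral_dominated (f : R -> R) (k : nat -> R -> R) (k0 : R -> R) :
  rintegrable a b f -> (forall n, measurable_fun Iab (k n)) -> measurable_fun Iab k0 ->
  (forall n x, `|k n x| <= 1) ->
  (forall x, Iab x -> k ^~ x @ \oo --> k0 x) ->
  (fun n => rint (fun x => f x * k n x)) @ \oo --> rint (fun x => f x * k0 x).
Proof.
move=> fi mk mk0 k1 kk.
have mf := rintegrable_measurable fi.
have [|||||f0i _ fc] := @dominated_convergence _ _ _ mu Iab (measurable_itv _)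
  (fun n x => (f x * k n x)%:E) (fun x => (f x * k0 x)%:E) (fun x => `|f x|%:E).
- by move=> n; apply/measurable_EFinP; apply: measurable_funM; [exact: mf|exact: mk].
- by apply/measurable_EFinP; apply: measurable_funM; [exact: mf|exact: mk0].
- apply: aeW => x xI; apply: cvg_EFin; first by near=> n.
  by apply: cvgM; [exact: cvg_cst|exact: kk].
- exact: integrable_norm.
- apply: aeW => x n xI /=; rewrite lee_fin normrM ler_piMr //.
apply: fine_cvg; move: fc; rewrite fineK //.
exact: integrable_fin_num.
Unshelve. all: by end_near.
Qed.

Lemma within_continuous_dist (f : R -> R) c e : {within `[a, b], continuous f} ->
  a <= c <= b -> 0 < e ->
  exists2 r, 0 < r & forall x, a <= x <= b -> `|x - c| < r -> `|f x - f c| <= e.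
Proof.
move=> /subspace_continuousP fc cI e0.
have cA : `[a, b]%classic c by rewrite /= in_itv.
have /cvgrPdist_le /(_ _ e0) := fc _ cA.
rewrite /within /= => /nbhs_ballP[r r0 rP].
exists r => // x xI xr; rewrite distrC; apply: rP; last by rewrite /= in_itv.
by rewrite /ball /= distrC.
Qed.

Lemma Rintegral_concentrated (phi tent : R -> R) (p e : R) :
  rintegrable a b (fun x => phi x * tent x) -> rintegrable a b tent ->
  (forall x, 0 <= tent x) -> rint tent = 1 ->
  (forall x, Iab x -> tent x != 0 -> `|phi x - p| <= e) ->
  `|rint (fun x => phi x * tent x) - p| <= e.
Proof.
move=> pti ti t0 t1 pe.
have pi : rintegrable a b (fun x => (phi x - p) * tent x).
  have := rintegrableB pti (rintegrableZ p ti).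
  by apply: eq_integrable => // x _; rewrite /= mulrBl.
have -> : rint (fun x => phi x * tent x) - p = rint (fun x => (phi x - p) * tent x).
  rewrite -[X in _ - X]mulr1 -t1 -RintegralZl // -RintegralB //.
    by apply: eq_Rintegral => x _; rewrite mulrBl.
  exact: rintegrableZ.
apply: (le_trans (le_normr_Rintegral _ pi)) => //.
rewrite -[leRHS]mulr1 -t1 -RintegralZl //; apply: le_Rintegral => //.
- exact: integrable_norm.
- exact: rintegrableZ.
move=> x xI; rewrite normrM (ger0_norm (t0 x)).
by have [->|tx] := eqVneq (tent x) 0; rewrite ?mulr0 // ler_wpM2r // pe.
Qed.

Lemma rintegrable_within (f : R -> R) : {within `[a, b], continuous f} ->
  rintegrable a b f.
Proof.
move=> fc; have fi : mu.-integrable `[a, b] (EFin \o f).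
  by apply: continuous_compact_integrable => //; exact: segment_compact.
apply: integrableS fi => // x /=; rewrite !in_itv /= => /andP[h1 h2].
by rewrite (ltW h1) (ltW h2).
Qed.

Lemma rintegrable_mul_continuous (g w : R -> R) : rintegrable a b g -> continuous w ->
  rintegrable a b (fun x => g x * w x).
Proof.
move=> gi wc.
have /compact_bounded[B [_ wB]] := continuous_compact
  (continuous_subspaceT (A := `[a, b]) wc) (@segment_compact R a b).
have mw : measurable_fun Iab w.
  by apply: (@measurable_funS _ _ _ _ setT) => //; exact: continuous_measurable_fun.
have mg := rintegrable_measurable gi.
have gn : rintegrable a b (fun x => `|g x|) by exact: integrable_norm gi.
apply: (rintegrable_le _ _ (rintegrableZ (`|B| + 1) gn)); first exact: measurable_funM.
move=> x xI; rewrite normrM mulrC ler_wpM2r //.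
apply: wB; first by rewrite ltr_pwDr // ler_norm.
exists x => //=; move: xI; rewrite /= !in_itv /= => /andP[h1 h2].
by rewrite (ltW h1) (ltW h2).
Qed.

(** Test with the cutoff times [w] and shrink the margin. The derivative of the cutoff averages f w
    near each end, and continuity on the closed interval turns these averages into boundary
    values. *)
Lemma real_weak_derivative (f g w w' : R -> R) c d :
  {within `[a, b], continuous f} -> rintegrable a b g ->
  (forall chi, test_function a b chi ->
     rint (fun x => f x * derive1 chi x) = - rint (fun x => g x * chi x)) ->
  (forall x : R, is_derive x 1 w (w' x)) -> continuous w' ->
  a <= c -> c < d -> d <= b ->
  \int[mu]_(x in `]c, d[) (f x * w' x + g x * w x) = f d * w d - f c * w c.
Proof.
move=> fc gi wd wD w'c ac cd db.
have wc : continuous w.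
  by move=> x; apply/differentiable_continuous/derivable1_diffP; case: (wD x).
have fi := rintegrable_within fc.
pose del (n : nat) : R := (d - c) / 4 * n.+1%:R^-1.
have del0 n : 0 < del n by rewrite mulr_gt0 ?divr_gt0 ?subr_gt0 ?invr_gt0.
have del4 n : 4 * del n <= d - c.
  have : n.+1%:R^-1 <= 1 :> R by rewrite invf_le1 ?ltr0n // ler1n.
  rewrite /del => k1; have -> : 4 * ((d - c) / 4 * n.+1%:R^-1) = (d - c) * n.+1%:R^-1.
    by rewrite mulrA; congr (_ * _); field.
  by rewrite ler_piMr // subr_ge0 ltW.
have delc : del @ \oo --> (0 : R).
  rewrite -[X in _ --> X](mulr0 ((d - c) / 4)).
  by apply: cvgM; [exact: cvg_cst|exact: cvg_harmonic].
pose H x := f x * w' x + g x * w x.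
have Hi : rintegrable a b H.
  by apply: rintegrableD; exact: rintegrable_mul_continuous.
pose kap n := cutoff c d (del n).
pose phi x := f x * w x.
have phic : {within `[a, b], continuous phi}.
  move=> x; apply: continuousM; first exact: fc.
  exact: (continuous_subspaceT wc).
have phii := rintegrable_within phic.
have kapD n x := is_derive_cutoff c d (del n) x.
have kapS n x := cutoff_support (del0 n) (del4 n) (x := x).
(* Product rule: the tents carry the future boundary terms, all other terms keep the cutoff. *)
have step n : rint (fun x => H x * kap n x) =
    rint (fun x => phi x * tentr d (del n) x) - rint (fun x => phi x * tentl c (del n) x).
  have tli := rintegrable_mul_continuous phii (@tentl_continuous R c (del n)).
  have tri := rintegrable_mul_continuous phii (@tentr_continuous R d (del n)).
  have kc : continuous (kap n) := @cutoff_continuous R c d (del n).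
  pose chi x := kap n x * w x.
  have chiD (x : R) : is_derive x 1 chi
      ((tentl c (del n) x - tentr d (del n) x) * w x + kap n x * w' x).
    have h := is_deriveM (kapD n x) (wD x).
    by apply: (is_derive_eq h); rewrite /GRing.scale /= /kap; ring.
  have chiE x : derive1 chi x =
      (tentl c (del n) x - tentr d (del n) x) * w x + kap n x * w' x.
    by rewrite derive1E; case: (chiD x).
  have chiT : test_function a b chi.
    split; first by move=> x; case: (chiD x).
      rewrite (funext chiE : derive1 chi = _) => x.
      apply: cvgD; apply: cvgM; [|exact: wc|exact: kc|exact: w'c].
      by apply: cvgB; [exact: tentl_continuous|exact: tentr_continuous].
    exists (c + del n), (d - del n); have d0 := del0 n; split; try lra.
    by move=> x; rewrite in_itv /= => /kapS; rewrite /chi /kap => ->; rewrite mul0r.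
  have := wd _ chiT; rewrite (funext chiE : derive1 chi = _) => e.
  have i1 : rintegrable a b (fun x => f x * w' x * kap n x).
    by do 2 apply: rintegrable_mul_continuous => //.
  have i2 : rintegrable a b (fun x => g x * w x * kap n x).
    by do 2 apply: rintegrable_mul_continuous => //.
  have -> : rint (fun x => H x * kap n x) =
      rint (fun x => f x * w' x * kap n x) + rint (fun x => g x * w x * kap n x).
    rewrite -RintegralD //; apply: eq_Rintegral => x _; rewrite /H; ring.
  have -> : rint (fun x => g x * w x * kap n x) = rint (fun x => g x * chi x).
    by apply: eq_Rintegral => x _; rewrite /chi; ring.
  rewrite -[rint (fun x => g x * chi x)]opprK -e.
  have -> : rint (fun x => f x *
      ((tentl c (del n) x - tentr d (del n) x) * w x + kap n x * w' x)) =
      rint (fun x => (phi x * tentl c (del n) x - phi x * tentr d (del n) x) +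
        f x * w' x * kap n x).
    by apply: eq_Rintegral => x _; rewrite /phi; ring.
  rewrite RintegralD ?RintegralB //; last exact: rintegrableB.
  by ring.
(* The cutoffs are bounded by 1 and tend pointwise to the indicator of the open interval; they
   vanish at its ends. *)
have cvgI : (fun n => rint (fun x => H x * kap n x)) @ \oo -->
    rint (fun x => H x * \1_(`]c, d[%classic) x).
  apply: Rintegral_dominated => //.
  - move=> n; apply: (@measurable_funS _ _ _ _ setT) => //.
    by apply: continuous_measurable_fun; exact: cutoff_continuous.
  - by move=> n x; exact: cutoff_bound.
  move=> x _; rewrite indicE mem_setE in_itv /=; apply: cvg_near_cst.
  have [/andP[cx xd]|xcd] := boolP (c < x < d).
    near=> n.
    rewrite [LHS](cutoff_eq1 (del0 n) (del4 n)) //.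
    have : del n < Num.min (x - c) (d - x) / 2.
      near: n; apply: (cvgr_lt _ delc).
      by rewrite divr_gt0 // lt_min !subr_gt0 cx.
    rewrite ltr_pdivlMr // lt_min => /andP[h1 h2].
    by apply/andP; split; lra.
  near=> n; rewrite [LHS]kapS //; apply: contra xcd => /andP[h1 h2].
  by have := del0 n; move=> d0; apply/andP; split; lra.
have -> : \int[mu]_(x in `]c, d[) (f x * w' x + g x * w x) =
    rint (fun x => H x * \1_(`]c, d[%classic) x).
  have sub : `]c, d[%classic `<=` Iab.
    move=> x /=; rewrite !in_itv /= => /andP[h1 h2].
    by rewrite (le_lt_trans ac h1) (lt_le_trans h2 db).
  rewrite -[X in Rintegral _ X](setIidr sub) Rintegral_mkcondr.
  by apply: eq_Rintegral => x _; rewrite patch_indic.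
(* It remains to see that the same sequence tends to the difference of the boundary values, by the
   two tents. *)
apply: (cvg_unique _ cvgI) => //.
rewrite -/(phi d) -/(phi c); apply/cvgrPdist_le => e e0.
have e2 : 0 < e / 2 by rewrite divr_gt0.
have [|rc rc0 rcP] := @within_continuous_dist _ c (e / 2) phic _ e2.
  by rewrite ac (le_trans (ltW cd) db).
have [|rd rd0 rdP] := @within_continuous_dist _ d (e / 2) phic _ e2.
  by rewrite db (le_trans ac (ltW cd)).
near=> n; rewrite step.
have dn : 2 * del n < Num.min rc rd.
  suff : del n < Num.min rc rd / 2 by lra.
  near: n; apply: (cvgr_lt _ delc).
  by rewrite divr_gt0 // lt_min rc0.
move: dn; rewrite lt_min => /andP[dc dd].
have d0 := del0 n; have d4 := del4 n.
have tlc : rint (tentl c (del n)) = 1.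
  have D x := is_derive_step_affine (del n) c (-1) x.
  rewrite (Rintegral_derive lt_ab D (@step'_affine_continuous R _ _ _)).
  rewrite step1 ?step0 ?subr0 //; [apply: affine_le => //; lra|apply: affine_ge => //; lra].
have trc : rint (tentr d (del n)) = 1.
  have D x := is_derive_step_affine (del n) d 2 x.
  rewrite (Rintegral_derive lt_ab D (@step'_affine_continuous R _ _ _)).
  rewrite step1 ?step0 ?subr0 //; [apply: affine_le => //; lra|apply: affine_ge => //; lra].
have bl : `|rint (fun x => phi x * tentl c (del n) x) - phi c| <= e / 2.
  apply: Rintegral_concentrated => //.
  - exact: rintegrable_mul_continuous (@tentl_continuous R c (del n)).
  - by apply/rintegrable_within/continuous_subspaceT; exact: tentl_continuous.
  - exact: tentl_ge0.
  move=> x xI tx; apply: rcP.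
    by move: xI; rewrite /= in_itv /= => /andP[h1 h2]; rewrite (ltW h1) (ltW h2).
  have /andP[h1 h2] : c <= x <= c + 2 * del n.
    by apply: contraNT tx => /(tentl_support d0 d4)->.
  by rewrite ger0_norm; lra.
have br : `|rint (fun x => phi x * tentr d (del n) x) - phi d| <= e / 2.
  apply: Rintegral_concentrated => //.
  - exact: rintegrable_mul_continuous (@tentr_continuous R d (del n)).
  - by apply/rintegrable_within/continuous_subspaceT; exact: tentr_continuous.
  - exact: tentr_ge0.
  move=> x xI tx; apply: rdP.
    by move: xI; rewrite /= in_itv /= => /andP[h1 h2]; rewrite (ltW h1) (ltW h2).
  have /andP[h1 h2] : d - 2 * del n <= x <= d.
    by apply: contraNT tx => /(tentr_support d0 d4)->.
  by rewrite ler0_norm; lra.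
move: bl br; rewrite !ler_norml => /andP[h1 h2] /andP[h3 h4].
by apply/andP; split; lra.
Unshelve. all: by end_near.
Qed.

End WeakDerivative.

(** * Fourier coefficients of weak derivatives, and lower bounds for chords of the unit circle *)

Section DerivativeCoefficients.
Local Open Scope classical_set_scope.
Context {R : realType}.
Variables a b : R.
Hypothesis lt_ab : a < b.

Local Notation fc f l := (fourier_coef a b f l).
Local Notation wave := (wave a b).
Local Notation L2 := (L2 a b).
Local Notation freq := (freq a b).

Let L_gt0 : 0 < b - a. Proof. by rewrite subr_gt0. Qed.

Lemma Re_mul_real (z : R[i]) (r : R) : Re (z * r%:C) = Re z * r.
Proof. by case: z => u v /=; rewrite mulr0 subr0. Qed.

Lemma Im_mul_real (z : R[i]) (r : R) : Im (z * r%:C) = Im z * r.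
Proof. by case: z => u v /=; rewrite mulr0 add0r. Qed.

Lemma weak_derivative_formula (f g : R -> R[i]) (w w' : R -> R) c d :
  continuous_on a b f -> L2 g -> weak_derivative a b f g ->
  (forall x : R, is_derive x 1 w (w' x)) -> continuous w' ->
  a <= c -> c < d -> d <= b ->
  cintegral c d (fun x => f x * (w' x)%:C + g x * (w x)%:C) =
  f d * (w d)%:C - f c * (w c)%:C.
Proof.
move=> [fr fi] gL wd wD w'c ac cd db; have [gr gi] := cintegrable_L2 lt_ab gL.
apply: complex_eq.
  rewrite Re_cintegral ReD ReN !Re_mul_real.
  rewrite -(@real_weak_derivative R a b lt_ab _ _ w w' c d fr gr) //.
    by apply: eq_Rintegral => x _; rewrite ReD !Re_mul_real.
  move=> chi /wd /(congr1 Re); rewrite ReN !Re_cintegral.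
  by under eq_Rintegral do rewrite Re_mul_real;
     under [in RHS]eq_Rintegral do rewrite Re_mul_real.
rewrite Im_cintegral ImD ImN !Im_mul_real.
rewrite -(@real_weak_derivative R a b lt_ab _ _ w w' c d fi gi) //.
  by apply: eq_Rintegral => x _; rewrite ImD !Im_mul_real.
move=> chi /wd /(congr1 Im); rewrite ImN !Im_cintegral.
by under eq_Rintegral do rewrite Im_mul_real;
   under [in RHS]eq_Rintegral do rewrite Im_mul_real.
Qed.

(** Integration by parts against the constant 1. *)
Lemma weak_derivative_lipschitz (f g : R -> R[i]) B c d :
  continuous_on a b f -> L2 g -> weak_derivative a b f g ->
  (forall x, a < x < b -> normc (g x) <= B) ->
  a <= c -> c < d -> d <= b -> normc (f d - f c) <= 2 * B * (d - c).
Proof.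
move=> fc gL wd gB ac cd db.
have := weak_derivative_formula fc gL wd (fun x => is_derive_cst (1 : R) x (1 : R))
  (fun x => cvg_cst (0 : R)) ac cd db.
rewrite /cst !mulr1 => <-.
rewrite (@eq_cintegral _ _ _ _ g); last by move=> x _; rewrite mulr0 add0r mulr1.
rewrite -mulrA; apply: normc_cintegral_le => // [|x /andP[cx xd]]; last first.
  by apply: gB; rewrite (le_lt_trans ac cx) (lt_le_trans xd db).
have [gr gi] := cintegrable_L2 lt_ab gL.
have sub : (`]c, d[ : set R) `<=` (`]a, b[ : set R).
  move=> x /=; rewrite !in_itv /= => /andP[h1 h2].
  by rewrite (le_lt_trans ac h1) (lt_le_trans h2 db).
by split; [apply: integrableS gr|apply: integrableS gi].
Qed.

Lemma fourier_coef_weak_derivative (f g : R -> R[i]) l :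
  L2 f -> continuous_on a b f -> f a = f b -> L2 g -> weak_derivative a b f g ->
  fc g l = 'i%C * (freq l)%:C * fc f l.
Proof.
move=> fL fcont fab gL wd; pose k := freq (- l).
have aff (x : R) : is_derive x 1 (fun x : R => k * (x - a)) k.
  by apply: is_derive_eq; rewrite ?scaler0 ?addr0 ?subr0 /GRing.scale /= ?mulr1.
have [cc cs] := @wave_ccontinuous R a b (- l).
rewrite /wave /= -/k in cc cs.
have dC (x : R) : is_derive x 1 (fun x : R => cos (k * (x - a))) (- k * sin (k * (x - a))).
  have h := @is_derive1_comp R cos (fun x => k * (x - a)) x _ _ (is_derive_cos _) (aff x).
  by apply: (is_derive_eq h); ring.
have dS (x : R) : is_derive x 1 (fun x : R => sin (k * (x - a))) (k * cos (k * (x - a))).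
  have h := @is_derive1_comp R sin (fun x => k * (x - a)) x _ _ (is_derive_sin _) (aff x).
  by apply: (is_derive_eq h); ring.
have cC : continuous (fun x : R => - k * sin (k * (x - a))).
  by move=> x; apply: cvgM; [exact: cvg_cst|exact: cs].
have cS : continuous (fun x : R => k * cos (k * (x - a))).
  by move=> x; apply: cvgM; [exact: cvg_cst|exact: cc].
have eC := weak_derivative_formula fcont gL wd dC cC (lexx a) lt_ab (lexx b).
have eS := weak_derivative_formula fcont gL wd dS cS (lexx a) lt_ab (lexx b).
have kper : expi (k * (b - a)) = 1 by rewrite freq_period // expi_pi_int.
have kc := congr1 Re kper; have ks := congr1 Im kper; rewrite /= in kc ks.
(* Weights in the integration by parts are real, so the cosine and sine parts of the wave are
   separate. The cosine boundary term vanishes by periodicity of [f], the sine one because the sine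
   is 0 at both ends. *)
rewrite !subrr !mulr0 cos0 kc fab subrr in eC.
rewrite !subrr !mulr0 sin0 ks !mulr0 subrr in eS.
have intb (F : R -> R[i]) (h : R -> R) B : L2 F -> continuous h -> (forall x, `|h x| <= B) ->
    L2 (fun x => F x * (h x)%:C).
  move=> FL hc hB; apply: (L2_Mbounded (B := B) FL) => [|x _].
    by apply: cmeasurable_continuous; exact: ccontinuous_real.
  by rewrite normc_real.
have iC : cintegrable a b (fun x => f x * (- k * sin (k * (x - a)))%:C +
    g x * (cos (k * (x - a)))%:C).
  apply: cintegrable_L2 => //; apply: L2D => //.
    apply: (intb _ _ `|k|) => // x; rewrite normrM normrN ler_piMr //; exact: sin_max.
  by apply: (intb _ _ 1) => // x; exact: cos_max.
have iS : cintegrable a b (fun x => f x * (k * cos (k * (x - a)))%:C +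
    g x * (sin (k * (x - a)))%:C).
  apply: cintegrable_L2 => //; apply: L2D => //.
    apply: (intb _ _ `|k|) => // x; rewrite normrM ler_piMr //; exact: cos_max.
  by apply: (intb _ _ 1) => // x; exact: sin_max.
have fW : cintegrable a b (fun x => f x * wave (- l) x).
  by apply: cintegrable_L2 => //; exact: L2_wave.
have gW : cintegrable a b (fun x => g x * wave (- l) x).
  by apply: cintegrable_L2 => //; exact: L2_wave.
have e0 : cintegral a b (fun x => ('i%C * k%:C) * (f x * wave (- l) x) + g x * wave (- l) x) = 0.
  transitivity (cintegral a b (fun x => (f x * (- k * sin (k * (x - a)))%:C +
      g x * (cos (k * (x - a)))%:C) + 'i%C * (f x * (k * cos (k * (x - a)))%:C +
      g x * (sin (k * (x - a)))%:C))).
    apply: eq_cintegral => x _.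
    have -> : wave (- l) x = (cos (k * (x - a)))%:C + 'i%C * (sin (k * (x - a)))%:C.
      by rewrite /wave -/k; apply: complex_eq => /=; ring.
    have ii : 'i%C * 'i%C = -1 :> R[i] by rewrite -expr2 sqr_i.
    have rM (x1 x2 : R) : (x1 * x2)%:C = x1%:C * x2%:C by rewrite rmorphM.
    move: (cos _) (sin _) (f x) (g x) => C S F G; generalize k => K; rewrite !rM rmorphN.
    apply/eqP; rewrite -subr_eq0; apply/eqP.
    transitivity (K%:C * F * S%:C * ('i%C * 'i%C + 1)); first by ring.
    by rewrite ii addNr mulr0.
  rewrite cintegralD //; last exact: cintegrableZ.
  by rewrite cintegralZ // eC eS mulr0 addr0.
move: e0; rewrite cintegralD //; last exact: cintegrableZ.
rewrite cintegralZ // => /eqP; rewrite addrC addr_eq0 => /eqP e0.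
rewrite !fourier_coefE // e0 /k freqN rmorphN /=; ring.
Qed.

(** A weak form of Jordan's inequality. The mean value theorem is useless near pi/2, where the
    cosine degenerates, so it is applied at u/2 and followed by the double angle formula. *)
Lemma sin_ge (u : R) : 0 <= u <= pi / 2 -> u / 4 <= sin u.
Proof.
move=> /andP[u0 u1]; have pi0 := pi_gt0 R.
have c4 : 2^-1 <= cos (pi / 4) :> R.
  have c0 : 0 <= cos (pi / 4) :> R by apply: cos_ge0_pihalf; apply/andP; split; lra.
  have : cos ((pi / 4) *+ 2) = 0 :> R.
    by have -> : (pi / 4) *+ 2 = pi / 2 :> R; [field|exact: cos_pihalf].
  rewrite cos_mulr2n => h; apply: le_of_sqr => //; lra.
have half (v : R) : 0 <= v -> v <= pi / 4 -> v / 2 <= sin v /\ 2^-1 <= cos v.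
  move=> v0 v1.
  have cv (x : R) : 0 <= x -> x <= pi / 4 -> 2^-1 <= cos x.
    move=> x0 x1; apply: (le_trans c4).
    by rewrite leNgt ltr_cos ?in_itv /= -?leNgt //; apply/andP; split; lra.
  split; last exact: cv.
  have [c /andP[]] := MVT_segment v0 (fun t _ => is_derive_sin t)
    (continuous_subspaceT (@continuous_sin R)).
  rewrite !bnd_simp sin0 !subr0 => c0 cle ->.
  by rewrite mulrC ler_wpM2r // cv // (le_trans cle).
have [||s1 c1] := half (u / 2); try lra.
have -> : u = (u / 2) *+ 2 by field.
rewrite sin_mulr2n.
have : (u / 4) <= cos (u / 2) * sin (u / 2) *+ 2; last by lra.
have u4 : 0 <= u / 4 by lra.
nra.
Qed.

Lemma normc_expi_sub1_sin (t : R) : normc (expi t - 1) = 2 * `|sin (t / 2)|.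
Proof.
apply/eqP; rewrite -(eqrXn2 (n := 2)) ?normc_ge0 // ?mulr_ge0 //.
rewrite sqr_normcE ReD ImD ReN ImN exprMn real_normK ?num_real //.
have -> : expi t = expi (t / 2) * expi (t / 2) by rewrite -expiD -splitr.
rewrite /expi ReM ImM /=.
have := cos2Dsin2 (t / 2); move: (cos _) (sin _) => C S h.
have -> : C * C = 1 - S ^+ 2 by rewrite -h; ring.
have e : C ^+ 2 = 1 - S ^+ 2 by rewrite -h; ring.
have -> : (1 - S ^+ 2 - S * S - 1) ^+ 2 + (C * S + S * C - 0) ^+ 2 =
  4 * S ^+ 4 + 4 * C ^+ 2 * S ^+ 2 by ring.
by rewrite e; apply/eqP; ring.
Qed.

(** The chord is twice the sine of half the angle; beyond pi the sine is reflected, which yields the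
    distance to 2 pi. *)
Lemma normc_expi_sub1_ge (t : R) : 0 <= t <= pi *+ 2 ->
  Num.min t (pi *+ 2 - t) / 4 <= normc (expi t - 1).
Proof.
move=> /andP[t0 t1]; have pi0 := pi_gt0 R; rewrite normc_expi_sub1_sin.
have [h|h] := lerP t pi.
  have s : t / 2 / 4 <= sin (t / 2) by apply: sin_ge; apply/andP; split; lra.
  have := ler_norm (sin (t / 2)); have : Num.min t (pi *+ 2 - t) <= t by rewrite ge_min lexx.
  by move: (Num.min _ _) (`|_|) s => *; lra.
have s : (pi - t / 2) / 4 <= sin (pi - t / 2) by apply: sin_ge; apply/andP; split; lra.
rewrite sinpi_sub in s || rewrite sinB sinpi cospi mul0r mulN1r sub0r opprK in s.
have := ler_norm (sin (t / 2)).
have : Num.min t (pi *+ 2 - t) <= pi *+ 2 - t by rewrite ge_min lexx orbT.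
by move: (Num.min _ _) (`|_|) s => *; lra.
Qed.

End DerivativeCoefficients.

(** * Pointwise convergence of Fourier series *)

Section FourierInversion.
Local Open Scope classical_set_scope.
Context {R : realType}.
Variables a b : R.
Hypothesis lt_ab : a < b.

Local Notation fc f l := (fourier_coef a b f l).
Local Notation wave := (wave a b).
Local Notation L2 := (L2 a b).

Let L_gt0 : 0 < b - a. Proof. by rewrite subr_gt0. Qed.

Definition fourier_sum (f : R -> R[i]) (H : nat) (x : R) : R[i] :=
  \sum_(j < H.*2) fc f (j%:Z - H%:Z) * wave (j%:Z - H%:Z) x.

(** By Bessel's inequality the squared coefficients along distinct frequencies form a convergent
    series, so they tend to 0. *)
Lemma riemann_lebesgue (g : R -> R[i]) (i : nat -> int) e : L2 g -> injective i ->
  0 < e -> \forall n \near \oo, normc (fc g (i n)) <= e.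
Proof.
move=> gL inj e0.
have c : cvgn (series (fun n => normc (fc g (i n)) ^+ 2)).
  apply: nondecreasing_is_cvgn.
    by apply: nondecreasing_series => n _ _; exact: sqr_ge0.
  exists (L2sq a b g / (b - a)) => _ [n _ <-].
  rewrite ler_pdivlMr // mulrC /series /= big_mkord.
  have us : uniq (map i (iota 0 n)) by rewrite map_inj_uniq ?iota_uniq.
  have := bessel lt_ab gL us; rewrite big_map.
  by rewrite -[X in iota _ X]subn0 -/(index_iota 0 n) big_mkord.
have /cvgrPdist_le /(_ _ (exprn_gt0 2 e0)) := cvg_series_cvg_0 c.
apply: filterS => n; rewrite sub0r normrN ger0_norm ?sqr_ge0 // => h.
by rewrite -(ler_pXn2r (n := 2)) ?nnegrE ?normc_ge0 // ltW.
Qed.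

(* Chernoff's argument: division by the wave of frequency 1 turns the Fourier sum
   into a telescoping one, whose end terms tend to 0 by Bessel's inequality. *)
Lemma fourier_sum_telescope (f g : R -> R[i]) x0 c H : L2 g -> (0 < H)%N ->
  (forall x, a < x < b -> f x = c + (g x * wave 1 x * wave (- 1) x0 - g x)) ->
  fourier_sum f H x0 - c =
  wave (- H%:Z - 1) x0 * fc g (- H%:Z - 1) - wave (H%:Z - 1) x0 * fc g (H%:Z - 1).
Proof.
move=> gL H0 fE; pose t l := wave l x0 * fc g l.
have cf l : fc f l * wave l x0 = c * (l == 0)%:R + (t (l - 1) - t l).
  have g1 := L2_wave 1 gL.
  have zL : L2 (fun x => wave (- 1) x0 * (g x * wave 1 x)) by exact: L2Z.
  rewrite (@eq_fourier_coef _ _ _ _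
    (fun x => c + (wave (- 1) x0 * (g x * wave 1 x) - g x))); last first.
    by move=> x xI; rewrite fE // [wave (-1) x0 * _]mulrC.
  rewrite fourier_coefD //; [|exact: L2_cst|exact: L2B].
  rewrite fourier_coef_cst // fourier_coefB // fourier_coefZ // fourier_coefMwave.
  rewrite mulrDl mulrBl; congr (_ + (_ - _)).
  - by case: eqP => [->|_]; rewrite ?wave0 ?mulr1 // !mulr0 mul0r.
  - by rewrite /t addrC waveD; ring.
  by rewrite mulrC.
rewrite /fourier_sum (eq_bigr _ (fun j _ => cf _)) big_split /=.
have HH : (H < H.*2)%N by rewrite -addnn -[X in (X < _)%N]addn0 ltn_add2l.
rewrite (bigD1 (Ordinal HH)) //= subrr eqxx mulr1 big1 ?addr0 => [|j jH]; last first.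
  have /negbTE -> : j%:Z - H%:Z != 0; last by rewrite mulr0.
  by rewrite subr_eq0; apply: contraNneq jH => e; apply/eqP/val_inj => /=; lia.
rewrite addrAC subrr add0r.
rewrite -(big_mkord xpredT (fun j => t (j%:Z - H%:Z - 1) - t (j%:Z - H%:Z))).
rewrite -[RHS]opprB; apply: (canRL (@opprK _)); rewrite -sumrN.
have := @telescope_sumr _ 0 H.*2 (fun j => t (j%:Z - H%:Z - 1)) (leq0n _).
rewrite sub0r; have -> : H.*2%:Z - H%:Z - 1 = H%:Z - 1 by lia.
move=> <-; apply: eq_bigr => j _; rewrite opprB; congr (t _ - _); lia.
Qed.

(** The inverse is spelled as conjugate times a real power so that its measurability follows from
    that of real powers. *)
Lemma normc_inv_mul (z : R[i]) : z != 0 -> conjc z * ((normc z ^+ 2) `^ (-1))%:C * z = 1.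
Proof.
move=> z0; have n0 : normc z ^+ 2 != 0.
  by rewrite expf_eq0 /=; apply: contraNneq z0 => /eq0_normc ->.
rewrite powR_inv1 ?sqr_ge0 // mulrAC [conjc z * z]mulrC mul_conjc -rmorphM.
by rewrite mulfV.
Qed.

(** A Lipschitz condition in the chordal distance on the circle makes the quotient [g] bounded,
    hence in L^2, and the two end terms of the telescoped sum are Fourier coefficients of [g]. *)
Lemma fourier_sum_cvg (f : R -> R[i]) K x0 e :
  cmeasurable a b f ->
  (forall x, a < x < b -> normc (f x - f x0) <= K * normc (wave 1 x * wave (- 1) x0 - 1)) ->
  0 < e -> \forall H \near \oo, normc (fourier_sum f H x0 - f x0) <= e.
Proof.
move=> mf fK e0; pose w x := wave 1 x * wave (- 1) x0 - 1.
pose g x := (f x - f x0) * (conjc (w x) * ((normc (w x) ^+ 2) `^ (-1))%:C).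
have cw : ccontinuous w.
  apply: ccontinuousD; last exact: ccontinuous_cst.
  by apply: ccontinuousM; [exact: wave_ccontinuous|exact: ccontinuous_cst].
have mw := cmeasurable_continuous a b cw.
have mg : cmeasurable a b g.
  apply: cmeasurableM; first by apply: cmeasurableD => //; exact: cmeasurable_cst.
  apply: cmeasurableM; first exact: cmeasurable_conj.
  split; last exact: measurable_cst.
  apply: (measurableT_comp (measurable_powR _)).
  exact: cmeasurable_sqr.
have gw x : a < x < b -> g x * w x = f x - f x0.
  move=> xI; have [w0|w0] := eqVneq (w x) 0; last first.
    by rewrite /g -mulrA [_ * w x]normc_inv_mul // mulr1.
  rewrite w0 mulr0; have := fK x xI; rewrite -/(w x) w0 normc0 mulr0.
  by move=> h; apply/esym/eq0_normc/eqP; rewrite eq_le h normc_ge0.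
have gL : L2 g.
  apply: (L2_bounded lt_ab (B := `|K|) mg) => x xI.
  have [w0|w0] := eqVneq (w x) 0.
    by rewrite /g w0 [conjc _](rmorph0 (@conjc _)) mul0r mulr0 normc0.
  have n0 : 0 < normc (w x).
    by rewrite lt_neqAle normc_ge0 andbT eq_sym; apply: contraNneq w0 => /eq0_normc ->.
  rewrite -(ler_pM2r n0) -normcM gw //.
  by apply: (le_trans (fK x xI)); apply: ler_wpM2r; [exact: normc_ge0|exact: ler_norm].
have i1 : injective (fun n : nat => - n%:Z - 1) by move=> x y /=; lia.
have i2 : injective (fun n : nat => n%:Z - 1) by move=> x y /=; lia.
have e2 : 0 < e / 2 by rewrite divr_gt0.
near=> H.
have H0 : (0 < H)%N by near: H; exact: nbhs_infty_gt.
rewrite (fourier_sum_telescope gL H0) => [|x xI]; last first.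
  by rewrite -mulrA -[X in _ + (_ - X)]mulr1 -mulrBr gw // addrC subrK.
have nt l : normc (wave l x0 * fc g l) = normc (fc g l) by rewrite normcM normc_wave mul1r.
apply: (le_trans (normcB _ _)); rewrite !nt [e]splitr; apply: lerD.
  by near: H; exact: (riemann_lebesgue gL i1 e2).
by near: H; exact: (riemann_lebesgue gL i2 e2).
Unshelve. all: by end_near. Qed.

End FourierInversion.

(** * Uniform Fourier approximation of periodic H^2 functions *)

Section PeriodicSobolev.
Local Open Scope classical_set_scope.
Context {R : realType}.
Variables a b : R.
Hypothesis lt_ab : a < b.

Local Notation fc f l := (fourier_coef a b f l).
Local Notation fsum := (fourier_sum a b).
Local Notation wave := (wave a b).
Local Notation L2 := (L2 a b).
Local Notation freq := (freq a b).

Let L_gt0 : 0 < b - a. Proof. by rewrite subr_gt0. Qed.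

Lemma wave1_gap x y : a <= x <= b -> a <= y <= b ->
  pi / (2 * (b - a)) * Num.min `|x - y| (b - a - `|x - y|) <=
  normc (wave 1 x * wave (- 1) y - 1).
Proof.
move=> /andP[ax xb] /andP[ay yb].
have -> : wave 1 x * wave (- 1) y = expi (2 * pi / (b - a) * (x - y)).
  rewrite /wave -expiD freqN; congr expi.
  have -> : freq 1 = 2 * pi / (b - a) by rewrite /freq mulr1.
  by ring.
set d := `|x - y|.
have -> : normc (expi (2 * pi / (b - a) * (x - y)) - 1) = normc (expi (2 * pi / (b - a) * d) - 1).
  rewrite !normc_expi_sub1_sin; congr (_ * _).
  have [h|/ltW h] := leP 0 (x - y); first by rewrite /d (ger0_norm h).
  rewrite /d (ler0_norm h).
  by rewrite mulrN mulNr sinN normrN.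
have p0 : 0 <= 2 * pi / (b - a) by rewrite divr_ge0 ?mulr_ge0 ?pi_ge0 // ltW.
have e2 : 2 * pi / (b - a) * (b - a) = pi *+ 2.
  by rewrite divfK ?gt_eqF // mulr_natl.
have dL : d <= b - a by rewrite /d ler_norml; lra.
apply: le_trans (normc_expi_sub1_ge _); last first.
  by apply/andP; split; [rewrite mulr_ge0 /d|rewrite -e2 ler_wpM2l].
rewrite -e2 -mulrBr -minr_pMr //; move: (Num.min _ _) => mn.
have -> : pi / (2 * (b - a)) * mn = 2 * pi / (b - a) * mn / 4 by field; rewrite gt_eqF.
by [].
Qed.

Lemma periodic_lipschitz_gap (f : R -> R[i]) K x y :
  (forall x y, a <= x <= b -> a <= y <= b -> normc (f x - f y) <= K * `|x - y|) ->
  f a = f b -> 0 <= K -> a <= x <= b -> a <= y <= b ->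
  normc (f x - f y) <= 2 * (b - a) / pi * K * normc (wave 1 x * wave (- 1) y - 1).
Proof.
move=> fK fab K0 xI yI; have aI : a <= a <= b by rewrite lexx ltW.
have bI : a <= b <= b by rewrite lexx ltW.
(* The second term of the minimum is the way round the circle: through [b] and [a], where [f] takes
   the same value. *)
have main : normc (f x - f y) <= K * Num.min `|x - y| (b - a - `|x - y|).
  rewrite minr_pMr // le_min fK //=.
  have h1 := fK _ _ xI aI; have h2 := fK _ _ xI bI.
  have h3 := fK _ _ aI yI; have h4 := fK _ _ bI yI.
  move: xI yI => /andP[ax xb] /andP[ay yb].
  have [xy|/ltW xy] := leP 0 (x - y).
    rewrite (ger0_norm xy); have -> : f x - f y = (f x - f b) + (f a - f y) by rewrite fab; ring.
    apply: (le_trans (le_normcD _ _)); apply: (le_trans (lerD h2 h3)).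
    have -> : `|x - b| = b - x by rewrite distrC ger0_norm ?subr_ge0.
    have -> : `|a - y| = y - a by rewrite distrC ger0_norm ?subr_ge0.
    by rewrite -mulrDr ler_wpM2l //; lra.
  rewrite (ler0_norm xy); have -> : f x - f y = (f x - f a) + (f b - f y) by rewrite fab; ring.
  apply: (le_trans (le_normcD _ _)); apply: (le_trans (lerD h1 h4)).
  have -> : `|x - a| = x - a by rewrite ger0_norm ?subr_ge0.
  have -> : `|b - y| = b - y by rewrite ger0_norm ?subr_ge0.
  by rewrite -mulrDr ler_wpM2l //; lra.
apply: (le_trans main); have := wave1_gap xI yI; set mn := Num.min _ _.
move=> gap; rewrite -mulrA mulrCA ler_wpM2l //.
have -> : mn = 2 * (b - a) / pi * (pi / (2 * (b - a)) * mn).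
  have pn0 : pi != 0 :> R by rewrite gt_eqF ?pi_gt0.
  have Ln0 : b - a != 0 by rewrite gt_eqF.
  by move: pn0; move: (pi : R) => q qn0; field; rewrite Ln0 qn0.
by rewrite ler_wpM2l // divr_ge0 ?pi_ge0 // mulr_ge0 // ltW.
Qed.

Lemma continuous_on_bounded (f : R -> R[i]) : continuous_on a b f ->
  exists2 B, 0 <= B & forall x, a <= x <= b -> normc (f x) <= B.
Proof.
have real_bounded (g : R -> R) : {within `[a, b], continuous g} ->
    exists2 B, 0 <= B & forall x, a <= x <= b -> `|g x| <= B.
  move=> gc; have /compact_bounded[B [_ gB]] := continuous_compact gc (@segment_compact R a b).
  exists (`|B| + 1) => [|x xI]; first by rewrite addr_ge0.
  apply: gB; last by exists x => //=; rewrite in_itv.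
  by rewrite ltr_pwDr // ler_norm.
move=> [/real_bounded[B1 B10 fB1] /real_bounded[B2 B20 fB2]].
exists (B1 + B2) => [|x xI]; first exact: addr_ge0.
by apply: (le_trans (normc_le_ReIm _)); apply: lerD; [exact: fB1|exact: fB2].
Qed.

Lemma Hper_fourier_coefD m (phi : R -> R[i]) D k l : Hper_derivatives a b m phi D ->
  (k <= m)%N -> fc (D k) l = ('i%C * (freq l)%:C) ^+ k * fc phi l.
Proof.
move=> [D0 DL wD cD]; elim: k => [_|k IHk km].
  rewrite expr0 mul1r; apply: eq_fourier_coef => x /andP[ax xb].
  by apply: D0; rewrite in_itv /= !ltW.
have [cDk ek] := cD _ km.
rewrite (fourier_coef_weak_derivative lt_ab l (DL _ (ltnW km)) cDk ek (DL _ km) (wD _ km)).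
by rewrite IHk 1?ltnW // exprS mulrA.
Qed.

(** The coefficients of phi and of its second derivative are both bounded, and together they control
    the weight times the coefficient. *)
Lemma Hper2_coef_le (phi : R -> R[i]) : Hper a b 2 phi ->
  exists2 A, 0 <= A & forall l, normc (fc phi l) <= A * invsq l.
Proof.
move=> [D hD]; have [D0 DL _ _] := hD.
pose A0 := Num.sqrt (L2sq a b (D 0%N) / (b - a)); pose A2 := Num.sqrt (L2sq a b (D 2%N) / (b - a)).
exists ((A0 + A2) * (1 + (b - a) ^+ 2)) => [|l].
  by rewrite mulr_ge0 ?addr_ge0 ?sqrtr_ge0 ?sqr_ge0.
have le (f : R -> R[i]) : L2 f -> normc (fc f l) <= Num.sqrt (L2sq a b f / (b - a)).
  by move=> fL; rewrite -[leLHS]ger0_norm ?normc_ge0 // -sqrtr_sqr ler_wsqrtr // fourier_coef_le.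
have h0 := le _ (DL 0%N isT); have h2 := le _ (DL 2%N isT).
rewrite (Hper_fourier_coefD l hD) // expr0 mul1r in h0.
rewrite (Hper_fourier_coefD l hD) // exprMn sqr_i mulN1r mulNr normcN normcM -rmorphXn
  normc_real ger0_norm ?sqr_ge0 // in h2.
have hw : weight a b l * normc (fc phi l) <= A0 + A2.
  by rewrite /weight mulrDl mul1r lerD.
rewrite -mulrA; apply: le_trans (ler_wpM2l _ (inv_weight lt_ab l)); last first.
  by rewrite addr_ge0 ?sqrtr_ge0.
by rewrite ler_pdivlMr ?weight_gt0 // mulrC.
Qed.

Lemma fourier_sumS (f : R -> R[i]) H x : fsum f H.+1 x =
  fc f (- H%:Z - 1) * wave (- H%:Z - 1) x + fsum f H x + fc f H%:Z * wave H%:Z x.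
Proof.
rewrite /fourier_sum doubleS big_ord_recl big_ord_recr /=.
rewrite addrA; congr (_ + _ + _).
- by have -> : 0%:Z - H.+1%:Z = - H%:Z - 1 by lia.
- by apply: eq_bigr => j _; rewrite /bump /=; have -> : (1 + j)%N%:Z - H.+1%:Z = j%:Z - H%:Z by lia.
- by rewrite /bump /=; have -> : (1 + H.*2)%N%:Z - H.+1%:Z = H%:Z by lia.
Qed.

(** Passing from K to K + 1 adds two modes of size at most A/K^2, and 2/K^2 <= 4 (1/K - 1/(K+1))
    since K + 1 <= 2K. *)
Lemma fourier_sum_cauchy (f : R -> R[i]) A H n x : 0 <= A ->
  (forall l, normc (fc f l) <= A * invsq l) -> (0 < H)%N ->
  normc (fsum f (H + n) x - fsum f H x) <= 4 * A * (H%:R^-1 - (H + n)%:R^-1).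
Proof.
move=> A0 fA H0; elim: n => [|n IHn].
  by rewrite addn0 !subrr normc0 mulr0.
rewrite addnS fourier_sumS; set K := (H + n)%N.
have K0 : (0 < K)%N by rewrite addn_gt0 H0.
have Kr : 0 < K%:R :> R by rewrite ltr0n.
set p := fc f _ * _; set q := fc f _ * _.
have -> : p + fsum f K x + q - fsum f H x = (fsum f K x - fsum f H x) + (p + q) by ring.
apply: (le_trans (le_normcD _ _)); apply: (le_trans (lerD IHn (le_normcD _ _))).
have qle : normc q <= A * K%:R^-1 ^+ 2.
  rewrite normcM normc_wave mulr1; apply: (le_trans (fA _)); rewrite /invsq.
  have /negbTE -> : K%:Z != 0 by lia.
  by have -> : `|K%:Z| = K%:Z by []; rewrite rmorphXn exprVn.
have ple : normc p <= A * K%:R^-1 ^+ 2.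
  rewrite normcM normc_wave mulr1; apply: (le_trans (fA _)); rewrite /invsq ler_wpM2l //.
  have /negbTE -> : - K%:Z - 1 != 0 by lia.
  have -> : `|- K%:Z - 1| = K.+1%:Z by lia.
  rewrite rmorphXn /= exprVn lef_pV2 ?posrE ?exprn_gt0 ?ltr0n //.
  by rewrite ler_pXn2r ?nnegrE // ler_nat.
apply: (le_trans (lerD (lexx _) (lerD ple qle))).
have k1 : 1 <= K%:R :> R by rewrite ler1n.
have -> : 4 * A * (H%:R^-1 - K.+1%:R^-1) =
  4 * A * (H%:R^-1 - K%:R^-1) + A * (4 * (K%:R^-1 - K.+1%:R^-1)) by ring.
rewrite lerD2l -mulrDr ler_wpM2l //.
have -> : K%:R^-1 - K.+1%:R^-1 = (K%:R * (K%:R + 1))^-1 :> R.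
  by rewrite -[K.+1%:R]natr1; field; rewrite !gt_eqF // ltr_wpDr.
have -> : K%:R^-1 ^+ 2 + K%:R^-1 ^+ 2 = 2 / K%:R ^+ 2 :> R by rewrite exprVn; ring.
have kp : 0 < K%:R * (K%:R + 1) :> R by rewrite mulr_gt0 // ltr_wpDr.
rewrite ler_pdivrMr ?exprn_gt0 // mulrAC ler_pdivlMr //.
by nra.
Qed.

Lemma Hper2_continuous (phi : R -> R[i]) : Hper a b 2 phi ->
  exists K, [/\ 0 <= K, cmeasurable a b phi, phi a = phi b &
    forall x y, a <= x <= b -> a <= y <= b -> normc (phi x - phi y) <= K * `|x - y|].
Proof.
move=> [D [D0 DL wD cD]].
have [c0 e0] := cD 0%N isT; have [c1 _] := cD 1%N isT.
have [B B0 DB] := continuous_on_bounded c1.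
have De x : a <= x <= b -> phi x = D 0%N x by move=> xI; rewrite D0 // in_itv.
have aI : a <= a <= b by rewrite lexx ltW.
have bI : a <= b <= b by rewrite lexx ltW.
have lip x y : a <= x <= b -> a <= y <= b -> x < y ->
    normc (phi x - phi y) <= 2 * B * `|x - y|.
  move=> xI yI xy; rewrite !De // normc_subC.
  rewrite ler0_norm ?opprB; last by rewrite subr_le0 ltW.
  move: xI yI => /andP[ax xb] /andP[ay yb].
  apply: (weak_derivative_lipschitz lt_ab c0 (DL 1%N isT) (wD 0%N isT)) => // z /andP[h1 h2].
  by apply: DB; rewrite !ltW.
exists (2 * B); split=> [||| x y xI yI].
- by rewrite mulr_ge0.
- have [mr mi] := cmeasurable_continuous_on c0.
  by split; [move: mr|move: mi]; apply: eq_measurable_fun => x /set_mem /=;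
    rewrite in_itv /= => /andP[h1 h2]; rewrite De // !ltW.
- by rewrite !De.
have [xy|xy|->] := ltgtP x y; first exact: lip.
  by rewrite normc_subC distrC; exact: lip.
by rewrite !subrr normc0 normr0 mulr0.
Qed.

Lemma Hper2_fourier_sum (phi : R -> R[i]) : Hper a b 2 phi ->
  exists2 C, 0 <= C & forall H x, (0 < H)%N -> a <= x <= b ->
    normc (fsum phi H x - phi x) <= C / H%:R.
Proof.
move=> hphi; have [A A0 phiA] := Hper2_coef_le hphi.
have [K [K0 mphi phiab phiK]] := Hper2_continuous hphi.
exists (4 * A) => [|H x H0 xI]; first by rewrite mulr_ge0.
apply/ler_addgt0Pr => e e0.
have gap y : a < y < b -> normc (phi y - phi x) <=
    2 * (b - a) / pi * K * normc (wave 1 y * wave (- 1) x - 1).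
  move=> /andP[h1 h2]; apply: periodic_lipschitz_gap => //.
  by rewrite !ltW.
have := fourier_sum_cvg lt_ab mphi gap e0 => -[n _ nP].
have := nP (H + n)%N (leq_addl _ _) => /= h.
(* Pointwise inversion only identifies the limit, at a rate depending on x; comparison with a far
   larger index gives the rate 1/H, uniform in x. *)
have -> : fsum phi H x - phi x =
  - (fsum phi (H + n) x - fsum phi H x) + (fsum phi (H + n) x - phi x) by ring.
apply: (le_trans (le_normcD _ _)); rewrite normcN; apply: lerD => //.
apply: (le_trans (fourier_sum_cauchy _ _ A0 phiA H0)).
by rewrite ler_wpM2l ?mulr_ge0 // gerBl invr_ge0.
Qed.

Lemma fourier_sum_mode (f : R -> R[i]) H x :
  fsum f H x = \sum_(j < H.*2) fc f (mode H.*2 j) * wave (mode H.*2 j) x.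
Proof. by rewrite /mode doubleK. Qed.

Lemma Hper2_sup (phi : R -> R[i]) M x : Hper a b 2 phi -> 0 <= M ->
  wbound a b 1 (fun l => fc phi l) M -> a <= x <= b -> normc (phi x) <= c_l1 a b * M.
Proof.
move=> hphi M0 phiM xI; have [C C0 CP] := Hper2_fourier_sum hphi.
apply/ler_addgt0Pr => e e0.
have [H H0 He] : exists2 H, (0 < H)%N & C / H%:R <= e.
  exists (Num.truncn (C / e)).+1 => //; rewrite ler_pdivrMr ?ltr0n //.
  rewrite mulrC -ler_pdivrMr //; apply: ltW; exact: truncnS_gt.
have -> : phi x = fsum phi H x - (fsum phi H x - phi x) by ring.
apply: (le_trans (normcB _ _)); apply: lerD; last exact: le_trans (CP H x H0 xI) He.
rewrite fourier_sum_mode; apply: (le_trans (normc_sum _ _ _)).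
apply: le_trans (@wbound_l1 R a b lt_ab 0 _ M H.*2 M0 phiM).
by apply: ler_sum => j _; rewrite normcM normc_wave mulr1 expr0 mul1r.
Qed.

(** Multiplication by a single wave shifts coefficients, so a partial sum of [V] gives a finite
    convolution exactly; the rest is uniformly small. *)
Lemma fourier_coef_product (V phi : R -> R[i]) H d S l : L2 phi -> cmeasurable a b V ->
  (forall x, a < x < b -> normc (phi x) <= S) -> 0 <= d ->
  (forall x, a < x < b -> normc (V x - fsum V H x) <= d) ->
  normc (fc (fun x => V x * phi x) l -
         \sum_(j < H.*2) fc V (mode H.*2 j) * fc phi (l - mode H.*2 j)) <= 2 * (d * S).
Proof.
move=> phiL mV phiS d0 Vd.
have fsL : L2 (fun x => fsum V H x * phi x).
  rewrite /fourier_sum; under eq_fun do rewrite mulr_suml.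
  apply: L2_sum => // j; under eq_fun do rewrite -mulrA [wave _ _ * _]mulrC.
  exact/L2Z/L2_wave.
have dL : L2 (fun x => phi x * (V x - fsum V H x)).
  apply: (L2_Mbounded (B := d)) => //.
  rewrite (_ : (fun x => _) = fun x => V x + -1 * fsum V H x); last first.
    by apply/funext => x; rewrite mulN1r.
  apply: cmeasurableD => //; apply: cmeasurableM; first exact: cmeasurable_cst.
  apply: cmeasurable_continuous.
  apply: ccontinuous_sum => j; apply: ccontinuousM; first exact: ccontinuous_cst.
  exact: wave_ccontinuous.
have VL : L2 (fun x => V x * phi x).
  have := L2D dL fsL; apply: eq_L2 => x _; ring.
have -> : \sum_(j < H.*2) fc V (mode H.*2 j) * fc phi (l - mode H.*2 j) =
    fc (fun x => fsum V H x * phi x) l.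
  transitivity (fc (fun x => \sum_(j < H.*2) fc V (mode H.*2 j) *
      (phi x * wave (mode H.*2 j) x)) l).
    rewrite fourier_coef_sum => // [|j]; last exact/L2Z/L2_wave.
    by apply: eq_bigr => j _; rewrite fourier_coefZ ?fourier_coefMwave //; exact: L2_wave.
  apply: eq_fourier_coef => x _; rewrite fourier_sum_mode mulr_suml.
  by apply: eq_bigr => j _; rewrite -mulrA [wave _ _ * _]mulrC.
rewrite -fourier_coefB // (@eq_fourier_coef _ _ _ _ (fun x => phi x * (V x - fsum V H x))).
  2: by move=> x _; ring.
rewrite fourier_coefE normcM normc_real ger0_norm; last by rewrite invr_ge0 ltW.
rewrite ler_pdivrMl // [leRHS]mulrC -mulrA; apply: normc_cintegral_le => //.
  exact/cintegrable_L2/L2_wave.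
move=> x xI; rewrite !normcM normc_wave mulr1 mulrC.
by apply: ler_pM; rewrite ?normc_ge0 ?phiS ?Vd.
Qed.

End PeriodicSobolev.

Lemma lebesgue_ae_imp {R : realType} (P Q : R -> Prop) : (forall x, P x -> Q x) ->
  {ae @lebesgue_measure R, forall x, P x} -> {ae @lebesgue_measure R, forall x, Q x}.
Proof.
move=> PQ [A [mA A0 PA]]; exists A; split=> // x nQ; apply: PA => /= Px.
by apply: nQ; exact: PQ.
Qed.

Lemma is_derive_epsilon {R : realType} (f : R -> R) (t d : R) :
  (forall e, 0 < e -> exists2 r, 0 < r & forall s, s != 0 -> `|s| < r ->
     `|s^-1 * (f (t + s) - f t) - d| <= e) -> is_derive t 1 f d.
Proof.
move=> fd.
have c : (h^-1 *: (f (h *: (1 : R) + t) - f t) @[h --> 0^'] --> d)%classic.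
  apply/cvgrPdist_le => e /fd[r r0 rP]; apply/nbhs_ballP; exists r => // s.
  rewrite /ball /= sub0r normrN => sr s0; rewrite distrC.
  suff -> : s^-1 *: (f (s *: (1 : R) + t) - f t) = s^-1 * (f (t + s) - f t) by exact: rP.
  by rewrite /GRing.scale /= mulr1 [s + t]addrC.
by apply: DeriveDef; [exact: cvgP c|exact: cvg_lim c].
Qed.

(** * Convergence for the exact solution *)

Section CoefficientODE.
Local Open Scope classical_set_scope.
Local Open Scope ring_scope.
Context {R : realType}.
Variables a b : R.
Hypothesis lt_ab : a < b.

Local Notation mu := (@lebesgue_measure R).
Local Notation fc f l := (fourier_coef a b f l).
Local Notation wave := (wave a b).
Local Notation L2 := (L2 a b).
Local Notation freq := (freq a b).

Let L_gt0 : 0 < b - a. Proof. by rewrite subr_gt0. Qed.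

Lemma fourier_coef_norm_le (f : R -> R[i]) l e : L2 f ->
  (L2norm a b f < (e * Num.sqrt (b - a))%:E)%E -> normc (fc f l) <= e.
Proof.
move=> fL; rewrite L2normE // lte_fin => fe.
have s0 : 0 < Num.sqrt (b - a) by rewrite sqrtr_gt0.
have := fourier_coef_le lt_ab l fL; have := normc_ge0 (fc f l).
move: (normc _) => n n0; rewrite ler_pdivlMr // => nle.
rewrite -(ler_pM2r s0); apply: le_trans (ltW fe).
rewrite -[leLHS]ger0_norm ?mulr_ge0 ?sqrtr_ge0 // -sqrtr_sqr; apply: ler_wsqrtr.
by rewrite exprMn sqr_sqrtr // ltW.
Qed.

Lemma Hper_L2 m (phi : R -> R[i]) : Hper a b m phi -> L2 phi.
Proof.
move=> [D [D0 DL _ _]]; apply: eq_L2 (DL 0%N _) => // x /andP[h1 h2].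
by rewrite D0 // in_itv /= !ltW.
Qed.

Lemma ae_eq0_fourier_coef (F : R -> R[i]) l : L2 F ->
  {ae mu, forall x, x \in `]a, b[ -> F x = 0} -> fc F l = 0.
Proof.
move=> FL F0; rewrite fourier_coefE.
have /L2P[[mr mi] _] := L2_wave (- l) FL.
suff -> : cintegral a b (fun x => F x * wave (- l) x) = 0 by rewrite mulr0.
have zero (g : R -> R) : measurable_fun (`]a, b[ : set R) g ->
    {ae mu, forall x, x \in `]a, b[ -> g x = 0} ->
    \int[mu]_(x in `]a, b[) g x = 0.
  move=> mg g0; rewrite /Rintegral (@ae_eq_integral _ _ _ mu _ (cst 0%E)) //.
  - by rewrite integral0.
  - exact/measurable_EFinP.
  by refine (lebesgue_ae_imp _ g0) => x xP xI; rewrite /= xP.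
apply: complex_eq; [rewrite Re_cintegral|rewrite Im_cintegral]; apply: zero => //;
  by refine (lebesgue_ae_imp _ F0) => x xP xI; rewrite xP // mul0r.
Qed.

Section Solution.
Variables (V : R -> R) (eps : R) (psi0 : R -> R[i]) (psi dpsi : R -> R -> R[i]).
Hypothesis VH : Hper a b 2 (ofreal V).
Hypothesis sol : exact_solution a b V eps psi0 psi dpsi.

(** Frozen at negative times: the coefficients then are continuous on the whole line, as the mean
    value argument for a step starting at 0 requires. *)
Definition sol_coef (t : R) (l : int) : R[i] := fc (psi (Num.max t 0)) l.

Definition pot_coef (t : R) (l : int) : R[i] :=
  fc (fun x => ofreal V x * psi (Num.max t 0) x) l.

Lemma solution_Hper t : 0 <= t -> Hper a b 2 (psi t).
Proof. by case: sol => _ + _ _ _; apply. Qed.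

Lemma solution_L2 t : 0 <= t -> L2 (psi t).
Proof. by move=> /solution_Hper/Hper_L2. Qed.

Lemma sol_coefE t l : 0 <= t -> sol_coef t l = fc (psi t) l.
Proof. by move=> t0; rewrite /sol_coef max_l. Qed.

Lemma sol_coef_neg t l : t <= 0 -> sol_coef t l = fc (psi 0) l.
Proof. by move=> t0; rewrite /sol_coef max_r. Qed.

Lemma sol_coef_derive t l : 0 < t -> is_cderive (sol_coef ^~ l) t (fc (dpsi t) l).
Proof.
move=> t0; have [_ _ _ /(_ _ t0)[dL dlim] _] := sol.
have main e : 0 < e -> exists2 r, 0 < r & forall s, s != 0 -> `|s| < r ->
    normc ((s^-1)%:C * (sol_coef (t + s) l - sol_coef t l) - fc (dpsi t) l) <= e.
  move=> e0; have es : 0 < e * Num.sqrt (b - a) by rewrite mulr_gt0 // sqrtr_gt0.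
  have /dlim := nbhs_open_ereal_lt (f := fun=> e * Num.sqrt (b - a)) es.
  move=> /nbhs_ballP[r r0 rP]; exists (Num.min r t) => [|s s0].
    by rewrite lt_min t0 andbT.
  rewrite lt_min => /andP[sr st].
  have ts : 0 <= t + s by move: st; rewrite ltr_norml => /andP[]; lra.
  have t0' := ltW t0; have p1 := solution_L2 ts; have p2 := solution_L2 t0'.
  have dif := L2B p1 p2; have dif' := L2Z (s^-1)%:C dif.
  rewrite !sol_coefE // -fourier_coefB // -fourier_coefZ // -fourier_coefB //.
  apply: fourier_coef_norm_le; first exact: L2B.
  by apply: rP => //; rewrite /ball /= sub0r normrN.
split; apply: is_derive_epsilon => e /main[r r0 rP]; exists r => // s s0 sr;
  apply: le_trans (rP s s0 sr).
  by apply: le_trans (Re_le_normc _); rewrite ReD ReN [_%:C * _]mulrC Re_mul_real ReD ReN [_ / s]mulrC.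
by apply: le_trans (Im_le_normc _); rewrite ImD ImN [_%:C * _]mulrC Im_mul_real ImD ImN [_ / s]mulrC.
Qed.

Lemma sol_coef_continuous l : ccontinuous (sol_coef ^~ l).
Proof.
have main t e : 0 < e -> exists2 r, 0 < r & forall s, `|s - t| < r ->
    normc (sol_coef s l - sol_coef t l) <= e.
  move=> e0; have [t0|t0|<-] := ltgtP 0 t.
  - have [dr di] := sol_coef_derive l t0.
    have e2 : 0 < e / 2 by rewrite divr_gt0.
    have /derivable1_diffP/differentiable_continuous := @ex_derive _ _ _ _ _ _ _ dr.
    have /derivable1_diffP/differentiable_continuous := @ex_derive _ _ _ _ _ _ _ di.
    move=> /cvgrPdist_le/(_ _ e2)/nbhs_ballP[r1 r10 h1].
    move=> /cvgrPdist_le/(_ _ e2)/nbhs_ballP[r2 r20 h2].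
    exists (Num.min r1 r2) => [|s]; first by rewrite lt_min r10.
    rewrite lt_min => /andP[s1 s2]; rewrite normc_subC; apply: (le_trans (normc_le_ReIm _)).
    rewrite ReD ImD ReN ImN [e]splitr; apply: lerD.
      by apply: h2; rewrite /ball /= distrC.
    by apply: h1; rewrite /ball /= distrC.
  - exists (- t) => [|s]; first by rewrite oppr_gt0.
    rewrite ltr_norml opprK => /andP[_ st].
    by rewrite !sol_coef_neg ?subrr ?normc0; [exact: ltW|exact: ltW|lra].
  have es : 0 < e * Num.sqrt (b - a) by rewrite mulr_gt0 // sqrtr_gt0.
  have [_ _ lim0 _ _] := sol.
  have /lim0 := nbhs_open_ereal_lt (f := fun=> e * Num.sqrt (b - a)) es.
  move=> /nbhs_ballP[r r0 rP]; exists r => // s; rewrite subr0 => sr.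
  have [s0|s0] := ltP 0 s; last by rewrite !sol_coef_neg // subrr normc0; exact: ltW.
  have s0' := ltW s0; have p1 := solution_L2 s0'; have p2 := solution_L2 (lexx 0).
  rewrite !sol_coefE // -fourier_coefB //; apply: fourier_coef_norm_le; first exact: L2B.
  by apply: rP => //; rewrite /ball /= sub0r normrN.
split=> t; apply/cvgrPdist_le => e /(main t)[r r0 rP]; apply/nbhs_ballP; exists r => // s;
  rewrite /ball /= distrC => sr; rewrite distrC; apply: le_trans (rP s sr).
  by apply: le_trans (Re_le_normc _); rewrite ReD ReN.
by apply: le_trans (Im_le_normc _); rewrite ImD ImN.
Qed.

Lemma potential_L2 t : 0 <= t -> L2 (fun x => ofreal V x * psi t x).
Proof.
move=> /solution_L2 pL; have [K [K0 mV Vab VK]] := Hper2_continuous lt_ab VH.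
have := L2_Mbounded (B := normc (ofreal V a) + K * (b - a)) pL mV.
move=> h; apply: eq_L2 (h _) => [x _|x /andP[ax xb]]; first by rewrite mulrC.
have -> : ofreal V x = ofreal V a + (ofreal V x - ofreal V a) by rewrite addrC subrK.
apply: (le_trans (le_normcD _ _)); rewrite lerD2l.
have aI : a <= a <= b by rewrite lexx ltW.
have xI : a <= x <= b by rewrite !ltW.
apply: (le_trans (VK _ _ xI aI)); rewrite ler_wpM2l //.
by rewrite gtr0_norm ?subr_gt0 // lerD2r ltW.
Qed.

Lemma sol_coef_ode t l : 0 < t -> is_cderive (sol_coef ^~ l) t
  (- 'i%C * ((freq l ^+ 2)%:C * sol_coef t l + eps%:C * pot_coef t l)).
Proof.
move=> t0; apply: is_cderive_eq (sol_coef_derive l t0) _.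
have [_ _ _ /(_ _ t0)[dL _] /(_ _ t0)[D hD ae]] := sol.
have [_ DL _ _] := hD; have D2L := DL 2%N isT.
have VL := potential_L2 (ltW t0); have idL := L2Z 'i%C dL.
have eVL := L2Z eps%:C VL.
(* The equation holds almost everywhere in space; all terms are moved to one side to form an L^2
   function whose coefficients vanish. *)
have := @ae_eq0_fourier_coef (fun x => 'i%C * dpsi t x + (D 2%N x - eps%:C * (ofreal V x * psi t x))) l.
rewrite fourier_coefD //; last exact: L2B.
rewrite fourier_coefB // !fourier_coefZ // (Hper_fourier_coefD lt_ab l hD) //.
rewrite sol_coefE ?ltW // /pot_coef max_l ?ltW //.
move=> h; have := h _ _; rewrite exprMn sqr_i -rmorphXn.
set d := fc _ l; set p := fc _ l; set q := fc _ l => {}h.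
have := h (L2D idL (L2B D2L eVL)) _.
move=> {}h.
have e : 'i%C * d = (freq l ^+ 2)%:C * p + eps%:C * q.
  apply/eqP; rewrite -subr_eq0; apply/eqP; rewrite -[RHS]h; first by rewrite mulN1r mulNr; ring.
  by refine (lebesgue_ae_imp _ ae) => x xP xI; rewrite xP // /ofreal rmorphM; ring.
by rewrite -e mulNr mulrA -expr2 sqr_i mulN1r opprK.
Qed.

End Solution.

End CoefficientODE.

(** * Sobolev norms, and bounds from almost every time to every time *)

Section SobolevNorms.
Local Open Scope classical_set_scope.
Local Open Scope ring_scope.
Context {R : realType}.
Variables a b : R.
Hypothesis lt_ab : a < b.

Local Notation mu := (@lebesgue_measure R).
Local Notation fc f l := (fourier_coef a b f l).
Local Notation wbound := (wbound a b).
Local Notation weight := (weight a b).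
Local Notation freq := (freq a b).

Let L_gt0 : 0 < b - a. Proof. by rewrite subr_gt0. Qed.

Let hterm m f (l : int) : R := weight l ^+ m * normc (fc f l) ^+ 2.

Let hterm_ge0 m f l : 0 <= hterm m f l.
Proof. by rewrite mulr_ge0 ?sqr_ge0 // exprn_ge0 // weight_ge0. Qed.

Lemma esum_ge_seq (F : int -> R) (s : seq int) : uniq s ->
  ((\sum_(l <- s) F l)%:E <= \esum_(l in [set: int]) (F l)%:E)%E.
Proof.
move=> us; apply: esum_ge; exists [set` s].
  by split; [exact: finite_seq|].
by rewrite -fsbig_seq // sumEFin.
Qed.

Lemma esum_le_seq (F : int -> R) (K : R) : (forall l, 0 <= F l) ->
  (forall s : seq int, uniq s -> \sum_(l <- s) F l <= K) ->
  (\esum_(l in [set: int]) (F l)%:E <= K%:E)%E.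
Proof.
move=> F0 FK; apply: ge_ereal_sup => _ [A [finA _] <-].
rewrite fsbig_finite //= sumEFin lee_fin; apply: FK; exact: finmap.fset_uniq.
Qed.

Lemma HnormE m f : Hnorm a b m f = sqrte (\esum_(l in [set: int]) (hterm m f l)%:E)%E.
Proof. by []. Qed.

Lemma Hnorm_wbound m f M : (Hnorm a b m f <= M%:E)%E ->
  0 <= M /\ wbound m (fun l => fc f l) M.
Proof.
rewrite HnormE => fM.
have M0 : 0 <= M by rewrite -lee_fin; apply: le_trans fM; exact: sqrte_ge0.
split=> // s us; rewrite -lee_fin; apply: (le_trans (esum_ge_seq (hterm m f) us)).
have : (0 <= \esum_(l in [set: int]) (hterm m f l)%:E)%E.
  by apply: esum_ge0 => l _; rewrite lee_fin.
move: fM; case: (\esum_(l in _) _)%E => [y| |] //=.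
rewrite !lee_fin => yM y0.
by rewrite -(sqr_sqrtr y0) ler_pXn2r // nnegrE sqrtr_ge0.
Qed.

(** [fine] sends an infinite norm to 0, so finiteness has to be proved: Bessel's inequality for [f]
    and its m-th derivative suffices, since (1 + u)^m <= 2^m (1 + u^m). *)
Lemma Hper_wbound m f : Hper a b m f ->
  0 <= fine (Hnorm a b m f) /\ wbound m (fun l => fc f l) (fine (Hnorm a b m f)).
Proof.
move=> [D hD]; have [_ DL _ _] := hD.
pose K := 2 ^+ m * ((L2sq a b (D 0%N) + L2sq a b (D m)) / (b - a)).
have le_weight l : weight l ^+ m <= 2 ^+ m * (1 + (freq l ^+ 2) ^+ m).
  have w0 := weight_ge0 a b l; rewrite /weight in w0 *.
  have := sqr_ge0 (freq l); move: (freq l ^+ 2) => u u0.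
  have [u1|/ltW u1] := leP u 1.
    apply: (@le_trans _ _ (2 ^+ m)).
      by apply: lerXn2r; rewrite ?nnegrE; lra.
    by rewrite ler_peMr ?exprn_ge0 // lerDl exprn_ge0.
  apply: (@le_trans _ _ ((2 * u) ^+ m)).
    by apply: lerXn2r; rewrite ?nnegrE; lra.
  by rewrite exprMn ler_wpM2l ?exprn_ge0 // lerDr.
have bound s : uniq s -> \sum_(l <- s) hterm m f l <= K.
  move=> us; apply: (@le_trans _ _ (2 ^+ m * \sum_(l <- s)
      (normc (fc (D 0%N) l) ^+ 2 + normc (fc (D m) l) ^+ 2))).
    rewrite mulr_sumr; apply: ler_sum => l _.
    rewrite /hterm !(Hper_fourier_coefD lt_ab l hD) // expr0 mul1r.
    move: (fc f l) (le_weight l) => z; rewrite normcM normcX normcM => lw.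
    have -> : normc 'i%C = 1 :> R by rewrite /= expr0n /= add0r expr1n sqrtr1.
    rewrite mul1r normc_real exprMn exprAC real_normK ?num_real //.
    rewrite -[X in X + _]mul1r -mulrDl mulrA.
    by rewrite ler_wpM2r ?sqr_ge0.
  rewrite /K ler_wpM2l ?exprn_ge0 // ler_pdivlMr // mulrC big_split /= mulrDr.
  by apply: lerD; apply: bessel => //; exact: DL.
have fin : (Hnorm a b m f < +oo)%E.
  rewrite HnormE; have := esum_le_seq (hterm_ge0 m f) bound.
  by case: (\esum_(l in _) _)%E => [y| |] //=; rewrite ltry.
have fin' : Hnorm a b m f \is a fin_num.
  by rewrite ge0_fin_numE // HnormE sqrte_ge0.
by apply: Hnorm_wbound; rewrite fineK.
Qed.

Lemma ae_dense (P : R -> Prop) c d : {ae @lebesgue_measure R, forall t, P t} -> c < d ->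
  exists2 t, c < t < d & P t.
Proof.
move=> [A [mA A0 PA]] cd; apply: contrapT => nP.
have sub : (`]c, d[ : set R) `<=` A.
  move=> t /=; rewrite in_itv /= => tI; apply: PA => Pt.
  by apply: nP; exists t.
have : (mu (`]c, d[ : set R) <= mu A)%E by apply: le_measure => //; rewrite inE.
rewrite A0 lebesgue_measure_itv /= lte_fin cd -EFinB lee_fin; lra.
Qed.

(** Each finite weighted sum is continuous in time, so a violation at one instant would persist on
    an interval, which no null set contains. *)
Lemma ccontinuous_wbound m (c : R -> int -> R[i]) M S :
  (forall l, ccontinuous (c ^~ l)) -> 0 < S ->
  {ae @lebesgue_measure R, forall t, t \in `[0, S] -> wbound m (c t) M} ->
  forall t, 0 <= t <= S -> wbound m (c t) M.
Proof.
move=> cc S0 ae t /andP[t0 tS] s us; apply: contrapT => /negP; rewrite -ltNge => lt.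
pose F t := \sum_(l <- s) weight l ^+ m * normc (c t l) ^+ 2.
have Fc : continuous F.
  rewrite /F; elim: (s) => [|l s' IHs] u.
    by rewrite (_ : (fun t => _) = cst 0); [exact: cvg_cst|apply/funext => x; rewrite big_nil].
  pose G (z : R[i]) := weight l ^+ m * (Re z ^+ 2 + Im z ^+ 2).
  pose H t := \sum_(k <- s') weight k ^+ m * normc (c t k) ^+ 2.
  rewrite (_ : (fun t => _) = fun t => G (c t l) + H t); last first.
    by apply/funext => x; rewrite big_cons sqr_normcE.
  have [cr ci] := cc l; apply: cvgD; last exact: IHs.
  apply: cvgM; first exact: cvg_cst.
  apply: cvgD; under eq_fun do rewrite expr2; rewrite expr2;
    by apply: cvgM; first [exact: cr|exact: ci].
have gap : 0 < F t - M ^+ 2 by rewrite subr_gt0.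
have /cvgrPdist_lt/(_ _ gap)/nbhs_ballP[r r0 rP] := Fc t.
(* The interval lies to the right of [t], except at the final time, where it lies to the left. *)
have [c0 [d0 [cd cS near]]] : exists c d, [/\ c < d, 0 <= c /\ d <= S &
    forall u, c < u < d -> `|t - u| < r].
  have [tS'|tS'] := ltP t S.
    exists t, (Num.min S (t + r)); split.
    - by rewrite lt_min tS' ltrDl.
    - by split=> //; rewrite ge_min lexx.
    by move=> u; rewrite lt_min => /and3P[h1 h2 h3]; rewrite distrC ltr_norml; lra.
  exists (Num.max 0 (t - r)), t; split.
  - by rewrite gt_max gtrBl r0 (lt_le_trans S0 tS').
  - by split=> //; rewrite le_max lexx.
  by move=> u; rewrite gt_max => /andP[/andP[h1 h2] h3]; rewrite ltr_norml; lra.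
have [u /andP[u1 u2] Pu] := ae_dense ae cd.
have uI : u \in `[0, S] by rewrite in_itv /=; case: cS => h1 h2; apply/andP; split; lra.
have FuM : F u <= M ^+ 2 by exact: Pu.
have := rP u; rewrite /ball /= => /(_ (near _ _)).
rewrite u1 u2 => /(_ isT); rewrite ltr_norml; lra.
Qed.

End SobolevNorms.

(** * From coefficients to the L^2 error *)

Section Convergence.
Local Open Scope classical_set_scope.
Local Open Scope ring_scope.
Context {R : realType}.
Variables a b : R.
Hypothesis lt_ab : a < b.

Local Notation fc f l := (fourier_coef a b f l).
Local Notation fsum := (fourier_sum a b).
Local Notation wave := (wave a b).
Local Notation wbound := (wbound a b).
Local Notation L2 := (L2 a b).
Local Notation L2sq := (L2sq a b).

Let L_gt0 : 0 < b - a. Proof. by rewrite subr_gt0. Qed.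

Lemma Hper_le p q (phi : R -> R[i]) : (p <= q)%N -> Hper a b q phi -> Hper a b p phi.
Proof.
move=> pq [D [D0 DL wD cD]]; exists D; split=> // k kp.
- by apply: DL; exact: leq_trans pq.
- by apply: wD; exact: leq_trans pq.
by apply: cD; exact: leq_trans pq.
Qed.

Lemma L2sq_le (f w : R -> R[i]) K : L2 f -> L2 w ->
  (forall x, a < x < b -> normc (f x) ^+ 2 <= K + 2 * normc (w x) ^+ 2) ->
  L2sq f <= K * (b - a) + 2 * L2sq w.
Proof.
move=> /L2P[_ fi] /L2P[_ wi] fw.
have wi2 := rintegrableZ 2 wi; have Ki := rintegrable_cst lt_ab K.
rewrite -(Rintegral_Iab_cst lt_ab) -RintegralZl // -RintegralD //.
by apply: le_Rintegral => //; exact: rintegrableD.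
Qed.

Section Grid.
Variable N : nat.
Hypothesis N_gt0 : (0 < N)%N.
Hypothesis N_even : ~~ odd N.

Local Notation blocks P := ((2 * P + 1) * N)%N.
Local Notation h := (mesh a b N).

Definition low (l : int) : bool := (- (N./2)%:Z <= l) && (l < (N./2)%:Z).

Lemma low_mode (k : 'I_N) : low (mode N k).
Proof. by rewrite /low mode_ge // mode_lt. Qed.

Lemma sum_low (W : nmodType) P (F : int -> W) :
  \sum_(j < blocks P) (if low (mode (blocks P) j) then F (mode (blocks P) j) else 0) =
  \sum_(k < N) F (mode N k).
Proof.
rewrite (sum_blocks N_gt0 N_even P (fun l => if low l then F l else 0)).
apply: eq_bigr => k _; have P1 : (P < 2 * P + 1)%N by lia.
rewrite (bigD1 (Ordinal P1)) //= subrr mul0r addr0 low_mode big1 ?addr0 // => q.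
rewrite -val_eqE /= => qP; case: ifP => //; rewrite /low.
have := mode_ge N_gt0 N_even k; have := mode_lt N_gt0 N_even k; have := half_double N_even.
move: (mode N k) => r hN r1 r2; set d := q%:Z - P%:Z.
have [d0|d0] : d >= 1 \/ d <= -1 by rewrite /d; lia.
  have : N%:Z <= d * N%:Z by rewrite ler_peMl.
  by move=> ? /andP[]; lia.
have : d * N%:Z <= - N%:Z by rewrite -mulN1r ler_wpM2r.
by move=> ? /andP[]; lia.
Qed.

Lemma blocks_double P : blocks P = (P * N + N./2).*2.
Proof. by have := even_halfK N_even; lia. Qed.

Lemma fourier_sum_blocks (f : R -> R[i]) P x :
  \sum_(j < blocks P) fc f (mode (blocks P) j) * wave (mode (blocks P) j) x =
  fsum f (P * N + N./2) x.
Proof. by rewrite fourier_sum_mode -blocks_double. Qed.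

Lemma node_itv (i : 'I_N) : a <= node a b N i <= b.
Proof.
have N0 : 0 < N%:R :> R by rewrite ltr0n.
have iN : i%:R <= N%:R :> R by rewrite ler_nat ltnW.
rewrite /node /mesh lerDl; apply/andP; split.
  by rewrite mulr_ge0 // divr_ge0 // ltW.
by rewrite -lerBrDl mulrCA ger_pMr // ler_pdivrMr // mul1r.
Qed.

(** The modes in T_N contribute [E] and the others h^m M. Parseval is needed only for finite sums:
    [f] is replaced by a long partial sum, and the uniform remainder tends to 0. *)
Lemma L2_interpolation_error m (f : R -> R[i]) (y : int -> R[i]) M E :
  Hper a b 2 f -> 0 <= M -> wbound m (fun l => fc f l) M -> 0 <= E ->
  nmode N (fun l => fc f l - y l) <= E ->
  L2 (fun x => f x - trigpoly a b N y x) /\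
  L2sq (fun x => f x - trigpoly a b N y x) <= 2 * (b - a) * (E + h ^+ m * M) ^+ 2.
Proof.
move=> hf M0 fM E0 fE; have fL := Hper_L2 hf.
have h0 := ltW (mesh_gt0 lt_ab N_gt0).
have hM : 0 <= h ^+ m * M by rewrite mulr_ge0 ?exprn_ge0.
have yL : L2 (trigpoly a b N y).
  by apply: L2_sum => // k; apply: L2Z; exact: wave_L2.
have dL := L2B fL yL; split=> //.
have [C C0 fC] := Hper2_fourier_sum lt_ab hf.
pose z l := fc f l - (if low l then y l else 0).
have zsum P : \sum_(j < blocks P) normc (z (mode (blocks P) j)) ^+ 2 <=
    E ^+ 2 + (h ^+ m * M) ^+ 2.
  pose x l := if low l then 0 else fc f l.
  have xM : wbound m x M.
    move=> s us; apply: le_trans (fM s us); apply: ler_sum => l _.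
    rewrite ler_wpM2l ?exprn_ge0 ?weight_ge0 // /x; case: ifP => // _.
    by rewrite normc0 expr0n /= sqr_ge0.
  have zE l : normc (z l) ^+ 2 =
      (if low l then normc (fc f l - y l) ^+ 2 else 0) + normc (high N x l) ^+ 2.
    rewrite /z /high /x; case: ifP => [_|lowl].
      by rewrite if_same normc0 expr0n addr0.
    rewrite subr0 add0r ifT //; move: lowl; rewrite /low => /negbT.
    by rewrite negb_and -!ltNge -leNgt; have := half_double N_even; lia.
  rewrite (eq_bigr _ (fun j _ => zE _)) big_split /=; apply: lerD.
    rewrite (sum_low P (fun l => normc (fc f l - y l) ^+ 2)).
    by rewrite -sqr_n2 -/(nmode N (fun l => fc f l - y l)) ler_pXn2r ?nnegrE ?n2_ge0.
  have := @high_n2 R a b lt_ab N N_gt0 m x M (blocks P) (fun j => mode (blocks P) j) 1.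
  rewrite [h / _]divr1 mulr1 => hn; rewrite -sqr_n2 ler_pXn2r ?nnegrE ?n2_ge0 //.
  apply: hn => //; first by move=> i j; rewrite /mode => e; apply: val_inj => /=; lia.
  by move=> i; rewrite /high; case: ifP => //; rewrite eqxx.
apply/ler_addgt0Pr => e e0.
(* Chosen so that a remainder with square at most [d], doubled by (q + u)^2 <= 2 q^2 + 2 u^2,
   integrates to at most [e]. *)
pose d := e / (2 * (b - a)).
have d0 : 0 < d by rewrite divr_gt0 // mulr_gt0.
have sd0 : 0 < Num.sqrt d by rewrite sqrtr_gt0.
pose P := (Num.truncn (C / Num.sqrt d)).+1.
have PN : (P <= P * N + N./2)%N by rewrite (leq_trans _ (leq_addr _ _)) // leq_pmulr.
set H := (P * N + N./2)%N in PN.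
have HC : C / H%:R <= Num.sqrt d.
  have H0 : 0 < H%:R :> R by rewrite ltr0n (leq_trans _ PN).
  rewrite ler_pdivrMr // mulrC -ler_pdivrMr // ltW //.
  by apply: lt_le_trans (truncnS_gt _) _; rewrite ler_nat.
pose s := [seq mode (blocks P) j | j <- iota 0 (blocks P)].
have us : uniq s by rewrite map_inj_uniq ?iota_uniq // => i j; rewrite /mode; lia.
have sE (W : nmodType) (F : int -> W) : \sum_(l <- s) F l = \sum_(j < blocks P) F (mode (blocks P) j).
  by rewrite big_map -[X in iota _ X]subn0 -/(index_iota 0 _) big_mkord.
have := @L2sq_le _ (trig a b s z) (2 * d) dL (trig_L2 lt_ab s z).
rewrite parseval_trig // sE => le; apply: (le_trans (le _)).
  move=> x /andP[ax xb]; have xI : a <= x <= b by rewrite !ltW.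
  have -> : trig a b s z x = fsum f H x - trigpoly a b N y x.
    rewrite /trig sE -fourier_sum_blocks /trigpoly.
    rewrite -(sum_low P (fun l => y l * wave l x)) -sumrB.
    by apply: eq_bigr => j _; rewrite mulrBl; case: ifP => _; rewrite ?mul0r.
  have := fC H x (leq_trans (ltn0Sn _) PN) xI; move=> fH; have {}fH := le_trans fH HC.
  have -> : f x - trigpoly a b N y x =
    - (fsum f H x - f x) + (fsum f H x - trigpoly a b N y x) by ring.
  have := le_normcD (- (fsum f H x - f x)) (fsum f H x - trigpoly a b N y x).
  rewrite normcN; have := normc_ge0 (fsum f H x - f x).
  have := sqr_sqrtr (ltW d0); move: fH; move: (Num.sqrt d) => r.
  have := normc_ge0 (- (fsum f H x - f x) + (fsum f H x - trigpoly a b N y x)).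
  have := normc_ge0 (fsum f H x - trigpoly a b N y x).
  move: (normc (_ + _)) (normc (fsum f H x - f x)) (normc (fsum f H x - trigpoly _ _ _ _ _)).
  move=> p q u u0 p0 qr rd q0 pqu.
  have : p ^+ 2 <= (q + u) ^+ 2 by rewrite ler_pXn2r ?nnegrE ?addr_ge0.
  have : q ^+ 2 <= r ^+ 2 by rewrite ler_pXn2r ?nnegrE // (le_trans q0).
  by rewrite rd; have := sqr_ge0 (q - u); nra.
have -> : 2 * d * (b - a) = e by rewrite /d; field; rewrite gt_eqF.
rewrite addrC lerD2r mulrA ler_wpM2l ?mulr_ge0 ?(ltW L_gt0) //.
apply: (le_trans (zsum P)).
have := mulr_ge0 E0 hM; nra.
Qed.

(** 6 = 5 + 1: aliasing of the initial datum, and the modes of the solution outside T_N at the final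
    time. *)
Lemma tsfp_error m (V : R -> R) eps psi0 psi dpsi M T tau n :
  (2 <= m)%N -> Hper a b (maxn m 5) (ofreal V) -> 0 < eps <= 1 ->
  exact_solution a b V eps psi0 psi dpsi -> 0 < T ->
  Linfty_Hper_le a b m T psi M -> 0 < tau -> n%:R * tau <= T ->
  let v := fine (Hnorm a b (maxn m 5) (ofreal V)) in
  let f x := psi (n%:R * tau) x - interpolant a b (tsfp a b N V eps tau psi0 n) x in
  [/\ 0 <= v, 0 <= M, L2 f & L2sq f <= 2 * (b - a) * (6 * h ^+ m * M +
    eps * (n%:R * tau) * (step_cst a b v M * (h ^+ m + tau ^+ 2))) ^+ 2].
Proof.
move=> m2 VH /andP[eps0 eps1] sol T0 HM tau0 nT v f.
have [v0 vb] := Hper_wbound lt_ab VH.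
have VH2 : Hper a b 2 (ofreal V).
  by apply: Hper_le VH; rewrite (leq_trans _ (leq_maxl _ _)).
have M0 : 0 <= M.
  have [t /andP[t0 tT]] := ae_dense HM T0.
  by case=> [|_ /Hnorm_wbound[]//]; rewrite in_itv /= !ltW.
have cc l := sol_coef_continuous lt_ab sol l.
have cM : forall t, 0 <= t <= T -> wbound m (sol_coef a b psi t) M.
  apply: ccontinuous_wbound => //.
  refine (lebesgue_ae_imp _ HM) => t tP tI; have [_ /Hnorm_wbound[_ wM]] := tP tI.
  move: tI; rewrite in_itv /= => /andP[t0 _] s us.
  by apply: le_trans (wM s us); apply: ler_sum => l _; rewrite sol_coefE.
have wM t : 0 <= t <= T -> wbound m (fun l => fc (psi t) l) M.
  move=> tI s us; apply: le_trans (cM t tI s us); apply: ler_sum => l _.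
  by rewrite sol_coefE //; case/andP: tI.
have S0 : 0 <= c_l1 a b * M by rewrite mulr_ge0 // (le_trans ler01) // c_l1_ge1.
have psiH t : 0 <= t -> Hper a b 2 (psi t) by exact: (solution_Hper sol).
have sup t x : 0 <= t <= T -> a <= x <= b -> normc (psi t x) <= c_l1 a b * M.
  move=> tI xI; apply: Hper2_sup => //; first by apply: psiH; case/andP: tI.
  by apply: wbound_le (wM t tI); exact: ltnW.
have large (C e : R) : 0 < e -> exists P, forall P', (P <= P')%N -> C / (P' * N + N./2)%:R <= e.
  move=> e0; exists (Num.truncn (C / e)).+1 => P' PP.
  have PN : (P' <= P' * N + N./2)%N by rewrite (leq_trans _ (leq_addr _ _)) // leq_pmulr.
  have {}PN := leq_trans PP PN.
  have H0 : 0 < (P' * N + N./2)%:R :> R by rewrite ltr0n (leq_trans _ PN).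
  rewrite ler_pdivrMr // mulrC -ler_pdivrMr // ltW //.
  by apply: lt_le_trans (truncnS_gt _) _; rewrite ler_nat.
have Hpos P : (0 < P)%N -> (0 < P * N + N./2)%N by move=> P0; rewrite addn_gt0 muln_gt0 P0 N_gt0.
have Vg del : 0 < del -> exists P,
  (forall i : 'I_N, normc ((V (node a b N i))%:C -
     \sum_(j < blocks P) fc (ofreal V) (mode (blocks P) j) * wave (mode (blocks P) j) (node a b N i)) <= del) /\
  (forall s, 0 < s <= T -> forall k : 'I_N, normc (pot_coef a b V psi s (mode N k) -
     \sum_(j < blocks P) fc (ofreal V) (mode (blocks P) j) *
       sol_coef a b psi s (mode N k - mode (blocks P) j)) <= del).
  move=> del0; have [C C0 VC] := Hper2_fourier_sum lt_ab VH2.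
  (* One uniform accuracy for the potential serves both requirements: [e] on the nodes, and
     [2 * (e * S)] for the product, where S bounds the solution. *)
  pose e := del / (1 + 2 * (c_l1 a b * M)).
  have S1 : 0 < 1 + 2 * (c_l1 a b * M) by rewrite ltr_pwDl // mulr_ge0.
  have e0 : 0 < e by rewrite divr_gt0.
  have edel : e + 2 * (e * (c_l1 a b * M)) = del by rewrite /e; field; rewrite gt_eqF.
  have [P0 /(_ P0.+1 (leqnSn _)) Pe] := large C e e0; exists P0.+1; set P := P0.+1 in Pe *.
  have VP x : a <= x <= b -> normc (ofreal V x - fsum (ofreal V) (P * N + N./2) x) <= e.
    by move=> xI; rewrite normc_subC; apply: le_trans Pe; apply: VC => //; exact: Hpos.
  split=> [i|s /andP[s0 sT] k].
    rewrite fourier_sum_blocks; apply: (le_trans (VP _ (node_itv i))).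
    by rewrite -edel lerDl mulr_ge0 // mulr_ge0 // ltW.
  under eq_bigr do rewrite sol_coefE ?(ltW s0) //.
  rewrite /pot_coef max_l ?(ltW s0) // blocks_double.
  have sI : 0 <= s <= T by rewrite ltW.
  have [K [_ mV _ _]] := Hper2_continuous lt_ab VH2.
  have := @fourier_coef_product R a b lt_ab (ofreal V) (psi s) (P * N + N./2) e
    (c_l1 a b * M) (mode N k) (Hper_L2 (psiH _ (ltW s0))) mV.
  move=> prod; apply: le_trans (prod _ (ltW e0) _) _.
  - by move=> x /andP[h1 h2]; apply: sup => //; rewrite !ltW.
  - by move=> x /andP[h1 h2]; apply: VP; rewrite !ltW.
  by rewrite -edel lerDr ltW.
have psi0P del : 0 < del -> exists P, forall i : 'I_N,
  normc (psi0 (node a b N i) -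
    \sum_(j < blocks P) sol_coef a b psi 0 (mode (blocks P) j) * wave (mode (blocks P) j) (node a b N i)) <= del.
  move=> del0; have [C C0 pC] := Hper2_fourier_sum lt_ab (psiH 0 (lexx 0)).
  have [P0 /(_ P0.+1 (leqnSn _)) Pe] := large C del del0; exists P0.+1 => i.
  set P := P0.+1 in Pe *; have iI := node_itv i.
  have -> : psi0 (node a b N i) = psi 0 (node a b N i).
    by have [e0 _ _ _ _] := sol; rewrite e0 // in_itv.
  under eq_bigr do rewrite sol_coefE //.
  rewrite fourier_sum_blocks normc_subC; apply: le_trans Pe.
  by apply: pC => //; exact: Hpos.
have main := @global_error_le R a b lt_ab N N_gt0 N_even (fun l => fc (ofreal V) l)
  (maxn m 5) m v M v0 M0 m2 (leq_maxr _ _) (leq_maxl _ _) vb V eps tau psi0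
  (sol_coef a b psi) (pot_coef a b V psi) T eps0 eps1 tau0 cc
  (fun s s0 l => sol_coef_ode lt_ab VH2 sol l s0) cM Vg psi0P n nT.
have nt0 : 0 <= n%:R * tau by rewrite mulr_ge0 // ltW.
have h0 := ltW (mesh_gt0 lt_ab N_gt0).
set E := (X in _ <= X) in main.
have E0 : 0 <= E by apply: le_trans main; exact: n2_ge0.
have := @L2_interpolation_error m (psi (n%:R * tau)) (discrete_coef a b (tsfp a b N V eps tau psi0 n))
  M E (psiH _ nt0) M0 (wM _ _) E0 _.
case.
- by rewrite nt0.
- apply: le_trans main; apply: le_of_eq.
  by rewrite /global_error /nmode; congr n2; apply/funext => k; rewrite sol_coefE.
move=> fL fE; split=> //; apply: le_trans fE _.
apply: le_of_eq; congr (_ * _ ^+ 2); rewrite /E; ring.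
Qed.

End Grid.

End Convergence.

Local Close Scope complex_scope.

Theorem theorem2p1 (R : realType) (a b : R) (m : nat) :
  a < b -> (2 <= m)%N ->
  exists (C0 C1 : R) (Ct : R -> R -> R),
    [/\ 0 < C0, 0 < C1, forall M v : R, 0 < Ct M v &
    forall (V : R -> R) (psi0 : R -> R[i]) (psi dpsi : R -> R -> R -> R[i])
           (M M' : R -> R),
      Hper a b (maxn m 5) (ofreal V) ->
      (forall eps : R, 0 < eps <= 1 ->
         exact_solution a b V eps psi0 (psi eps) (dpsi eps)) ->
      (forall T eps : R, 0 < T -> 0 < eps <= 1 ->
         Linfty_Hper_le a b m (T / eps) (psi eps) (M T)) ->
      (forall T eps : R, 0 < T -> 0 < eps <= 1 ->
         Linfty_Hper_le a b (m - 2) (T / eps) (dpsi eps) (M' T)) ->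
      forall (T eps tau : R) (N n : nat),
        0 < T -> 0 < eps <= 1 -> 0 < tau -> (0 < N)%N -> ~~ odd N ->
        n%:R <= T / eps / tau ->
        (L2norm a b (fun x => (psi eps (n%:R * tau) x -
                              interpolant a b (tsfp a b N V eps tau psi0 n) x)%R)
         <= ((C0 + C1 * eps * (n%:R * tau)) *
             Ct (M T) (fine (Hnorm a b (maxn m 5) (ofreal V))) *
             (mesh a b N ^+ m + tau ^+ 2))%:E)%E].
Proof.
move=> lt_ab m2; have L0 : 0 < b - a by rewrite subr_gt0.
pose k := Num.sqrt (2 * (b - a)); pose c := c_l1 a b.
have k0 : 0 < k by rewrite sqrtr_gt0 mulr_gt0.
have c1 : 1 <= c := c_l1_ge1 a b.
(* [k] is the root of the prefactor in [tsfp_error], and 7c + 2c^2 comes from [step_cst]. The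
   potential enters that constant quadratically; adding 1 to each norm gives positivity and lets one
   factor dominate both terms. *)
exists (6 * k), (k * (7 * c + 2 * c ^+ 2)), (fun M v => (1 + `|M|) * (1 + `|v|) ^+ 2).
split; first by rewrite mulr_gt0.
- by rewrite mulr_gt0 //; nra.
- by move=> M v; rewrite mulr_gt0 ?exprn_gt0 // ltr_pwDl.
move=> V psi0 psi dpsi M M' VH sol HM _ T eps tau N n T0 epsI tau0 N0 Ne nT.
have /andP[eps0 _] := epsI.
have [] := @tsfp_error R a b lt_ab N N0 Ne m V eps psi0 (psi eps) (dpsi eps) (M T) (T / eps)
  tau n m2 VH epsI (sol _ epsI) (divr_gt0 T0 eps0) (HM _ _ T0 epsI) tau0 _.
  by rewrite -ler_pdivlMr.
set v := fine _ => v0 M0 fL fE; rewrite L2normE // lee_fin.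
have h0 : 0 < mesh a b N := mesh_gt0 lt_ab N0.
have hm : 0 <= mesh a b N ^+ m by rewrite exprn_ge0 // ltW.
have t0 : 0 <= n%:R * tau by rewrite mulr_ge0 // ltW.
set Q := (X in 2 * (b - a) * X ^+ 2) in fE.
have Q0 : 0 <= Q.
  rewrite /Q /step_cst -/c; have c0 := le_trans ler01 c1.
  have tau2 := sqr_ge0 tau; have e0 := ltW eps0.
  by repeat first [assumption | exact: ler0n | apply: exprn_ge0 | apply: addr_ge0 | apply: mulr_ge0].
(* As [Q] is nonnegative, the root of the squared bound is exactly k Q. *)
apply: (@le_trans _ _ (k * Q)).
  rewrite -[leRHS]ger0_norm ?mulr_ge0 ?(ltW k0) // -sqrtr_sqr; apply: ler_wsqrtr.
  by rewrite exprMn /k sqr_sqrtr // mulr_ge0 // ltW.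
rewrite !ger0_norm // /Q /step_cst -/c.
clear Q Q0 fE; clearbody v.
move: (mesh a b N ^+ m) (n%:R * tau) (M T) v hm t0 M0 v0 => H s A w H0 s0 A0 w0.
have tau2 : 0 <= tau ^+ 2 by rewrite sqr_ge0.
move: (tau ^+ 2) tau2 => t2 t20.
have e1 : 6 * H * A <= 6 * ((1 + A) * (1 + w) ^+ 2) * (H + t2).
  have w1 : 1 <= (1 + w) ^+ 2 by rewrite exprn_ege1 // lerDl.
  have A1 : A <= (1 + A) * (1 + w) ^+ 2.
    by apply: (@le_trans _ _ (1 + A)); [rewrite lerDr|rewrite ler_peMr ?addr_ge0].
  have -> : 6 * H * A = 6 * A * H by ring.
  by apply: ler_pM; rewrite ?mulr_ge0 ?lerDl ?ler_pM2l.
have e2 : 7 * (c * w) * A + 2 * (c * w) ^+ 2 * A <=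
    (7 * c + 2 * c ^+ 2) * ((1 + A) * (1 + w) ^+ 2).
  have -> : 7 * (c * w) * A + 2 * (c * w) ^+ 2 * A = (7 * c * w + 2 * c ^+ 2 * w ^+ 2) * A by ring.
  have -> : (7 * c + 2 * c ^+ 2) * ((1 + A) * (1 + w) ^+ 2) =
    (7 * c * (1 + w) ^+ 2 + 2 * c ^+ 2 * (1 + w) ^+ 2) * (1 + A) by ring.
  have c0 := le_trans ler01 c1; have cc := sqr_ge0 c; have ww := sqr_ge0 w.
  apply: ler_pM => //; last by rewrite lerDr.
    by repeat first [assumption | exact: ler0n | apply: addr_ge0 | apply: mulr_ge0].
  by apply: lerD; rewrite ler_wpM2l ?mulr_ge0 //; nra.
set G := (1 + A) * _ in e1 e2 *.
have -> : (6 * k + k * (7 * c + 2 * c ^+ 2) * eps * s) * G * (H + t2) =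
  k * (6 * G * (H + t2) + eps * s * (((7 * c + 2 * c ^+ 2) * G) * (H + t2))) by ring.
rewrite ler_wpM2l ?(ltW k0) //; apply: lerD => //.
rewrite ler_wpM2l ?mulr_ge0 ?(ltW eps0) // ler_wpM2r // addr_ge0 //.
Qed.
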